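(* There is a deterministic algorithm that, given a prime $p$ and a squarefree polynomial $f \in \mathbb{F}_p[X]$ of degree $n \ge 1$ that fully splits over $\mathbb{F}_p$, finds all roots of $f$ in $\mathbb{F}_p$ in time $n p^{1/2+o(1)}$.
   Context: $\mathbb{F}_p$ is the finite field of $p$ elements, $p$ prime. A polynomial fully splits over $\mathbb{F}_p$ if it is a product of linear factors in $\mathbb{F}_p[X]$. Time may be measured either in arithmetic operations in $\mathbb{F}_p$ or in bit operations (these agree up to a factor $p^{o(1)}$). Here $o(1)$ denotes a quantity tending to $0$ as $p\to\infty$, uniformly in $n$ and $f$. *)

(* Defs.v *)
From HB Require Import structures.
From mathcomp Require Import all_boot all_order all_algebra.
From mathcomp Require Import all_classical all_reals all_analysis.

Set Implicit Arguments.
Unset Strict Implicit.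
Unset Printing Implicit Defensive.

Import Order.TTheory GRing.Theory Num.Theory.
Import numFieldNormedType.Exports.

Local Open Scope ring_scope.

(* Deterministic algorithms are programs for a random access machine whose
   registers and memory cells hold natural numbers, with structured control and
   logarithmic cost: an instruction is charged for the bit lengths of the
   numbers it handles, including addresses, at the schoolbook rate for
   multiplication and division.  Thus time means bit operations.  Programs are
   uniform: a [cmd] is a finite object that does not depend on the input. *)

Inductive binop := Add | Sub | Mul | Div | Mod.

(* [Sub] is truncated; [x %/ 0 = 0] and [x %% 0 = x]. *)
Definition binop_val (o : binop) (x y : nat) : nat :=
  match o with
  | Add => (x + y)%N
  | Sub => (x - y)%N
  | Mul => (x * y)%N
  | Div => (x %/ y)%N
  | Mod => (x %% y)%N
  end.

Definition bitlen (x : nat) : nat := (trunc_log 2 x).+1.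

Definition binop_cost (o : binop) (x y : nat) : nat :=
  match o with
  | Add | Sub => (bitlen x + bitlen y)%N
  | Mul | Div | Mod => (bitlen x * bitlen y)%N
  end.

Record state := State { reg : nat -> nat; mem : nat -> nat }.

Definition update (m : nat -> nat) (i v : nat) : nat -> nat :=
  fun j => if j == i then v else m j.

(* Register names are fixed in the program; memory is addressed only through
   the contents of a register. *)
Inductive instr :=
| Const of nat & nat                (* Const d c : r_d := c *)
| Binop of binop & nat & nat & nat  (* Binop o d a b : r_d := r_a o r_b *)
| Read of nat & nat                 (* Read d a : r_d := mem[r_a] *)
| Write of nat & nat.               (* Write a b : mem[r_a] := r_b *)

Definition instr_effect (i : instr) (s : state) : state :=
  match i with
  | Const d c => State (update (reg s) d c) (mem s)
  | Binop o d a b =>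
      State (update (reg s) d (binop_val o (reg s a) (reg s b))) (mem s)
  | Read d a => State (update (reg s) d (mem s (reg s a))) (mem s)
  | Write a b => State (reg s) (update (mem s) (reg s a) (reg s b))
  end.

Definition instr_cost (i : instr) (s : state) : nat :=
  match i with
  | Const _ c => bitlen c
  | Binop o _ a b => binop_cost o (reg s a) (reg s b)
  | Read _ a => (bitlen (reg s a) + bitlen (mem s (reg s a)))%N
  | Write a b => (bitlen (reg s a) + bitlen (reg s b))%N
  end.

Inductive cmd :=
| Skip
| Do of instr
| Seq of cmd & cmd
| If of nat & cmd & cmd             (* If a c1 c2 : c1 if r_a is nonzero, else c2 *)
| While of nat & cmd.               (* While a c : repeat c while r_a is nonzero *)

(* [exec c s s' t]: started in [s], the program [c] halts in [s'] after time
   [t].  There is no derivation for a run that does not halt. *)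
Inductive exec : cmd -> state -> state -> nat -> Prop :=
| exec_skip s : exec Skip s s 0
| exec_do i s : exec (Do i) s (instr_effect i s) (instr_cost i s)
| exec_seq c1 c2 s s1 s2 t1 t2 :
    exec c1 s s1 t1 -> exec c2 s1 s2 t2 ->
    exec (Seq c1 c2) s s2 (t1 + t2)%N
| exec_if_true a c1 c2 s s' t :
    reg s a != 0%N -> exec c1 s s' t ->
    exec (If a c1 c2) s s' (bitlen (reg s a) + t)%N
| exec_if_false a c1 c2 s s' t :
    reg s a = 0%N -> exec c2 s s' t ->
    exec (If a c1 c2) s s' (bitlen (reg s a) + t)%N
| exec_while_true a c s s1 s2 t1 t2 :
    reg s a != 0%N -> exec c s s1 t1 -> exec (While a c) s1 s2 t2 ->
    exec (While a c) s s2 (bitlen (reg s a) + t1 + t2)%N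
| exec_while_false a c s :
    reg s a = 0%N -> exec (While a c) s s (bitlen (reg s a)).

Lemma exec_deterministic c s s1 t1 s2 t2 :
  exec c s s1 t1 -> exec c s s2 t2 -> s1 = s2 /\ t1 = t2.
Proof.
move=> e1; elim: e1 s2 t2 => {c s s1 t1}.
- by move=> s s2 t2 e2; inversion e2.
- by move=> i s s2 t2 e2; inversion e2.
- move=> c1 c2 s s1 s2 t1 t2 _ IH1 _ IH2 s' t' e2; inversion e2; subst.
  match goal with H : exec c1 _ _ _ |- _ => case: (IH1 _ _ H) => ? ? end; subst.
  by match goal with H : exec c2 _ _ _ |- _ => case: (IH2 _ _ H) => ? ? end; subst.
- move=> a c1 c2 s s' t n0 _ IH s2 t2 e2; inversion e2; subst.
    by match goal with H : exec c1 _ _ _ |- _ => case: (IH _ _ H) => ? ? end; subst.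
  by move/eqP: n0.
- move=> a c1 c2 s s' t z _ IH s2 t2 e2; inversion e2; subst.
    by move/eqP: z; match goal with H : is_true (_ != _) |- _ => rewrite (negbTE H) end.
  by match goal with H : exec c2 _ _ _ |- _ => case: (IH _ _ H) => ? ? end; subst.
- move=> a c s s1 s2 t1 t2 n0 _ IH1 _ IH2 s' t' e2; inversion e2; subst.
    match goal with H : exec c _ _ _ |- _ => case: (IH1 _ _ H) => ? ? end; subst.
    by match goal with H : exec (While a c) _ _ _ |- _ => case: (IH2 _ _ H) => ? ? end; subst.
  by move/eqP: n0.
- move=> a c s z s2 t2 e2; inversion e2; subst=> //.
  by move/eqP: z; match goal with H : is_true (_ != _) |- _ => rewrite (negbTE H) end.
Qed.

(* Initially register 0 holds the prime, register 1 the degree, memory cell [i]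
   the representative in {0, ..., p - 1} of the coefficient of 'X^i, and every
   other register and cell holds 0. *)
Definition input (p : nat) (f : {poly 'F_p}) : state :=
  State (update (update (fun=> 0%N) 1 (size f).-1) 0 p) (fun i => val f`_i).

(* On halting, register 0 holds the length of the output list, which occupies
   memory cells 0, 1, ... *)
Definition output (s : state) : seq nat := mkseq (mem s) (reg s 0).

Definition squarefree_poly (F : fieldType) (f : {poly F}) : Prop :=
  forall g : {poly F}, g ^+ 2 %| f -> size g = 1%N.

Definition fully_splits (F : fieldType) (f : {poly F}) : Prop :=
  exists2 s : seq {poly F},
    {in s, forall g : {poly F}, size g = 2%N} & f = \prod_(g <- s) g.

(* Main.v *)
Require Import Defs.
From mathcomp Require Import all_boot all_order all_algebra all_field.
From mathcomp Require Import zify ring.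
Import Defs.

Set Implicit Arguments.
Unset Strict Implicit.
Unset Printing Implicit Defensive.

(** Let [g] be a primitive root modulo [p] and [B] a power of 2 with
    [sqrt p <= B < 2 sqrt p]; the nonzero residues are the [g ^ (B j + i)] with
    [i, j < B].  The polynomial [H(Y) = \prod_(i < B) f(g ^ i Y)] has degree
    [n B]; it is built by [log B] doublings [F(Y) F(g ^ (2 ^ l) Y)], and
    Bluestein's chirp transform yields all [H(g ^ (B j))] from one product of
    polynomials of length [O(n B)].  At most [min(2 n, B)] of these values
    vanish, and for each such [j] one chirp transform of length [O(n + B)] gives
    the [f(g ^ (B j + i))], hence the roots: [O(n B)] coefficients in all.

    Polynomials of length [r ^ k] are multiplied in almost linear time as
    follows.  Exponents written in base [r] add without carry in base [2 r], so
    the product is a [k]-dimensional cyclic convolution of order [2 r].  With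
    [r = 2 ^ (t + 6)] and [t = isqrt (log p)], the element 2 is a [2 r]-th root
    of unity modulo [2 ^ r + 1], and [k] is [O(t)]; the overhead over linear time is
    [2 ^ O(t) = p ^ o(1)].

    A primitive root is assembled from the factorization of [p - 1], by trial
    division up to [B], and from a non-[l]-th power for each prime [l] dividing
    [p - 1]; the least such element is at most [B].

    The program is written in a language of [for] loops over sixteen arrays, with
    a compiler to the random access machine; bounds on word sizes and running
    times are checked by computation on the syntax. *)

(** Cost is counted in bits, so the [O(n B)] numbers handled must all have [p ^ o(1)] bits. The
    field of [p] elements need not contain roots of unity of a useful order, whereas modulo
    [2 ^ r + 1] the root 2 is explicit for every [r]. Its order [2 r] is only [p ^ o(1)], so a long
    product has to be cut into [k] short dimensions. Each dimension doubles the data, a loss of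
    [2 ^ k], and each pass costs a factor of order [r]; as [k] is about the logarithm of the length
    divided by that of [r], taking the logarithm of [r] near the square root of [log p] balances the
    two. The ring has zero divisors in general, so orthogonality is drawn from [2 ^ r = -1] without
    any division, and the inverse of [2 r] is again a power of 2. Both bounds on the number of
    vanishing values matter: a block costs about [n + B], where the term [n] is summed over at most
    [B] blocks and the term [B] over at most [2 n]. The factor 2 is there because the last block
    runs past [p - 1], so that a root may be met twice. Squarefreeness and splitting give [n <= p],
    which bounds all lengths by [4 p ^ 2]. *)

(** * Source language: syntax, denotation and step count *)

Inductive expr :=
| Num of nat
| Var of nat
| Op of binop & expr & expr
| Peek of expr.

(* Memory is split into sixteen interleaved arrays. *)
Definition cell (A i : nat) : nat := i * 16 + A.
Definition cell_expr (A : nat) (i : expr) : expr :=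
  Op Add (Op Mul i (Num 16)) (Num A).
Definition Get (A : nat) (i : expr) : expr := Peek (cell_expr A i).
Definition arr (A : nat) (s : state) (i : nat) : nat := mem s (cell A i).

Inductive com :=
| Asg of nat & expr
| St of nat & expr & expr            (* St A i e : A[i] := e *)
| Raw of expr & expr                 (* Raw a e : mem[a] := e *)
| Bits of nat & nat                  (* Bits d x : r_d := bitlen r_x *)
| CSeq of com & com
| CIf of expr & com & com
| For of nat & expr & com.           (* the bound is evaluated once, on entry *)

Fixpoint ev (e : expr) (s : state) : nat :=
  match e with
  | Num c => c
  | Var x => reg s x
  | Op o a b => binop_val o (ev a s) (ev b s)
  | Peek a => mem s (ev a s)
  end.

Definition setr (s : state) (x v : nat) : state :=
  State (update (reg s) x v) (mem s).
Definition setm (s : state) (a v : nat) : state :=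
  State (reg s) (update (mem s) a v).

Fixpoint den (c : com) (s : state) : state :=
  match c with
  | Asg x e => setr s x (ev e s)
  | St A i e => setm s (cell A (ev i s)) (ev e s)
  | Raw a e => setm s (ev a s) (ev e s)
  | Bits d x => setr s d (bitlen (reg s x))
  | CSeq c1 c2 => den c2 (den c1 s)
  | CIf e c1 c2 => if ev e s != 0 then den c1 s else den c2 s
  | For x e b => iteri (ev e s) (fun i s' => den b (setr s' x i)) s
  end.

Definition loop_state (x : nat) (b : com) (s : state) (i : nat) : state :=
  iteri i (fun i s' => den b (setr s' x i)) s.

Fixpoint esz (e : expr) : nat :=
  match e with
  | Num _ => 1
  | Var _ => 2
  | Op _ a b => esz a + esz b + 1
  | Peek a => esz a + 1
  end.

(** Bounds the number of instructions and tests of the compiled code. On words of [W] bits each of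
    them costs at most [2 * W ^ 2], so running time separates into this count and a bound on word
    size. *)
Fixpoint steps (c : com) (s : state) : nat :=
  match c with
  | Asg x e => esz e + 2
  | St A i e => esz i + esz e + 5
  | Raw a e => esz a + esz e + 1
  | Bits d x => 5 * bitlen (reg s x) + 6
  | CSeq c1 c2 => steps c1 s + steps c2 (den c1 s)
  | CIf e c1 c2 => esz e + 1 + (if ev e s != 0 then steps c1 s else steps c2 s)
  | For x e b => esz e + 2 +
      \sum_(i < ev e s) (steps b (setr (loop_state x b s i) x i) + 6)
  end.

(** * Compilation *)

(* Registers below [nvars] are program variables, the others are temporaries. *)
Definition nvars : nat := 64.

Fixpoint cexpr (d : nat) (e : expr) : cmd :=
  match e with
  | Num c => Do (Const d c)
  | Var x => Seq (Do (Const d 0)) (Do (Binop Add d x d))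
  | Op o a b => Seq (cexpr d a) (Seq (cexpr d.+1 b) (Do (Binop o d d d.+1)))
  | Peek a => Seq (cexpr d a) (Do (Read d d))
  end.

(** [d] is the lowest free temporary. A [For] keeps the number of remaining rounds in [d] and the
    index in [d.+1], so a body that overwrites the loop variable cannot change the number of rounds.
    In [Bits] one halving precedes the loop and the counter starts at 1, in accordance with
    [bitlen 0 = bitlen 1 = 1]. *)
Fixpoint compile (d : nat) (c : com) : cmd :=
  match c with
  | Asg x e => Seq (cexpr d e)
      (Seq (Do (Const d.+1 0)) (Do (Binop Add x d d.+1)))
  | St A i e => Seq (cexpr d (cell_expr A i))
      (Seq (cexpr d.+1 e) (Do (Write d d.+1)))
  | Raw a e => Seq (cexpr d a) (Seq (cexpr d.+1 e) (Do (Write d d.+1)))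
  | Bits x y =>
      Seq (Do (Const d 0)) (Seq (Do (Binop Add d.+1 y d))
     (Seq (Do (Const d.+2 1)) (Seq (Do (Const d.+3 2))
     (Seq (Do (Binop Div d.+1 d.+1 d.+3))
     (Seq (While d.+1
        (Seq (Do (Const d 1)) (Seq (Do (Binop Add d.+2 d.+2 d))
             (Do (Binop Div d.+1 d.+1 d.+3)))))
     (Seq (Do (Const d 0)) (Do (Binop Add x d.+2 d))))))))
  | CSeq c1 c2 => Seq (compile d c1) (compile d c2)
  | CIf e c1 c2 => Seq (cexpr d e) (If d (compile d c1) (compile d c2))
  | For x e b =>
      Seq (cexpr d e) (Seq (Do (Const d.+1 0)) (While d
        (Seq (Do (Const d.+2 0)) (Seq (Do (Binop Add x d.+1 d.+2))
        (Seq (compile d.+2 b)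
        (Seq (Do (Const d.+2 1)) (Seq (Do (Binop Add d.+1 d.+1 d.+2))
             (Do (Binop Sub d d d.+2)))))))))
  end.

(** * Word-size conditions and correctness of the compiler *)

Fixpoint evok (W : nat) (e : expr) (s : state) : bool :=
  match e with
  | Num c => c < 2 ^ W
  | Var x => (x < nvars) && (reg s x < 2 ^ W)
  | Op o a b => [&& evok W a s, evok W b s & binop_val o (ev a s) (ev b s) < 2 ^ W]
  | Peek a => evok W a s && (mem s (ev a s) < 2 ^ W)
  end.

Fixpoint okc (W : nat) (c : com) (s : state) : Prop :=
  match c with
  | Asg x e => x < nvars /\ evok W e s
  | St A i e => evok W (cell_expr A i) s /\ evok W e s
  | Raw a e => evok W a s /\ evok W e s
  | Bits d x => [/\ d < nvars, x < nvars & reg s x < 2 ^ W]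
  | CSeq c1 c2 => okc W c1 s /\ okc W c2 (den c1 s)
  | CIf e c1 c2 => evok W e s /\ (if ev e s != 0 then okc W c1 s else okc W c2 s)
  | For x e b => [/\ x < nvars, evok W e s &
      forall i, i < ev e s -> okc W b (setr (loop_state x b s i) x i)]
  end.

Lemma evok_lt W e s : evok W e s -> ev e s < 2 ^ W.
Proof. by case: e => [c|x|o a b|a] //=; [case/andP|case/and3P|case/andP]. Qed.

Lemma bitlen_lt W x : x < 2 ^ W.+1 -> bitlen x <= W.+1.
Proof.
case: x => [|x] // h; rewrite /bitlen ltnS -ltnS.
by rewrite -(ltn_exp2l _ _ (isT : 1 < 2)); apply: leq_ltn_trans h; exact: trunc_logP.
Qed.

Lemma bitlen_small x : x < 2 -> bitlen x = 1.
Proof. by case: x => [|[|]]. Qed.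

Lemma bitlen_div2 x : 2 <= x -> bitlen x = (bitlen (x %/ 2)).+1.
Proof. by move=> h; rewrite /bitlen divn2 -trunc_log2S. Qed.

Definition sim (hs ls : state) : Prop :=
  (forall x, x < nvars -> reg ls x = reg hs x) /\ mem ls = mem hs.

(** Temporaries below [d] hold the counters of the enclosing loops, which nested code must not
    disturb. *)
Definition keeps (d : nat) (ls ls' : state) : Prop :=
  forall x, nvars <= x < d -> reg ls' x = reg ls x.

Lemma instr_cost_le W i s :
  match i with
  | Const _ c => c < 2 ^ W.+1
  | Binop _ _ a b => (reg s a < 2 ^ W.+1) && (reg s b < 2 ^ W.+1)
  | Read _ a => (reg s a < 2 ^ W.+1) && (mem s (reg s a) < 2 ^ W.+1)
  | Write a b => (reg s a < 2 ^ W.+1) && (reg s b < 2 ^ W.+1)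
  end -> instr_cost i s <= 2 * W.+1 ^ 2.
Proof.
rewrite [W.+1 ^ 2]expnS expn1; case: i => [d c|o d a b|d a|a b] /=.
- by move/bitlen_lt=> h; nia.
- case/andP=> /bitlen_lt h1 /bitlen_lt h2.
  by case: o; rewrite /=; try nia; move: (leq_mul h1 h2); lia.
- by case/andP=> /bitlen_lt h1 /bitlen_lt h2; nia.
- by case/andP=> /bitlen_lt h1 /bitlen_lt h2; nia.
Qed.

Lemma updE m i v : update m i v i = v. Proof. by rewrite /update eqxx. Qed.
Lemma updN m i v j : j <> i -> update m i v j = m j.
Proof. by rewrite /update; case: eqP. Qed.

Lemma cexprP W d e hs ls : nvars <= d -> sim hs ls -> evok W.+1 e hs ->
  exists ls' t, [/\ exec (cexpr d e) ls ls' t, reg ls' d = ev e hs,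
    forall x, x < d -> reg ls' x = reg ls x, mem ls' = mem ls
    & t <= 2 * W.+1 ^ 2 * esz e].
Proof.
elim: e d ls => [c|x|o a IHa b IHb|a IHa] d ls hd [simr simm] /=.
- move=> hc; eexists; eexists; split; first exact: exec_do.
  + by rewrite /= updE.
  + by move=> x hx /=; rewrite updN //; lia.
  + by [].
  + by rewrite muln1; apply: instr_cost_le.
- case/andP=> hx hv; eexists; eexists; split.
  + by apply: exec_seq; apply: exec_do.
  + rewrite /= updE updN; last lia.
    by rewrite updE addn0; exact: simr.
  + by move=> y hy /=; rewrite !updN //; lia.
  + by [].
  + rewrite muln2 -addnn; apply: leq_add; apply: instr_cost_le => /=.
      by rewrite expn_gt0.
    by rewrite updE updN; [rewrite simr // hv expn_gt0 | lia].
- case/and3P=> ha hb hab.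
  have [l1 [t1 [e1 v1 k1 m1 c1]]] := IHa d ls hd (conj simr simm) ha.
  have s1 : sim hs l1.
    by split=> [y hy|]; [rewrite k1 ?simr //; apply: leq_trans hd | rewrite m1].
  have [l2 [t2 [e2 v2 k2 m2 c2]]] := IHb d.+1 l1 (leqW hd) s1 hb.
  have v2' : reg l2 d = ev a hs by rewrite k2.
  eexists; eexists; split.
  + by apply: exec_seq e1 _; apply: exec_seq e2 _; apply: exec_do.
  + by rewrite /= updE v2 v2'.
  + by move=> y hy /=; rewrite updN; [rewrite k2 ?k1 //; lia | lia].
  + by rewrite /= m2 m1.
  + have := @instr_cost_le W (Binop o d d d.+1) l2.
    rewrite v2 v2' (evok_lt ha) (evok_lt hb) => /(_ isT) c3.
    by rewrite !mulnDr muln1; lia.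
- case/andP=> ha hv.
  have [l1 [t1 [e1 v1 k1 m1 c1]]] := IHa d ls hd (conj simr simm) ha.
  eexists; eexists; split.
  + by apply: exec_seq e1 _; apply: exec_do.
  + by rewrite /= updE v1 m1 simm.
  + by move=> y hy /=; rewrite updN; [rewrite k1 | lia].
  + by rewrite /= m1.
  + have := @instr_cost_le W (Read d d) l1.
    rewrite v1 m1 simm (evok_lt ha) hv => /(_ isT) c3.
    by rewrite !mulnDr muln1; lia.
Qed.

Lemma simW hs ls ls' : sim hs ls -> (forall x, x < nvars -> reg ls' x = reg ls x) ->
  mem ls' = mem ls -> sim hs ls'.
Proof. by move=> [h1 h2] h3 h4; split=> [x hx|]; [rewrite h3 ?h1 | rewrite h4]. Qed.

Lemma reg_const d c s x : x <> d -> reg (instr_effect (Const d c) s) x = reg s x.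
Proof. exact: updN. Qed.
Lemma reg_constE d c s : reg (instr_effect (Const d c) s) d = c.
Proof. exact: updE. Qed.
Lemma reg_binop o d a b s x :
  x <> d -> reg (instr_effect (Binop o d a b) s) x = reg s x.
Proof. exact: updN. Qed.
Lemma reg_binopE o d a b s :
  reg (instr_effect (Binop o d a b) s) d = binop_val o (reg s a) (reg s b).
Proof. exact: updE. Qed.

(** Each halving raises the counter [d.+2] by one. The bound on its final value keeps the counter
    itself a word, since [W.+1 < 2 ^ W.+1]. *)
Lemma bits_loop W d v ls : 0 < W ->
  reg ls d.+1 = v -> reg ls d.+3 = 2 -> v < 2 ^ W.+1 ->
  reg ls d.+2 + (if v == 0 then 0 else bitlen v) <= W.+1 ->
  exists ls' t, [/\ exec (While d.+1
        (Seq (Do (Const d 1)) (Seq (Do (Binop Add d.+2 d.+2 d))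
             (Do (Binop Div d.+1 d.+1 d.+3))))) ls ls' t,
     reg ls' d.+2 = reg ls d.+2 + (if v == 0 then 0 else bitlen v),
     forall x, x < d -> reg ls' x = reg ls x, mem ls' = mem ls
     & t <= 2 * W.+1 ^ 2 * (5 * (if v == 0 then 0 else bitlen v) + 1)].
Proof.
move=> W0; have W2 : W.+1 < 2 ^ W.+1 by apply: ltn_expl.
elim/ltn_ind: v ls => v IH ls h1 h3 hv hc.
have C1 (x : nat) : x < 2 ^ W.+1 -> bitlen x <= 2 * W.+1 ^ 2.
  by move/bitlen_lt=> hx; rewrite expnS expn1; nia.
have [v0|v0] := eqVneq v 0.
  exists ls, (bitlen (reg ls d.+1)); split=> //.
  - by apply: exec_while_false; rewrite h1 v0.
  - by rewrite addn0.
  - by rewrite muln0 add0n muln1 h1 C1.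
pose l1 := instr_effect (Const d 1) ls.
pose l2 := instr_effect (Binop Add d.+2 d.+2 d) l1.
pose l3 := instr_effect (Binop Div d.+1 d.+1 d.+3) l2.
have r2 : reg l2 d.+2 = (reg ls d.+2).+1.
  by rewrite /l2 /= updE updN ?updE ?addn1 //; lia.
have e1 : reg l3 d.+1 = v %/ 2.
  by rewrite /l3 /= updE /l2 /l1 /= !updN ?h1 ?h3 //; lia.
have e3 : reg l3 d.+3 = 2 by rewrite /l3 /l2 /l1 /= !updN //; lia.
have e2 : reg l3 d.+2 = (reg ls d.+2).+1 by rewrite /l3 /= updN ?r2 //; lia.
have lv : v %/ 2 < v by rewrite ltn_Pdiv // lt0n.
have bv : bitlen v = (if v %/ 2 == 0 then 0 else bitlen (v %/ 2)).+1.
  have [v2|v2] := leqP 2 v.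
    by rewrite bitlen_div2 //; case: eqP => // h; have := divn_gt0 v (isT : 0 < 2); rewrite h v2.
  by rewrite bitlen_small // divn_small.
have hc' : reg ls d.+2 < W.+1.
  by move: hc; rewrite (negbTE v0) bv; lia.
have [||ls' [t [E R K m T]]] := IH _ lv l3 e1 e3.
- by apply: leq_ltn_trans hv; exact: ltnW.
- by rewrite e2; move: hc; rewrite (negbTE v0) bv; lia.
exists ls', (bitlen (reg ls d.+1) + (instr_cost (Const d 1) ls +
   (instr_cost (Binop Add d.+2 d.+2 d) l1 + instr_cost (Binop Div d.+1 d.+1 d.+3) l2)) + t).
split.
- apply: exec_while_true E; first by rewrite h1.
  by apply: exec_seq (exec_do _ _) _; apply: exec_seq (exec_do _ _) (exec_do _ _).
- by rewrite R e2 bv addSnnS.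
- by move=> x hx; rewrite K // /l3 /l2 /l1 /= !updN //; lia.
- by rewrite m.
- have c1 := @instr_cost_le W (Const d 1) ls (leq_ltn_trans (ltn0Sn W) W2).
  have c2 : instr_cost (Binop Add d.+2 d.+2 d) l1 <= 2 * W.+1 ^ 2.
    apply: instr_cost_le; rewrite /l1 /= updE updN; last lia.
    by apply/andP; split; apply: leq_ltn_trans W2; [exact: ltnW|].
  have c3 : instr_cost (Binop Div d.+1 d.+1 d.+3) l2 <= 2 * W.+1 ^ 2.
    apply: instr_cost_le; rewrite /l2 /l1 /= !updN ?h1 ?h3 ?hv /=; try lia.
  have c0 := C1 _ hv; rewrite bv; move: T; rewrite h1.
  move: (2 * W.+1 ^ 2) c1 c2 c3 c0 => C c1 c2 c3 c0 T; nia.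
Qed.

(** Forward simulation by induction on the source. Since the machine has no derivation for a
    diverging run, this also proves termination; a loop needs an inner induction on the number of
    remaining rounds. *)
Lemma compileP W c d hs ls : 0 < W -> nvars <= d -> sim hs ls -> okc W.+1 c hs ->
  exists ls' t, [/\ exec (compile d c) ls ls' t, sim (den c hs) ls', keeps d ls ls'
    & t <= 2 * W.+1 ^ 2 * steps c hs].
Proof.
move=> W0; have W1 : 1 < 2 ^ W.+1 by rewrite -{1}(expn0 2) ltn_exp2l.
have W2 : W.+1 < 2 ^ W.+1 by apply: ltn_expl.
elim: c d hs ls => [x e|A i e|a e|x y|c1 IH1 c2 IH2|e c1 IH1 c2 IH2|x e b IH] d hs ls hd hsim /=.
- case=> hx he; have [l1 [t1 [e1 v1 k1 m1 C1]]] := cexprP hd hsim he.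
  eexists; eexists; split.
  + by apply: exec_seq e1 _; apply: exec_seq; apply: exec_do.
  + split=> [y hy|] /=; last by rewrite m1; case: hsim.
    have dd : d <> d.+1 by lia.
    rewrite updE addn0 (updN _ _ dd) v1.
    have [->|/eqP yx] := eqVneq y x; first by rewrite !updE.
    rewrite !updN //; try lia.
    by rewrite k1; [case: hsim => + _; apply | lia].
  + by move=> y hy /=; rewrite !updN ?k1 //; lia.
  + rewrite !mulnDr; apply: leq_add => //; rewrite muln2 -addnn.
    apply: leq_add; apply: instr_cost_le; first by rewrite expn_gt0.
    by rewrite /= updE updN ?v1 ?(evok_lt he) ?expn_gt0 //; lia.
- case=> hi0 he; have hi : evok W.+1 (cell_expr A i) hs := hi0.
  have [l1 [t1 [e1 v1 k1 m1 C1]]] := cexprP hd hsim hi.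
  have s1 : sim hs l1 by apply: (simW hsim) => // x hx; rewrite k1 //; lia.
  have [l2 [t2 [e2 v2 k2 m2 C2]]] := cexprP (leqW hd) s1 he.
  have v2' : reg l2 d = cell A (ev i hs) by rewrite k2.
  eexists; eexists; split.
  + by apply: exec_seq e1 _; apply: exec_seq e2 _; apply: exec_do.
  + split=> [y hy|] /=; first by rewrite k2 ?k1; [case: hsim => + _; apply | lia | lia].
    by rewrite v2 v2' m2 m1; case: hsim => _ ->.
  + by move=> y hy /=; rewrite k2 ?k1 //; lia.
  + have := @instr_cost_le W (Write d d.+1) l2.
    rewrite v2 v2' (evok_lt he) (evok_lt hi) => /(_ isT) c3.
    move: C1 C2 c3 => /=; move: (2 * W.+1 ^ 2) => C; nia.
- case=> hi he; have [l1 [t1 [e1 v1 k1 m1 C1]]] := cexprP hd hsim hi.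
  have s1 : sim hs l1 by apply: (simW hsim) => // x hx; rewrite k1 //; lia.
  have [l2 [t2 [e2 v2 k2 m2 C2]]] := cexprP (leqW hd) s1 he.
  have v2' : reg l2 d = ev a hs by rewrite k2.
  eexists; eexists; split.
  + by apply: exec_seq e1 _; apply: exec_seq e2 _; apply: exec_do.
  + split=> [z hz|] /=; first by rewrite k2 ?k1; [case: hsim => + _; apply | lia | lia].
    by rewrite v2 v2' m2 m1; case: hsim => _ ->.
  + by move=> z hz /=; rewrite k2 ?k1 //; lia.
  + have := @instr_cost_le W (Write d d.+1) l2.
    rewrite v2 v2' (evok_lt he) (evok_lt hi) => /(_ isT) c3.
    move: C1 C2 c3 => /=; move: (2 * W.+1 ^ 2) => C; nia.
- case=> hx hy hv; set v := reg hs y in hv *.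
  pose l1 := instr_effect (Const d 0) ls.
  pose l2 := instr_effect (Binop Add d.+1 y d) l1.
  pose l3 := instr_effect (Const d.+2 1) l2.
  pose l4 := instr_effect (Const d.+3 2) l3.
  pose l5 := instr_effect (Binop Div d.+1 d.+1 d.+3) l4.
  have vy : reg l1 y = v by rewrite /l1 reg_const; [case: hsim => + _; apply | lia].
  have v1 : reg l2 d.+1 = v by rewrite /l2 reg_binopE vy /l1 reg_constE /= addn0.
  have v4 : reg l4 d.+1 = v by rewrite /l4 reg_const ?/l3 1?reg_const ?v1 //; lia.
  have v43 : reg l4 d.+3 = 2 by rewrite /l4 reg_constE.
  have v5 : reg l5 d.+1 = v %/ 2 by rewrite /l5 reg_binopE v4 v43.
  have v53 : reg l5 d.+3 = 2 by rewrite /l5 reg_binop ?v43 //; lia.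
  have v52 : reg l5 d.+2 = 1.
    rewrite /l5 reg_binop; last lia.
    rewrite /l4 reg_const; last lia.
    by rewrite /l3 reg_constE.
  have bv : bitlen v = (if v %/ 2 == 0 then 0 else bitlen (v %/ 2)).+1.
    have [v2|v2] := leqP 2 v.
      by rewrite bitlen_div2 //; case: eqP => // h; have := divn_gt0 v (isT : 0 < 2); rewrite h v2.
    by rewrite bitlen_small // divn_small.
  have [||ls' [t [E R K m T]]] := bits_loop W0 v5 v53.
  + by apply: leq_ltn_trans hv; apply: leq_div.
  + by rewrite v52 add1n -bv; apply: bitlen_lt.
  eexists; eexists; split.
  + do 5 (apply: exec_seq (exec_do _ _) _); rewrite -/l1 -/l2 -/l3 -/l4 -/l5.
    apply: exec_seq E _; apply: exec_seq (exec_do _ _) (exec_do _ _).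
  + split=> [z hz|] /=; last by rewrite m /=; case: hsim.
    have dd : d.+2 <> d by lia.
    rewrite updE (updN _ _ dd) R v52.
    rewrite add1n -bv addn0; have [->|/eqP zx] := eqVneq z x; first by rewrite !updE.
    rewrite !updN //; try lia.
    by rewrite K /l5 /l4 /l3 /l2 /l1 /= ?updN //; try lia; case: hsim => + _; apply.
  + move=> z hz /=; rewrite !updN //; try lia.
    by rewrite K /l5 /l4 /l3 /l2 /l1 /= ?updN //; lia.
  + have c1 := @instr_cost_le W (Const d 0) ls (ltnW W1).
    have c2 : instr_cost (Binop Add d.+1 y d) l1 <= 2 * W.+1 ^ 2.
      by apply: instr_cost_le; rewrite vy hv /l1 reg_constE ltnW.
    have c3 := @instr_cost_le W (Const d.+2 1) l2 W1.
    have c4 : instr_cost (Const d.+3 2) l3 <= 2 * W.+1 ^ 2.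
      by apply: instr_cost_le; exact: leq_ltn_trans (W0 : 2 <= W.+1) W2.
    have c5 : instr_cost (Binop Div d.+1 d.+1 d.+3) l4 <= 2 * W.+1 ^ 2.
      by apply: instr_cost_le; rewrite v4 hv v43; exact: leq_ltn_trans (W0 : 2 <= W.+1) W2.
    have c6 := @instr_cost_le W (Const d 0) ls' (ltnW W1).
    have c7 : instr_cost (Binop Add x d.+2 d) (instr_effect (Const d 0) ls') <= 2 * W.+1 ^ 2.
      have dd : d.+2 <> d by lia.
      apply: instr_cost_le; rewrite reg_constE (reg_const _ _ dd) R v52 add1n -bv.
      by rewrite (leq_ltn_trans (bitlen_lt hv) W2) ltnW.
    rewrite -/l1 -/l2 -/l3 -/l4 bv; move: T; move: (2 * W.+1 ^ 2) c1 c2 c3 c4 c5 c6 c7 => C; nia.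
- case=> h1 h2; have [l1 [t1 [e1 s1 k1 C1]]] := IH1 d hs ls hd hsim h1.
  have [l2 [t2 [e2 s2 k2 C2]]] := IH2 d _ _ hd s1 h2.
  exists l2, (t1 + t2); split=> //; first exact: exec_seq e1 e2.
    by move=> y hy; rewrite k2 // k1.
  by rewrite mulnDr leq_add.
- case=> he; have [l1 [t1 [e1 v1 k1 m1 C1]]] := cexprP hd hsim he.
  have s1 : sim hs l1 by apply: (simW hsim) => // x hx; rewrite k1 //; lia.
  have cb := bitlen_lt (evok_lt he).
  have Cb : bitlen (ev e hs) <= 2 * W.+1 ^ 2 by rewrite expnS expn1; nia.
  case: eqP => /= [v0 h2|v0 h2].
    have [l2 [t2 [e2 s2 k2 C2]]] := IH2 d _ _ hd s1 h2.
    eexists; eexists; split.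
    + by apply: exec_seq e1 _; apply: exec_if_false e2; rewrite v1.
    + by [].
    + by move=> y hy; rewrite k2 // k1 //; lia.
    + rewrite v1 !mulnDr muln1; lia.
  have [l2 [t2 [e2 s2 k2 C2]]] := IH1 d _ _ hd s1 h2.
  eexists; eexists; split.
  + by apply: exec_seq e1 _; apply: exec_if_true e2; rewrite v1; apply/eqP.
  + by [].
  + by move=> y hy; rewrite k2 // k1 //; lia.
  + rewrite v1 !mulnDr muln1; lia.
- case=> hx he hb; set N := ev e hs in hb *.
  have [l1 [t1 [e1 v1 k1 m1 C1]]] := cexprP hd hsim he.
  have s1 : sim hs l1 by apply: (simW hsim) => // y hy; rewrite k1 //; lia.
  have hN : N < 2 ^ W.+1 := evok_lt he.
  set body := Seq (Do (Const d.+2 0)) _.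
  (* Entered at round [i], the [While] pays for the rounds from [i] to [N] and for one last test,
     whence the final [+ 1]. *)
  have loop i l : i <= N -> reg l d = N - i -> reg l d.+1 = i -> keeps d ls l ->
    sim (loop_state x b hs i) l ->
    exists ls' t, [/\ exec (While d body) l ls' t, sim (loop_state x b hs N) ls', keeps d ls ls'
      & t <= 2 * W.+1 ^ 2 *
        (\sum_(i <= j < N) (steps b (setr (loop_state x b hs j) x j) + 6) + 1)].
    have [n] := ubnP (N - i); elim: n i l => // n IHn i l.
    rewrite ltnS => hn hi rd rd1 kl sl.
    have bd : bitlen (reg l d) <= 2 * W.+1 ^ 2.
      have : reg l d < 2 ^ W.+1 by rewrite rd; apply: leq_ltn_trans hN; apply: leq_subr.
      by move/bitlen_lt; rewrite expnS expn1; nia.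
    move: hi; rewrite leq_eqVlt => /orP[/eqP iN|hi].
      exists l, (bitlen (reg l d)); split=> //.
      - by apply: exec_while_false; rewrite rd iN subnn.
      - by rewrite -iN.
      - by rewrite iN big_geq // add0n muln1.
    pose a1 := instr_effect (Const d.+2 0) l.
    pose a2 := instr_effect (Binop Add x d.+1 d.+2) a1.
    have r1 : reg a1 d.+1 = i by rewrite /a1 /= updN //; lia.
    have sa2 : sim (setr (loop_state x b hs i) x i) a2.
      split=> [y hy|]; last by case: sl.
      have [->|/eqP yx] := eqVneq y x.
        by rewrite /a2 reg_binopE r1 /a1 reg_constE /= addn0 updE.
      rewrite /a2 reg_binop // /a1 reg_const /= ?updN //; last lia.
      by case: sl => + _; apply.
    have [l3 [t3 [e3 s3 k3 C3]]] := IH d.+2 _ _ (leqW (leqW hd)) sa2 (hb _ hi).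
    have r3 : reg l3 d.+1 = i by rewrite k3 ?/a2 1?reg_binop ?r1 //; lia.
    have r3' : reg l3 d = N - i by rewrite k3 ?/a2 1?reg_binop ?/a1 1?reg_const ?rd //; lia.
    pose a4 := instr_effect (Const d.+2 1) l3.
    pose a5 := instr_effect (Binop Add d.+1 d.+1 d.+2) a4.
    pose a6 := instr_effect (Binop Sub d d d.+2) a5.
    have r61 : reg a6 d.+1 = i.+1.
      rewrite /a6 reg_binop; last lia.
      rewrite /a5 reg_binopE /a4 reg_constE reg_const ?r3 /= ?addn1 //; lia.
    have r60 : reg a6 d = N - i.+1.
      rewrite /a6 reg_binopE /a5 2?reg_binop /a4 ?reg_constE; try lia.
      rewrite reg_const ?r3' /= ?subn1 ?subnS //; lia.
    have k6 : keeps d ls a6.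
      move=> y hy; rewrite /a6 /a5 /a4 /= !updN; try lia.
      rewrite k3; last lia.
      by rewrite /a2 /a1 /= !updN ?kl //; lia.
    have s6 : sim (loop_state x b hs i.+1) a6.
      apply: simW s3 _ _ => // y hy; rewrite /a6 /a5 /a4 /= !updN //; lia.
    have hn' : N - i.+1 < n by lia.
    have [l7 [t7 [e7 s7 k7 C7]]] := IHn i.+1 a6 hn' hi r60 r61 k6 s6.
    eexists; eexists; split.
    + apply: exec_while_true e7; first by rewrite rd subn_eq0 -ltnNge.
      do 2 (apply: exec_seq (exec_do _ _) _); apply: exec_seq e3 _.
      by do 2 (apply: exec_seq (exec_do _ _) _); apply: exec_do.
    + exact: s7.
    + exact: k7.
    + have iW : i < 2 ^ W.+1 by apply: ltn_trans hN.
      have c1 := @instr_cost_le W (Const d.+2 0) l (ltnW W1).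
      have c2 : instr_cost (Binop Add x d.+1 d.+2) a1 <= 2 * W.+1 ^ 2.
        by apply: instr_cost_le; rewrite r1 iW /a1 /= updE ltnW.
      have c4 := @instr_cost_le W (Const d.+2 1) l3 W1.
      have c5 : instr_cost (Binop Add d.+1 d.+1 d.+2) a4 <= 2 * W.+1 ^ 2.
        by apply: instr_cost_le; rewrite /a4 /= updE updN ?r3 ?iW //; lia.
      have c6 : instr_cost (Binop Sub d d d.+2) a5 <= 2 * W.+1 ^ 2.
        have d0 : d <> d.+2 by lia.
        have d1 : d <> d.+1 by lia.
        have d2 : d.+2 <> d.+1 by lia.
        apply: instr_cost_le; rewrite /a5 !reg_binop // /a4 reg_constE (reg_const _ _ d0).
        by rewrite r3' W1 andbT (leq_ltn_trans (leq_subr _ _) hN).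
      rewrite (big_ltn hi); move: C7.
      rewrite -/a1 -/a4 -/a5; move: (bitlen _) (instr_cost _ _) (instr_cost _ _) bd c1 c2 => ? ? ?.
      move: (instr_cost _ _) (instr_cost _ _) (instr_cost _ _) C3 c4 c5 c6 => ? ? ?.
      move: (\sum_(_ <= _ < _) _) (2 * W.+1 ^ 2) => ? ?; nia.
  have [|||||l9 [t9 [e9 s9 k9 C9]]] := loop 0 (instr_effect (Const d.+1 0) l1).
  + by [].
  + by rewrite subn0 /= updN ?v1 //; lia.
  + by rewrite /= updE.
  + by move=> y hy /=; rewrite updN ?k1 //; lia.
  + by apply: simW s1 _ _ => // y hy /=; rewrite updN //; lia.
  eexists; eexists; split.
  + by apply: exec_seq e1 _; apply: exec_seq (exec_do _ _) e9.
  + exact: s9.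
  + exact: k9.
  + have c1 := @instr_cost_le W (Const d.+1 0) l1 (ltnW W1).
    move: C9; rewrite big_mkord !mulnDr muln1; move: C1 c1; move: (instr_cost _ _) (2 * _) (\sum_(_ < _) _) => ? ? ?; nia.
Qed.

(** * Static analyses *)

(* The class of an expression is an exponent [k] such that its value stays below
   the [k]-th power of the word bound; [pos] lists the registers known to be
   positive, hence safe as moduli. *)
Fixpoint cls (pos : seq nat) (e : expr) : nat :=
  match e with
  | Op Add a b => (maxn (cls pos a) (cls pos b)).+1
  | Op Mul a b => cls pos a + cls pos b
  | Op Mod a (Var y) => if y \in pos then 1 else cls pos a
  | Op _ a _ => cls pos a
  | _ => 1
  end.

(** Numerals below 64 fit because words have at least 6 bits. Intermediate values may reach class 6,
    which is why the machine is run with words of [6 * w] bits although stored values have [w]. *)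
Fixpoint etc (pos : seq nat) (e : expr) : bool :=
  match e with
  | Num c => c < 64
  | Var x => x < nvars
  | Op o a b => [&& etc pos a, etc pos b & cls pos (Op o a b) <= 6]
  | Peek a => etc pos a
  end.

(** Whatever is stored must have class 1, and the registers of [pos] are never assigned, so they
    remain positive moduli throughout. *)
Fixpoint tc (pos : seq nat) (c : com) : bool :=
  match c with
  | Asg x e => [&& x < nvars, x \notin pos, etc pos e & cls pos e <= 1]
  | St A i e => [&& etc pos (cell_expr A i), etc pos e & cls pos e <= 1]
  | Raw a e => [&& etc pos a, etc pos e & cls pos e <= 1]
  | Bits d x => [&& d < nvars, d \notin pos & x < nvars]
  | CSeq c1 c2 => tc pos c1 && tc pos c2
  | CIf e c1 c2 => [&& etc pos e, tc pos c1 & tc pos c2]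
  | For x e b => [&& x < nvars, x \notin pos, etc pos e, cls pos e <= 1 & tc pos b]
  end.

Definition words (w : nat) (s : state) : Prop :=
  (forall x, x < nvars -> reg s x < 2 ^ w) /\ (forall a, mem s a < 2 ^ w).
Definition positive (pos : seq nat) (s : state) : Prop :=
  forall y, y \in pos -> 0 < reg s y.

Lemma cls_gt0 pos e : 0 < cls pos e.
Proof. by elim: e => //= o a IHa b IHb; case: o => //; [rewrite addn_gt0 IHa | case: b IHb => // y _; case: ifP]. Qed.

Lemma etcP w pos e s : 6 <= w -> words w s -> positive pos s -> etc pos e ->
  evok (6 * w) e s && (ev e s < 2 ^ (w * cls pos e)).
Proof.
move=> w6 [wr wm] hpos.
have w16 : 1 <= w by lia.
have pw k : k <= 6 -> 2 ^ (w * k) <= 2 ^ (6 * w).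
  by move=> hk; rewrite leq_exp2l // mulnC leq_mul2r hk orbT.
have p1 : 2 ^ w <= 2 ^ (6 * w) by rewrite -{1}[w]muln1; apply: pw.
elim: e => [c|x|o a IHa b IHb|a IHa] /=.
- move=> hc; rewrite muln1; have h : c < 2 ^ w.
    by apply: leq_trans (_ : 2 ^ 6 <= _) => //; rewrite leq_exp2l.
  by rewrite h (leq_trans h p1).
- by move=> hx; rewrite hx muln1 wr // (leq_trans (wr _ hx) p1).
- case/and3P=> ha hb hk; have /andP[a1 a2] := IHa ha; have /andP[b1 b2] := IHb hb.
  rewrite a1 b1 /=.
  suff h : binop_val o (ev a s) (ev b s) < 2 ^ (w * cls pos (Op o a b)).
    by rewrite h (leq_trans h (pw _ hk)).
  case: o hk => /= hk.
  + rewrite mulnS expnD.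
    have ma : 2 ^ (w * cls pos a) <= 2 ^ (w * maxn (cls pos a) (cls pos b)).
      by rewrite leq_exp2l // leq_mul2l leq_maxl orbT.
    have mb : 2 ^ (w * cls pos b) <= 2 ^ (w * maxn (cls pos a) (cls pos b)).
      by rewrite leq_exp2l // leq_mul2l leq_maxr orbT.
    have h2 : 2 <= 2 ^ w by rewrite -{1}(expn1 2) leq_exp2l.
    apply: leq_trans (leq_mul h2 (leqnn _)); lia.
  + exact: leq_ltn_trans (leq_subr _ _) a2.
  + by rewrite mulnDr expnD; apply: ltn_mul.
  + exact: leq_ltn_trans (leq_div _ _) a2.
  + have h := leq_ltn_trans (leq_mod (ev a s) (ev b s)) a2.
    case: b {IHb b1 b2 hk} hb h => //= y hy h; case: ifP => // hp; rewrite muln1.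
    exact: ltn_trans (ltn_pmod _ (hpos y hp)) (wr _ hy).
- by move/IHa/andP=> [-> _] /=; rewrite muln1 wm (leq_trans (wm _) p1).
Qed.

Lemma words_setr w s x v : words w s -> v < 2 ^ w -> words w (setr s x v).
Proof.
move=> [h1 h2] hv; split=> //= y hy; rewrite /update; case: eqP => // _; exact: h1.
Qed.

Lemma words_setm w s x v : words w s -> v < 2 ^ w -> words w (setm s x v).
Proof. by move=> [h1 h2] hv; split=> //= y; rewrite /update; case: eqP. Qed.

Lemma positive_setr pos s x v : positive pos s -> x \notin pos -> positive pos (setr s x v).
Proof.
move=> h hx y hy /=; rewrite /update; case: eqP => [yx|_]; last exact: h.
by rewrite -yx hy in hx.
Qed.

Lemma etc1P w pos e s : 6 <= w -> words w s -> positive pos s -> etc pos e ->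
  cls pos e <= 1 -> ev e s < 2 ^ w.
Proof.
move=> w6 h1 h2 h3 h4; have /andP[_ h] := etcP w6 h1 h2 h3.
by have -> : w = w * cls pos e by have := cls_gt0 pos e; nia.
Qed.

(** Stored values of class 1 make [words w] an invariant of every command, loops included; no
    knowledge of what the program computes enters. *)
Lemma tcP w pos c s : 6 <= w -> words w s -> positive pos s -> tc pos c ->
  [/\ okc (6 * w) c s, words w (den c s) & positive pos (den c s)].
Proof.
move=> w6; have ww : 2 ^ w <= 2 ^ (6 * w) by rewrite leq_exp2l //; lia.
elim: c s => [x e|A i e|a e|d x|c1 IH1 c2 IH2|e c1 IH1 c2 IH2|x e b IH] s hw hp; simpl tc.
- case/and4P=> hx xp he hc; have /andP[h1 _] := etcP w6 hw hp he.
  have h2 := etc1P w6 hw hp he hc.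
  by split=> /=; [|apply: words_setr|apply: positive_setr].
- case/and3P=> hi0 he hc; have hi : etc pos (cell_expr A i) := hi0.
  have /andP[h1 _] := etcP w6 hw hp he.
  have /andP[h0 _] := etcP w6 hw hp hi; have h2 := etc1P w6 hw hp he hc.
  by split; [split|apply: words_setm|].
- case/and3P=> hi he hc; have /andP[h1 _] := etcP w6 hw hp he.
  have /andP[h0 _] := etcP w6 hw hp hi; have h2 := etc1P w6 hw hp he hc.
  by split; [split|apply: words_setm|].
- case/and3P=> hd dp hx; have h := hw.1 x hx; split.
  + by split=> //; apply: leq_trans h ww.
  + apply: words_setr => //; case: w w6 {ww} hw h => // w _ _ h.
    by apply: leq_ltn_trans (bitlen_lt h) _; apply: ltn_expl.
  + exact: positive_setr.
- case/andP=> t1 t2; have [g1 w1 p1] := IH1 s hw hp t1.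
  by have [g2 w2 p2] := IH2 _ w1 p1 t2.
- case/and3P=> he t1 t2; have /andP[h1 _] := etcP w6 hw hp he.
  by rewrite /=; case: eqP => _; [have [g2 w2 p2] := IH2 s hw hp t2 | have [g1 w1 p1] := IH1 s hw hp t1].
- case/and5P=> hx xp he hc tb; have /andP[h1 _] := etcP w6 hw hp he.
  have h2 := etc1P w6 hw hp he hc.
  have inv i : i <= ev e s -> words w (loop_state x b s i) /\ positive pos (loop_state x b s i).
    elim: i => // i IHi hi; have [wi pi] := IHi (ltnW hi).
    have [] // := IH (setr (loop_state x b s i) x i).
      by apply: words_setr => //; apply: ltn_trans h2.
    exact: positive_setr.
  have [wi pi] := inv _ (leqnn _); split=> //; split=> // i hi.
  have [wj pj] := inv _ (ltnW hi).
  have [] // := IH (setr (loop_state x b s i) x i).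
    by apply: words_setr => //; apply: ltn_trans h2.
  exact: positive_setr.
Qed.

(** * Frames: registers and arrays that a command may change *)

Fixpoint wr (c : com) : seq nat :=
  match c with
  | Asg x _ | Bits x _ => [:: x]
  | St _ _ _ | Raw _ _ => [::]
  | CSeq c1 c2 | CIf _ c1 c2 => wr c1 ++ wr c2
  | For x _ b => x :: wr b
  end.

(** For [A >= 16] the cells of [A] overlap those of genuine arrays, and a raw write may hit any
    array; all sixteen are then listed. *)
Fixpoint awr (c : com) : seq nat :=
  match c with
  | Asg _ _ | Bits _ _ => [::]
  | St A _ _ => if A < 16 then [:: A] else iota 0 16
  | Raw _ _ => iota 0 16
  | CSeq c1 c2 | CIf _ c1 c2 => awr c1 ++ awr c2
  | For _ _ b => awr b
  end.

Lemma cell_inj A B i j : A < 16 -> B < 16 -> cell A i = cell B j -> A = B /\ i = j.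
Proof. rewrite /cell; lia. Qed.

Definition frame (xs As : seq nat) (s s' : state) : Prop :=
  (forall x, x \notin xs -> reg s' x = reg s x) /\
  (forall A i, A < 16 -> A \notin As -> arr A s' i = arr A s i).

Lemma frame_trans xs As s1 s2 s3 : frame xs As s1 s2 -> frame xs As s2 s3 -> frame xs As s1 s3.
Proof.
move=> [a1 b1] [a2 b2]; split=> [x hx|A i h h']; first by rewrite a2 ?a1.
by rewrite b2 ?b1.
Qed.

Lemma frame_sub xs As xs' As' s s' :
  {subset xs <= xs'} -> {subset As <= As'} -> frame xs As s s' -> frame xs' As' s s'.
Proof.
move=> h1 h2 [a b]; split=> [x hx|A i hA hx].
  by apply: a; apply: contra hx => /h1.
by apply: b => //; apply: contra hx => /h2.
Qed.

Lemma frame_setr xs As s x v : x \in xs -> frame xs As s (setr s x v).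
Proof.
move=> h; split=> // y hy /=; rewrite updN // => yx; by rewrite yx h in hy.
Qed.

Lemma den_frame c s : frame (wr c) (awr c) s (den c s).
Proof.
elim: c s => [x e|A i e|a e|d x|c1 IH1 c2 IH2|e c1 IH1 c2 IH2|x e b IH] s /=.
- by apply: frame_setr; rewrite inE.
- split=> // B j hB; rewrite /arr /=; case: ifP => hA; last first.
    by rewrite -/(iota 0 16) mem_iota hB.
  rewrite inE => /eqP AB; rewrite updN // => /cell_inj[] //.
- by split=> // B j hB; rewrite -/(iota 0 16) mem_iota hB.
- by apply: frame_setr; rewrite inE.
- apply: frame_trans (_ : frame _ _ s (den c1 s)) _.
    by apply: frame_sub (IH1 s) => z; rewrite mem_cat => ->.
  by apply: frame_sub (IH2 _) => z; rewrite mem_cat => ->; rewrite orbT.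
- case: ifP => _.
    by apply: frame_sub (IH1 s) => z; rewrite mem_cat => ->.
  by apply: frame_sub (IH2 _) => z; rewrite mem_cat => ->; rewrite orbT.
- elim: (ev e s) => // n IHn /=; apply: frame_trans IHn _.
  apply: frame_trans (_ : frame _ _ _ (setr _ x n)) _.
    by apply: frame_setr; rewrite inE eqxx.
  by apply: frame_sub (IH _) => // z; rewrite inE => ->; rewrite orbT.
Qed.

Lemma den_reg c s x : x \notin wr c -> reg (den c s) x = reg s x.
Proof. by case: (den_frame c s) => h _; apply: h. Qed.

Lemma den_arr c s A i : A < 16 -> A \notin awr c -> arr A (den c s) i = arr A s i.
Proof. by case: (den_frame c s) => _ h; apply: h. Qed.

Lemma loop_frame x b s i : frame (x :: wr b) (awr b) s (loop_state x b s i).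
Proof.
elim: i => // n IHn; apply: frame_trans IHn _.
apply: frame_trans (_ : frame _ _ _ (setr _ x n)) _.
  by apply: frame_setr; rewrite inE eqxx.
by apply: frame_sub (den_frame _ _) => // z; rewrite inE => ->; rewrite orbT.
Qed.

(** The loop rule supplies the frame at every round, so an invariant has to speak only of what the
    body changes. *)
Lemma for_inv (I : nat -> state -> Prop) x e b s : I 0 s ->
  (forall i s', i < ev e s -> frame (x :: wr b) (awr b) s s' -> I i s' ->
    I i.+1 (den b (setr s' x i))) ->
  I (ev e s) (den (For x e b) s).
Proof.
move=> h0 hS; rewrite /=; have : ev e s <= ev e s by [].
elim: {1 3 4}(ev e s) => // n IHn hn; apply: (hS n) => //; last exact: IHn (ltnW hn).
exact: loop_frame.
Qed.

(** * Syntactic bounds on step counts *)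

Fixpoint evars (e : expr) : seq nat :=
  match e with
  | Num _ => [::]
  | Var x => [:: x]
  | Op _ a b => evars a ++ evars b
  | Peek a => evars a
  end.

Fixpoint loadless (e : expr) : bool :=
  match e with
  | Op _ a b => loadless a && loadless b
  | Peek _ => false
  | _ => true
  end.

Fixpoint lvars (c : com) : seq nat :=
  match c with
  | Asg _ _ | Bits _ _ | St _ _ _ | Raw _ _ => [::]
  | CSeq c1 c2 | CIf _ c1 c2 => lvars c1 ++ lvars c2
  | For _ e b => evars e ++ lvars b
  end.

Fixpoint loop_loadless (c : com) : bool :=
  match c with
  | CSeq c1 c2 | CIf _ c1 c2 => loop_loadless c1 && loop_loadless c2
  | For _ e b => loadless e && loop_loadless b
  | _ => true
  end.

(* Upper bound on [steps] in which every loop bound is evaluated in [s]. *)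
Fixpoint cost (c : com) (s : state) : nat :=
  match c with
  | Asg x e => esz e + 2
  | St A i e => esz i + esz e + 5
  | Raw a e => esz a + esz e + 1
  | Bits d x => 5 * bitlen (reg s x) + 6
  | CSeq c1 c2 => cost c1 s + cost c2 s
  | CIf e c1 c2 => esz e + 1 + cost c1 s + cost c2 s
  | For x e b => esz e + 2 + ev e s * (cost b s + 6)
  end.

Fixpoint bitsless (c : com) : bool :=
  match c with
  | Bits _ _ => false
  | CSeq c1 c2 | CIf _ c1 c2 => bitsless c1 && bitsless c2
  | For _ _ b => bitsless b
  | _ => true
  end.

(** Loop bounds read neither memory nor any register that the command writes, so they keep their
    initial values and [cost] may evaluate all of them at the start. [Bits] is excluded since its
    cost depends on the value at hand. *)
Definition static (c : com) : bool :=
  [&& loop_loadless c, bitsless c & all (fun x => x \notin wr c) (lvars c)].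

Lemma ev_agree e s s' : loadless e -> (forall x, x \in evars e -> reg s' x = reg s x) ->
  ev e s' = ev e s.
Proof.
elim: e => [c|x|o a IHa b IHb|a IHa] //=; first by move=> _ h; apply: h; rewrite inE.
by case/andP=> ha hb h; rewrite IHa ?IHb // => x hx; apply: h; rewrite mem_cat hx ?orbT.
Qed.

(** Subcommands run in states other than the one where [cost] is evaluated. [V] is a set of
    protected registers that stays fixed in the induction and on which all these states agree. *)
Lemma steps_cost_gen (V : pred nat) c s s' : loop_loadless c -> bitsless c ->
  {subset lvars c <= V} -> (forall x, x \in wr c -> ~~ V x) ->
  (forall x, V x -> reg s' x = reg s x) -> steps c s' <= cost c s.
Proof.
elim: c s' => [x e|A i e|a e|d x|c1 IH1 c2 IH2|e c1 IH1 c2 IH2|x e b IH] s' //=.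
- case/andP=> l1 l2 /andP[b1 b2] hV hw hs.
  apply: leq_add.
    apply: IH1 => // z hz; first by apply: hV; rewrite mem_cat hz.
    by apply: hw; rewrite mem_cat hz.
  apply: IH2 => // z hz; first by apply: hV; rewrite mem_cat hz orbT.
    by apply: hw; rewrite mem_cat hz orbT.
  rewrite den_reg ?hs //; apply/negP => hz2.
  by have := hw z; rewrite mem_cat hz2 hz => /(_ isT).
- case/andP=> l1 l2 /andP[b1 b2] hV hw hs; rewrite -[X in _ <= X]addnA leq_add2l.
  case: ifP => _.
    apply: leq_trans (leq_addr _ _); apply: IH1 => // z hz; first by apply: hV; rewrite mem_cat hz.
    by apply: hw; rewrite mem_cat hz.
  apply: leq_trans (leq_addl _ _); apply: IH2 => // z hz; first by apply: hV; rewrite mem_cat hz orbT.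
  by apply: hw; rewrite mem_cat hz orbT.
- case/andP=> le lb bb hV hw hs.
  have -> : ev e s' = ev e s.
    by apply: ev_agree => // z hz; apply: hs; apply: hV; rewrite mem_cat hz.
  rewrite leq_add2l -[X in X * _]card_ord -sum_nat_const; apply: leq_sum => i _.
  rewrite leq_add2r; apply: IH => // z hz.
  - by apply: hV; rewrite mem_cat hz orbT.
  - by apply: hw; rewrite inE hz orbT.
  - rewrite /= updN; last by move=> zx; have := hw z; rewrite inE zx eqxx -zx hz => /(_ isT).
    have [h _] := loop_frame x b s' i; rewrite h ?hs //.
    by apply/negP => hz2; have := hw z hz2; rewrite hz.
Qed.

Lemma steps_cost c s : static c -> steps c s <= cost c s.
Proof.
case/and3P=> h1 h2 /allP h3; apply: (@steps_cost_gen (fun x => x \in lvars c)) => // x hx.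
by apply/negP => /h3; rewrite hx.
Qed.

(** * Digits *)

Definition dig (b t s : nat) : nat := s %/ b ^ t %% b.

Lemma digS b t s : dig b t.+1 s = dig b t (s %/ b).
Proof. by rewrite /dig expnS divnMA. Qed.

Lemma dig_lt b t s : 0 < b -> dig b t s < b.
Proof. by move=> b0; rewrite ltn_pmod. Qed.

Definition undig (b k : nat) (c : nat -> nat) : nat := \sum_(t < k) c t * b ^ t.

Lemma undigS b k c : undig b k.+1 c = c 0 + undig b k (fun t => c t.+1) * b.
Proof.
rewrite /undig big_ord_recl muln1 big_distrl; congr (_ + _).
by apply: eq_bigr => i _; rewrite /= expnS mulnA mulnAC.
Qed.

Lemma undig_ltn b k c : (forall t, t < k -> c t < b) -> undig b k c < b ^ k.
Proof.
elim: k c => [|k IH] c h; first by rewrite /undig big_ord0.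
have h0 := h 0 isT; have h1 := IH (fun t => c t.+1) (fun t ht => h t.+1 ht).
rewrite undigS expnS; nia.
Qed.

Lemma dig_undig b k c t : (forall t, t < k -> c t < b) -> t < k -> dig b t (undig b k c) = c t.
Proof.
elim: k c t => // k IH c t h ht; have h0 := h 0 isT.
have b0 : 0 < b by apply: leq_ltn_trans h0.
rewrite undigS; case: t ht => [|t] ht.
  by rewrite /dig expn0 divn1 addnC modnMDl modn_small.
rewrite digS divnDMl // divn_small // add0n; apply: IH => // u hu; exact: h.
Qed.

Lemma undig_dig b k s : 0 < b -> s < b ^ k -> undig b k (dig b ^~ s) = s.
Proof.
move=> b0; elim: k s => [|k IH] s hs.
  by move: hs; rewrite expn0 /undig big_ord0; case: s.
rewrite undigS /= {1}/dig expn0 divn1 addnC [RHS](divn_eq s b); congr (_ * _ + _).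
rewrite -[RHS](IH (s %/ b)); last by rewrite ltn_divLR // -expnSr.
by apply: eq_bigr => i _; rewrite digS.
Qed.

Lemma eq_undig b k c c' : (forall t, t < k -> c t = c' t) -> undig b k c = undig b k c'.
Proof. by move=> h; apply: eq_bigr => i _; rewrite h. Qed.

Lemma undigD b k c c' : undig b k c + undig b k c' = undig b k (fun t => c t + c' t).
Proof. by rewrite /undig -big_split; apply: eq_bigr => i _; rewrite mulnDl. Qed.

Lemma dig_lo b j e h t : 0 < b -> t < j -> dig b t (e * b ^ j + h) = dig b t h.
Proof.
move=> b0 tj; have -> : e * b ^ j = e * b ^ (j - t).-1 * b * b ^ t.
  by rewrite -!mulnA -expnS -expnD; congr (_ * _ ^ _); lia.
by rewrite /dig divnMDl ?expn_gt0 ?b0 // modnMDl.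
Qed.

Lemma dig_hi b j e h : e < b -> h < b ^ j -> dig b j (e * b ^ j + h) = e.
Proof.
move=> he hh; have b0 : 0 < b by apply: leq_ltn_trans he.
by rewrite /dig divnMDl ?expn_gt0 ?b0 // divn_small // addn0 modn_small.
Qed.

(* A base-[r] expansion read in base [2r]: the digits of two such numbers add
   without carry. *)
Definition spread (r k i : nat) : nat := undig r.*2 k (dig r ^~ i).
Definition fold (r k s : nat) : nat := undig r k (dig r.*2 ^~ s).
Definition small_digits (r k s : nat) : bool := [forall t : 'I_k, dig r.*2 t s < r].

Section Spread.
Variables (r k : nat).
Hypothesis r0 : 0 < r.

Let r20 : 0 < r.*2. Proof. by rewrite double_gt0. Qed.

Let dlt t i : dig r t i < r.*2.
Proof. by rewrite -addnn (leq_trans (dig_lt t i r0)) ?leq_addr. Qed.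

Lemma spread_lt i : spread r k i < r.*2 ^ k.
Proof. exact: undig_ltn. Qed.

Lemma dig_spread i t : t < k -> dig r.*2 t (spread r k i) = dig r t i.
Proof. by move=> tk; rewrite dig_undig. Qed.

Lemma small_digits_spread i : small_digits r k (spread r k i).
Proof. by apply/forallP => t; rewrite dig_spread // dig_lt. Qed.

Lemma fold_spread i : i < r ^ k -> fold r k (spread r k i) = i.
Proof.
by move=> hi; rewrite -[RHS](undig_dig r0 hi); apply: eq_undig => t tk; rewrite dig_spread.
Qed.

Lemma fold_lt s : small_digits r k s -> fold r k s < r ^ k.
Proof. by move/forallP => h; apply: undig_ltn => t tk; apply: (h (Ordinal tk)). Qed.

Lemma spread_fold s : s < r.*2 ^ k -> small_digits r k s -> spread r k (fold r k s) = s.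
Proof.
move=> hs /forallP h; rewrite -[RHS](undig_dig r20 hs); apply: eq_undig => t tk.
by rewrite dig_undig // => u uk; apply: (h (Ordinal uk)).
Qed.

Let sumlt i j t : dig r t i + dig r t j < r.*2.
Proof. by have := dig_lt t i r0; have := dig_lt t j r0; lia. Qed.

Lemma dig_spreadD i j t : t < k ->
  dig r.*2 t (spread r k i + spread r k j) =
  dig r.*2 t (spread r k i) + dig r.*2 t (spread r k j).
Proof. by move=> tk; rewrite !dig_spread // undigD dig_undig. Qed.

Lemma spreadD_lt i j : spread r k i + spread r k j < r.*2 ^ k.
Proof. by rewrite undigD; apply: undig_ltn. Qed.

(** The digits of the sum may exceed [r] but stay below [2 r]. Weighted with powers of [r] and left
    unreduced, they still represent [i + j], even when [i + j] is at least [r ^ k]. *)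
Lemma fold_spreadD i j : i < r ^ k -> j < r ^ k ->
  fold r k (spread r k i + spread r k j) = i + j.
Proof.
move=> hi hj; rewrite -{2}(undig_dig r0 hi) -{2}(undig_dig r0 hj) undigD.
by apply: eq_undig => t tk; rewrite dig_spreadD // !dig_spread.
Qed.
End Spread.

(** * Multidimensional Fourier transform over a ring with a root of -1 *)

Import GRing.Theory.
Local Open Scope ring_scope.

Lemma sum_ord_mul (V : nmodType) (m n : nat) (F : nat -> V) :
  \sum_(i < m * n) F i = \sum_(i < m) \sum_(j < n) F (i * n + j)%N.
Proof.
elim: m => [|m IH]; first by rewrite !big_ord0.
rewrite big_ord_recr /= -IH mulSnr big_split_ord /=; congr (_ + _).
Qed.

Lemma sum_ord_expS (V : nmodType) (n j : nat) (F : nat -> V) :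
  \sum_(i < n ^ j.+1) F i = \sum_(d < n) \sum_(y < n ^ j) F (d * n ^ j + y)%N.
Proof. by rewrite expnS sum_ord_mul. Qed.

Section Transform.
Variables (R : comNzRingType) (w : R) (rho : nat).
Let r := (2 ^ rho)%N.
Hypothesis w2 : w = 2%:R.
Hypothesis w_r : w ^+ r = -1.

Let r2 := r.*2.
Let r0 : (0 < r)%N. Proof. by rewrite /r expn_gt0. Qed.
Let r20 : (0 < r2)%N. Proof. by rewrite /r2 double_gt0. Qed.

Lemma w_r2 : w ^+ r2 = 1.
Proof. by rewrite /r2 -addnn exprD w_r mulrNN mulr1. Qed.

Lemma w_mod e : w ^+ (e %% r2) = w ^+ e.
Proof. by rewrite {2}(divn_eq e r2) exprD mulnC exprM w_r2 expr1n mul1r. Qed.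

Definition w' : R := w ^+ r2.-1.

Lemma ww' : w * w' = 1.
Proof. by rewrite /w' -exprS prednK // w_r2. Qed.

Lemma w'_mod e : w' ^+ (e %% r2) = w' ^+ e.
Proof.
have w'_r2 : w' ^+ r2 = 1 by rewrite /w' -exprM mulnC exprM w_r2 expr1n.
by rewrite {2}(divn_eq e r2) exprD mulnC exprM w'_r2 expr1n mul1r.
Qed.

(** The sum is the product of the [1 + z ^+ (2 ^ l)] over [l < n], and the factor with [l = m]
    vanishes. Nothing is divided, so zero divisors do no harm. *)
Lemma geo_sum_root (z : R) m n : z ^+ (2 ^ m) = -1 -> (m < n)%N ->
  \sum_(e < 2 ^ n) z ^+ e = 0.
Proof.
move=> hz; have dbl l : \sum_(e < 2 ^ l.+1) z ^+ e = (1 + z ^+ (2 ^ l)) * \sum_(e < 2 ^ l) z ^+ e.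
  rewrite expnS mul2n -addnn big_split_ord /= mulrDl mul1r mulr_sumr; congr (_ + _).
  by apply: eq_bigr => i _; rewrite exprD.
elim: n => // n IH; rewrite ltnS leq_eqVlt => /orP[/eqP <-|mn].
  by rewrite dbl hz subrr mul0r.
by rewrite dbl IH // mulr0.
Qed.

(** In a ring that is not a domain, a root of unity other than 1 need not have a vanishing geometric
    sum. Here the ratio is [w ^+ j] with [j] not divisible by [r2 = 2 ^ rho.+1]. Writing
    [j = 2 ^ v * o] with [o] odd and [v <= rho], its power [2 ^ (rho - v)] is [w ^+ (r * o) = -1],
    and [geo_sum_root] applies. *)
Lemma orthogonality d d' : (d < r2)%N -> (d' < r2)%N ->
  \sum_(e < r2) w ^+ (e * d) * w' ^+ (e * d') = (if d == d' then r2%:R else 0).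
Proof.
move=> hd hd'.
have E e : w ^+ (e * d) * w' ^+ (e * d') = (w ^+ (d + r2.-1 * d')) ^+ e.
  by rewrite /w' -!exprM -exprD; congr (_ ^+ _); nia.
under eq_bigr do rewrite E.
case: eqP => [<-|dd'].
  have -> : w ^+ (d + r2.-1 * d) = 1.
    by rewrite -mulSn prednK // exprM w_r2 expr1n.
  by under eq_bigr do rewrite expr1n; rewrite sumr_const card_ord.
set j := (_ + _)%N.
(* Modulo [r2] the exponent [j] is [d - d'], the difference of two distinct residues. *)
have jn : ~~ (r2 %| j)%N.
  apply/negP => /dvdnP[c hc]; have : (j + d' = d + r2 * d')%N by rewrite /j; nia.
  rewrite hc => h; have : (d + r2 * d' = d' %[mod r2])%N by rewrite -h modnMDl.
  by rewrite addnC mulnC modnMDl !modn_small.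
have j0 : (0 < j)%N by case: j jn => //; rewrite dvdn0.
have r2E : r2 = (2 ^ rho.+1)%N by rewrite /r2 /r expnS mul2n.
have [v [o [vr jE oo]]] : exists v o, [/\ (v <= rho)%N, j = (2 ^ v * o)%N & odd o].
  exists (logn 2 j), (j %/ 2 ^ logn 2 j)%N; split.
  - by rewrite leqNgt; apply: contra jn => h; rewrite r2E pfactor_dvdn.
  - by rewrite mulnC divnK // pfactor_dvdnn.
  - have := pfactor_coprime (isT : prime 2) j0; case=> o co jE.
    by rewrite {1}jE mulnK ?expn_gt0 // -coprime2n.
rewrite r2E; apply: (@geo_sum_root _ (rho - v)); last by rewrite ltnS leq_subr.
have -> : (w ^+ j) ^+ (2 ^ (rho - v)) = (w ^+ r) ^+ o.
  by rewrite -!exprM; congr (_ ^+ _); rewrite jE mulnAC -expnD subnKC.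
by rewrite w_r -signr_odd oo.
Qed.

Variable k : nat.
Let Q := (r2 ^ k)%N.
Let S := (r2 ^ k.+1)%N.

(* One pass transforms the lowest digit and moves it to the top. *)
Definition fwd (X : nat -> R) (s : nat) : R :=
  \sum_(d < r2) w ^+ (s %/ Q * d) * X (s %% Q * r2 + d)%N.
(** The shift by [rho.+1] in the exponent divides by [2 r], which equals [w ^+ rho.+1] because
    [w = 2]. *)
Definition bwd (X : nat -> R) (s : nat) : R :=
  \sum_(e < r2) w' ^+ (e * (s %% r2) + rho.+1) * X (e * Q + s %/ r2)%N.

Let Q0 : (0 < Q)%N. Proof. by rewrite /Q expn_gt0 r20. Qed.

Lemma bwd_fwd X s : (s < S)%N -> bwd (fwd X) s = X s.
Proof.
move=> hs; rewrite /bwd /fwd.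
have hq : (s %/ r2 < Q)%N by rewrite ltn_divLR // /Q -expnSr.
transitivity (\sum_(d < r2) w' ^+ rho.+1 *
   (\sum_(e < r2) w ^+ (e * d) * w' ^+ (e * (s %% r2))) * X (s %/ r2 * r2 + d)%N).
  transitivity (\sum_(e < r2) \sum_(d < r2) w' ^+ (e * (s %% r2) + rho.+1) *
     (w ^+ (e * d) * X (s %/ r2 * r2 + d)%N)).
    apply: eq_bigr => e _; rewrite divnMDl // divn_small // addn0 modnMDl (modn_small hq).
    by rewrite mulr_sumr.
  rewrite exchange_big /=; apply: eq_bigr => d _.
  rewrite mulr_sumr mulr_suml; apply: eq_bigr => e _.
  by rewrite exprD; ring.
have hd : (s %% r2 < r2)%N by rewrite ltn_pmod.
rewrite (bigD1 (Ordinal hd)) //= [Z in _ + Z]big1 ?addr0; last first.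
  move=> d dd. rewrite orthogonality //; case: eqP => [e|_]; last by rewrite mulr0 mul0r.
  by case/negP: dd; apply/eqP/val_inj.
rewrite orthogonality // eqxx -divn_eq.
have -> : r2%:R = w ^+ rho.+1 by rewrite /r2 /r w2 -natrX expnS mul2n.
by rewrite -exprMn [w' * w]mulrC ww' expr1n mul1r.
Qed.

Lemma eq_bwd X Y : (forall s, (s < S)%N -> X s = Y s) -> forall s, (s < S)%N -> bwd X s = bwd Y s.
Proof.
move=> XY s hs; apply: eq_bigr => e _; rewrite XY //.
have : (s %/ r2 < Q)%N by rewrite ltn_divLR // /Q -expnSr.
by have := ltn_ord e; rewrite /S expnS -/Q; nia.
Qed.

Lemma eq_fwd X Y : (forall s, (s < S)%N -> X s = Y s) -> forall s, (s < S)%N -> fwd X s = fwd Y s.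
Proof.
move=> XY s hs; apply: eq_bigr => d _; rewrite XY //.
have : (s %% Q < Q)%N by rewrite ltn_pmod.
by have := ltn_ord d; rewrite /S expnSr -/Q; nia.
Qed.

Lemma eq_iter_fwd n X Y : (forall s, (s < S)%N -> X s = Y s) ->
  forall s, (s < S)%N -> iter n fwd X s = iter n fwd Y s.
Proof. by move=> XY; elim: n => // n IH s hs; rewrite !iterS; apply: eq_fwd. Qed.

Lemma iter_bwd_fwd n X s : (s < S)%N -> iter n bwd (iter n fwd X) s = X s.
Proof.
elim: n X s => // n IH X s hs; rewrite iterSr iterS.
transitivity (iter n bwd (iter n fwd X) s); last exact: IH.
elim: n s hs {IH} (iter n fwd X) => [|n IH] s hs Z; first by rewrite /= bwd_fwd.
by rewrite !iterS; apply: eq_bwd => // u hu; apply: IH.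
Qed.

(** Exponent of the Fourier kernel on a product of [j] cyclic groups of order [2 r], with group
    elements coded by their digits. *)
Definition dprod (j s y : nat) : nat := \sum_(t < j) dig r2 t s * dig r2 t y.

Lemma dprodS j e h d y : (e < r2)%N -> (d < r2)%N -> (h < r2 ^ j)%N -> (y < r2 ^ j)%N ->
  dprod j.+1 (e * r2 ^ j + h) (d * r2 ^ j + y) = (e * d + dprod j h y)%N.
Proof.
move=> he hd hh hy; rewrite /dprod big_ord_recr /= addnC !dig_hi //; congr (_ + _)%N.
by apply: eq_bigr => i _; rewrite !dig_lo.
Qed.

Lemma dprodDr j s y y' : (forall t, (t < j)%N -> dig r2 t (y + y') = dig r2 t y + dig r2 t y')%N ->
  dprod j s (y + y') = (dprod j s y + dprod j s y')%N.
Proof.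
by move=> h; rewrite /dprod -big_split; apply: eq_bigr => i _; rewrite h // mulnDr.
Qed.

(** After [j] passes the [j] top digits of the index are frequencies, dual to the [j] lowest digits
    of the original index; the digits not yet transformed have moved down to form [lo]. *)
Lemma iter_fwd_gen X j h lo : (j <= k.+1)%N -> (h < r2 ^ j)%N -> (lo < r2 ^ (k.+1 - j))%N ->
  iter j fwd X (h * r2 ^ (k.+1 - j) + lo)%N =
  \sum_(y < r2 ^ j) w ^+ dprod j h y * X (lo * r2 ^ j + y)%N.
Proof.
elim: j h lo => [|j IH] h lo hj hh hlo.
  rewrite big_ord1 /dprod big_ord0 expr0 mul1r /= subn0.
  by case: h hh => // _; rewrite mul0n add0n addn0 muln1.
have bj : (0 < r2 ^ j)%N by rewrite expn_gt0 r20.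
have QE : Q = (r2 ^ j * r2 ^ (k.+1 - j.+1))%N by rewrite /Q -expnD; congr (_ ^ _)%N; lia.
have hE := divn_eq h (r2 ^ j).
have he : (h %/ r2 ^ j < r2)%N by rewrite ltn_divLR // -expnS.
have hm : (h %% r2 ^ j < r2 ^ j)%N by rewrite ltn_pmod.
set e := (h %/ _)%N in hE he *; set h' := (h %% _)%N in hE hm *.
set B := (r2 ^ (k.+1 - j.+1))%N in QE hlo *.
have BE : (r2 ^ (k.+1 - j) = B * r2)%N by rewrite /B -expnSr; congr (_ ^ _)%N; lia.
have -> : (h * B + lo = e * Q + (h' * B + lo))%N by rewrite hE QE; ring.
have hlt : (h' * B + lo < Q)%N by rewrite QE; nia.
rewrite iterS {1}/fwd divnMDl // divn_small // addn0 modnMDl modn_small //.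
apply: etrans; last by apply: esym; exact: (sum_ord_expS r2 j (fun y => w ^+ dprod j.+1 h y * X (lo * r2 ^ j.+1 + y)%N)).
apply: eq_bigr => d _.
have -> : ((h' * B + lo) * r2 + d = h' * r2 ^ (k.+1 - j) + (lo * r2 + d))%N.
  by rewrite BE; ring.
rewrite IH //; [|exact: ltnW|by rewrite BE; have := ltn_ord d; nia].
rewrite mulr_sumr; apply: eq_bigr => y _.
rewrite hE dprodS // exprD mulrA; congr (_ * X _).
by rewrite expnS; ring.
Qed.

Lemma iter_fwd X s : (s < S)%N ->
  iter k.+1 fwd X s = \sum_(y < S) w ^+ dprod k.+1 s y * X y.
Proof.
move=> hs; have := @iter_fwd_gen X k.+1 s 0 (leqnn _) hs.
by rewrite subnn expn0 muln1 addn0 mul0n; apply.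
Qed.

Definition spread_seq (a : nat -> R) (s : nat) : R :=
  if small_digits r k.+1 s then a (fold r k.+1 s) else 0.

Let N := (r ^ k.+1)%N.

Lemma iter_fwd_spread a s : (s < S)%N -> iter k.+1 fwd (spread_seq a) s =
  \sum_(i < N) w ^+ dprod k.+1 s (spread r k.+1 i) * a i.
Proof.
move=> hs; rewrite iter_fwd // /spread_seq.
pose G y := w ^+ dprod k.+1 s y * a (fold r k.+1 y).
transitivity (\sum_(y < S | small_digits r k.+1 y) G y).
  by rewrite [RHS]big_mkcond; apply: eq_bigr => y _; rewrite /G; case: ifP; rewrite ?mulr0.
pose f (i : 'I_N) : 'I_S := Ordinal (spread_lt k.+1 r0 i).
have N0 : (0 < N)%N by rewrite expn_gt0 r0.
pose g (y : 'I_S) : 'I_N := insubd (Ordinal N0) (fold r k.+1 y).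
rewrite (reindex_onto f g) /=; last first.
  by move=> y hy; apply: val_inj; rewrite /= val_insubd fold_lt //= spread_fold.
apply: eq_big => [i|i _]; last by rewrite /G /= fold_spread.
rewrite small_digits_spread //=; apply/eqP/val_inj.
by rewrite val_insubd /= fold_spread // ltn_ord.
Qed.

Definition spread_conv (a b : nat -> R) (x : nat) : R :=
  \sum_(i < N) \sum_(j < N | (spread r k.+1 i + spread r k.+1 j == x)%N) a i * b j.

(** The kernel is multiplicative along carry-free sums, and sums of two spread indices stay below
    [S]; hence the cyclic convolution does not wrap around. *)
Lemma iter_fwd_conv a b s : (s < S)%N ->
  iter k.+1 fwd (spread_seq a) s * iter k.+1 fwd (spread_seq b) s =
  iter k.+1 fwd (spread_conv a b) s.
Proof.
move=> hs; rewrite !iter_fwd_spread // iter_fwd // mulr_suml.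
transitivity (\sum_(i < N) \sum_(j < N) \sum_(y < S | (spread r k.+1 i + spread r k.+1 j == y)%N)
   w ^+ dprod k.+1 s y * (a i * b j)).
  apply: eq_bigr => i _; rewrite mulr_sumr; apply: eq_bigr => j _.
  have h := spreadD_lt k.+1 r0 i j.
  rewrite (big_pred1 (Ordinal h)) => [|y]; last by rewrite /= -val_eqE eq_sym.
  rewrite /= dprodDr => [|t ht]; last exact: dig_spreadD.
  by rewrite exprD; ring.
transitivity (\sum_(i < N) \sum_(y < S) \sum_(j < N | (spread r k.+1 i + spread r k.+1 j == y)%N)
   w ^+ dprod k.+1 s y * (a i * b j)).
  apply: eq_bigr => i _; rewrite (exchange_big_dep xpredT) //=.
rewrite exchange_big; apply: eq_bigr => y _; rewrite /spread_conv mulr_sumr.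
by apply: eq_bigr => i _; rewrite mulr_sumr.
Qed.

Lemma iter_bwd_conv a b Z :
  (forall s, (s < S)%N -> Z s = iter k.+1 fwd (spread_seq a) s * iter k.+1 fwd (spread_seq b) s) ->
  forall s, (s < S)%N -> iter k.+1 bwd Z s = spread_conv a b s.
Proof.
move=> hZ s hs; rewrite -(@iter_bwd_fwd k.+1 (spread_conv a b) s hs).
have {}hZ u : (u < S)%N -> Z u = iter k.+1 fwd (spread_conv a b) u.
  by move=> hu; rewrite hZ // iter_fwd_conv.
move: (k.+1) (iter k.+1 fwd _) hZ => n Y hZ.
elim: n s hs => [|n IH] s hs; first exact: hZ.
by rewrite !iterS; apply: eq_bwd.
Qed.
End Transform.

Section Fold.
Variables (V : pzSemiRingType) (r k : nat).
Hypothesis r0 : (0 < r)%N.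
Let N := (r ^ k)%N.

(** Each pair [(i, j)] contributes to exactly one [x], the sum of the two spreads, and [fold] sends
    that [x] to [i + j]. *)
Lemma sum_fold_conv (a b : nat -> V) m :
  \sum_(x < r.*2 ^ k | fold r k x == m)
     \sum_(i < N) \sum_(j < N | (spread r k i + spread r k j == x)%N) a i * b j =
  \sum_(i < N) \sum_(j < N | (i + j == m)%N) a i * b j.
Proof.
rewrite exchange_big; apply: eq_bigr => i _.
rewrite (exchange_big_dep xpredT) //= [RHS]big_mkcond; apply: eq_bigr => j _.
have h := spreadD_lt k r0 i j.
rewrite big_mkcondl /= (big_pred1 (Ordinal h)) /= ?fold_spreadD //.
Qed.
End Fold.

Local Open Scope nat_scope.

(** * Symbolic execution *)

Arguments den : simpl never.
Arguments ev : simpl never.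
Arguments arr : simpl never.

Declare Scope expr_scope.
Delimit Scope expr_scope with X.
Bind Scope expr_scope with expr.
Coercion Var : nat >-> expr.
Notation "# c" := (Num c) (at level 1, format "# c") : expr_scope.
Infix "+" := (Op Add) : expr_scope.
Infix "-" := (Op Sub) : expr_scope.
Infix "*" := (Op Mul) : expr_scope.
Infix "/" := (Op Div) : expr_scope.
Infix "%%" := (Op Mod) : expr_scope.
Notation "A .[ i ]" := (Get A i) (at level 1, left associativity, format "A .[ i ]") : expr_scope.
Declare Scope com_scope.
Delimit Scope com_scope with C.
Bind Scope com_scope with com.
Notation "x ::= e" := (Asg x e%X) (at level 60) : com_scope.
Notation "A $[ i ] ::= e" := (St A i%X e%X) (at level 60) : com_scope.
Notation "c1 ;; c2" := (CSeq c1 c2) (at level 70, right associativity) : com_scope.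
Notation "'for' x '<' e 'do' c" := (For x e%X c)
  (at level 65, x at level 9, e at level 9, c at level 65) : com_scope.

Lemma denAsg x e s : den (Asg x e) s = setr s x (ev e s). Proof. by []. Qed.
Lemma denSt A i e s : den (St A i e) s = setm s (cell A (ev i s)) (ev e s). Proof. by []. Qed.
Lemma denSeq c1 c2 s : den (CSeq c1 c2) s = den c2 (den c1 s). Proof. by []. Qed.
Lemma denIf e c1 c2 s : den (CIf e c1 c2) s = if ev e s != 0 then den c1 s else den c2 s.
Proof. by []. Qed.
Lemma evNum c s : ev (Num c) s = c. Proof. by []. Qed.
Lemma evVar x s : ev (Var x) s = reg s x. Proof. by []. Qed.
Lemma evOp o a b s : ev (Op o a b) s = binop_val o (ev a s) (ev b s). Proof. by []. Qed.
Lemma evGet A i s : ev (Get A i) s = arr A s (ev i s). Proof. by []. Qed.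
Lemma reg_setr s x v y : reg (setr s x v) y = if y == x then v else reg s y. Proof. by []. Qed.
Lemma reg_setm s a v y : reg (setm s a v) y = reg s y. Proof. by []. Qed.
Lemma arr_setr A s x v i : arr A (setr s x v) i = arr A s i. Proof. by []. Qed.
Lemma arr_setm A s B j v i : A < 16 -> B < 16 ->
  arr A (setm s (cell B j) v) i = if (A == B) && (i == j) then v else arr A s i.
Proof.
move=> hA hB; rewrite /arr /= /update; case: eqP => [/cell_inj[]// -> ->|h].
  by rewrite !eqxx.
by case: eqP => // AB; case: eqP => // ij; case: h; rewrite AB ij.
Qed.

Definition exE := (denAsg, denSt, denIf, evGet, evNum, evVar, evOp, reg_setr, reg_setm, arr_setr).

Lemma fillP x A e body val s (v : nat -> nat) :
  A < 16 -> x \notin wr body -> A \notin awr body ->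
  (forall i s', i < ev e s -> frame (x :: wr body) (A :: awr body) s s' -> reg s' x = i ->
     (forall j, i <= j -> arr A s' j = arr A s j) -> ev val (den body s') = v i) ->
  let s' := den (For x e (CSeq body (St A (Var x) val))) s in
  (forall i, i < ev e s -> arr A s' i = v i) /\
  (forall i, ev e s <= i -> arr A s' i = arr A s i).
Proof.
move=> hA hx hb hv s'.
pose I n s1 := (forall i, i < n -> arr A s1 i = v i) /\ (forall i, n <= i -> arr A s1 i = arr A s i).
apply: (for_inv (I := I)) => // i s1 hi hf [I1 I2].
have ev1 : ev val (den body (setr s1 x i)) = v i.
  apply: (hv i) => //; last by rewrite reg_setr eqxx.
  apply: (@frame_trans _ _ _ s1); last by apply: frame_setr; rewrite inE eqxx.
  apply: frame_sub hf => z; rewrite /= ?cats0 // hA mem_cat !inE orbC //.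
have b1 j : arr A (den body (setr s1 x i)) j = arr A s1 j by rewrite den_arr.
have x1 : reg (den body (setr s1 x i)) x = i by rewrite den_reg // reg_setr eqxx.
split=> j; rewrite denSeq !exE arr_setm // eqxx x1 ev1 b1; case: eqP => //.
- by move=> -> _.
- by move=> ne hj; apply: I1; lia.
- by move=> -> /[!ltnn].
- by move=> ne hj; apply: I2; lia.
Qed.

Lemma fill0P x A e val s (v : nat -> nat) : A < 16 ->
  (forall i s', i < ev e s -> frame [:: x] [:: A] s s' -> reg s' x = i ->
     (forall j, i <= j -> arr A s' j = arr A s j) -> ev val s' = v i) ->
  let s' := den (For x e (St A (Var x) val)) s in
  (forall i, i < ev e s -> arr A s' i = v i) /\
  (forall i, ev e s <= i -> arr A s' i = arr A s i).
Proof.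
move=> hA hv s'.
pose I n s1 := (forall i, i < n -> arr A s1 i = v i) /\ (forall i, n <= i -> arr A s1 i = arr A s i).
apply: (for_inv (I := I)) => // i s1 hi; rewrite /= hA => hf [I1 I2].
have ev1 : ev val (setr s1 x i) = v i.
  apply: (hv i) => //; last by rewrite reg_setr eqxx.
  by apply: (frame_trans hf); apply: frame_setr; rewrite inE eqxx.
split=> j; rewrite !exE arr_setm // !eqxx ev1 !exE /=; case: eqP => //.
- by move=> -> _.
- by move=> ne hj; apply: I1; lia.
- by move=> -> /[!ltnn].
- by move=> ne hj; apply: I2; lia.
Qed.

Lemma sumP x acc m e t s (v : nat -> nat) : acc != x -> m != acc -> m != x ->
  reg s acc = 0 ->
  (forall i s', i < ev e s -> frame [:: x; acc] [::] s s' -> reg s' x = i -> ev t s' = v i) ->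
  reg (den (For x e (acc ::= (acc + t) %% m)%C) s) acc = (\sum_(i < ev e s) v i) %% reg s m.
Proof.
move=> h1 h2 h3 h0 hv.
pose I n s1 := reg s1 acc = (\sum_(i < n) v i) %% reg s m.
apply: (for_inv (I := I)) => [|i s1 hi hf]; first by rewrite /I h0 big_ord0 mod0n.
have f2 : frame [:: x; acc] [::] s (setr s1 x i).
  by apply: frame_trans hf _; apply: frame_setr; rewrite inE eqxx.
rewrite /I => I1; rewrite !exE eqxx (hv i) //; last by rewrite reg_setr eqxx.
rewrite (negbTE h1) (negbTE h3) /= I1 big_ord_recr /=.
have -> : reg s1 m = reg s m by case: hf => + _; apply; rewrite !inE negb_or h2 h3.
by rewrite modnDml.
Qed.

(** * Multiplication of polynomials *)

(* Initial [r], [v] and [a] mark parameters, scratch registers and arrays. *)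

Notation rP := 0 (only parsing).
Notation rN := 1 (only parsing).
Notation rU := 2 (only parsing).
Notation rM := 3 (only parsing).
Notation rR := 4 (only parsing).
Notation rR2 := 5 (only parsing).
Notation rK := 6 (only parsing).
Notation rRK := 7 (only parsing).
Notation rQ := 8 (only parsing).
Notation rS := 9 (only parsing).
Notation vs := 20 (only parsing).
Notation vt := 21 (only parsing).
Notation vx := 22 (only parsing).
Notation vpos := 23 (only parsing).
Notation vpw := 24 (only parsing).
Notation vdg := 25 (only parsing).
Notation vfl := 26 (only parsing).
Notation vacc := 27 (only parsing).
Notation ve := 28 (only parsing).
Notation vd := 29 (only parsing).
Notation vq := 30 (only parsing).
Notation vu := 31 (only parsing).

Notation aI := 1 (only parsing).
Notation aA := 2 (only parsing).
Notation aB := 3 (only parsing).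
Notation aC := 4 (only parsing).
Notation aX := 5 (only parsing).
Notation aY := 6 (only parsing).
Notation aT := 7 (only parsing).
Notation aW := 8 (only parsing).
Notation aV := 9 (only parsing).

(** A digit in base [2 r] has quotient 0 or 1 by [r], so [vfl] drops to 0 at the first digit that is
    not small. Here and in the other programs, reduction modulo [rU] never changes a value; it gives
    the expression class 1, as the word-size check demands. *)
Definition digits : com :=
  (vpos ::= #0;; vfl ::= #1;; vpw ::= #1;; vx ::= vs;;
   for vt < rK do
     (vdg ::= vx %% rR2;;
      vfl ::= (vfl * (#1 - vdg / rR)) %% rU;;
      vpos ::= (vpos + vdg * vpw) %% rU;;
      vpw ::= (vpw * rR) %% rU;;
      vx ::= vx / rR2))%C.

Definition spread_prog (A X : nat) : com :=
  (for vs < rS do (digits;; X$[vs] ::= (vfl * A.[vpos]) %% rM))%C.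

Definition fwd_prog (X : nat) : com :=
  (for vs < rS do
     ((ve ::= vs / rQ;; vq ::= vs %% rQ;; vacc ::= #0;;
       for vd < rR2 do
         (vacc ::= (vacc + aW.[(ve * vd) %% rR2] * X.[vq * rR2 + vd]) %% rM));;
      aT$[vs] ::= vacc);;
   for vs < rS do (X$[vs] ::= aT.[vs]))%C.

Definition bwd_prog (X : nat) : com :=
  (for vs < rS do
     ((vq ::= vs / rR2;; vd ::= vs %% rR2;; vacc ::= #0;;
       for ve < rR2 do
         (vacc ::= (vacc + aV.[(ve * vd) %% rR2] * X.[ve * rQ + vq]) %% rM));;
      aT$[vs] ::= vacc);;
   for vs < rS do (X$[vs] ::= aT.[vs]))%C.

Definition fold_prog : com :=
  (for vs < rRK do (aC$[vs] ::= #0);;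
   for vs < rS do (digits;; aC$[vpos] ::= (aC.[vpos] + aX.[vs]) %% rP))%C.

Definition polymul : com :=
  (spread_prog aA aX;; spread_prog aB aY;;
   for vu < rK do fwd_prog aX;;
   for vu < rK do fwd_prog aY;;
   for vs < rS do (aX$[vs] ::= (aX.[vs] * aY.[vs]) %% rM);;
   for vu < rK do bwd_prog aX;;
   fold_prog)%C.

(** * Correctness of the multiplication program *)

Record env (rho k : nat) (s : state) : Prop := Env {
  envR : reg s rR = 2 ^ rho;
  envR2 : reg s rR2 = (2 ^ rho).*2;
  envM : reg s rM = (2 ^ 2 ^ rho).+1;
  envK : reg s rK = k.+1;
  envRK : reg s rRK = (2 ^ rho) ^ k.+1;
  envQ : reg s rQ = (2 ^ rho).*2 ^ k;
  envS : reg s rS = (2 ^ rho).*2 ^ k.+1;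
  envU : (2 ^ rho).*2 ^ k.+1 < reg s rU }.

(** The table [aV] of powers of the inverse of 2 starts at the power [rho.+1], so a backward pass
    includes its division by [2 r]. *)
Record tables (rho : nat) (s : state) : Prop := Tables {
  tabW : forall j, j < (2 ^ rho).*2 -> arr aW s j = 2 ^ j %[mod (2 ^ 2 ^ rho).+1];
  tabV : forall j, j < (2 ^ rho).*2 ->
    arr aV s j = (2 ^ (2 ^ rho).*2.-1) ^ (j + rho.+1) %[mod (2 ^ 2 ^ rho).+1] }.

Lemma env_frame rho k xs As s s' : frame xs As s s' -> env rho k s ->
  all (fun x => x \notin xs) [:: rR; rR2; rM; rK; rRK; rQ; rS; rU] -> env rho k s'.
Proof.
by case=> h _ [? ? ? ? ? ? ? ?] /and5P[? ? ? ? /and5P[? ? ? ? _]]; split; rewrite h.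
Qed.

Lemma tables_frame rho xs As s s' : frame xs As s s' -> tables rho s ->
  (aW \notin As) && (aV \notin As) -> tables rho s'.
Proof. by case=> _ h [t1 t2] /andP[h1 h2]; split=> j hj; rewrite h // ?t1 ?t2. Qed.

Lemma digitsP rho k s : env rho k s ->
  reg (den digits s) vpos = fold (2 ^ rho) k.+1 (reg s vs) /\
  reg (den digits s) vfl = small_digits (2 ^ rho) k.+1 (reg s vs).
Proof.
case=> eR eR2 _ eK _ _ _ eU; set r := 2 ^ rho in eR eR2 eU *.
have r0 : 0 < r by rewrite expn_gt0.
have rr : r <= r.*2 by rewrite -addnn leq_addr.
pose x := reg s vs.
have fu t : t <= k.+1 -> undig r t (dig r.*2 ^~ x) < reg s rU.
  move=> ht; apply: leq_ltn_trans eU.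
  apply: (@leq_trans (undig r.*2 t (dig r.*2 ^~ x))).
    apply: leq_sum => i _; rewrite leq_mul2l; apply/orP; right.
    by case: (nat_of_ord i) => // n; rewrite leq_exp2r.
  apply: leq_trans (_ : r.*2 ^ t <= _).
    by apply/ltnW/undig_ltn => u _; rewrite dig_lt // double_gt0.
  by rewrite leq_pexp2l // double_gt0.
have pu t : t <= k.+1 -> r ^ t < reg s rU.
  move=> ht; apply: leq_ltn_trans eU; apply: leq_trans (_ : r.*2 ^ t <= _).
    by case: t {ht} => // n; rewrite leq_exp2r.
  by rewrite leq_pexp2l // double_gt0.
pose I n s1 := [/\ reg s1 vpos = undig r n (dig r.*2 ^~ x), reg s1 vpw = r ^ n,
  reg s1 vx = x %/ r.*2 ^ n & reg s1 vfl = small_digits r n x].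
have [] : I k.+1 (den digits s); last by move=> h1 h2 h3 h4; rewrite h1 h4.
rewrite /digits !denSeq -[X in I X]eK.
set s0 := den (Asg vx _) _.
have -> : reg s rK = ev rK s0 by [].
apply: for_inv => [|i s1].
  split; rewrite /s0 ?exE /= ?divn1 //; first by rewrite /undig big_ord0.
  by rewrite (_ : small_digits r 0 x) //; apply/forallP => -[].
rewrite -/(den (Asg vx _) _) => hi hf [h1 h2 h3 h4].
have {}hi : i < k.+1 by rewrite -eK; exact: hi.
have kp y : y \in [:: rU; rR; rR2] -> reg s1 y = reg s y.
  move=> hy; have [hfr _] := hf; rewrite hfr.
    by rewrite /s0 !exE; move: hy; rewrite !inE => /or3P[]/eqP->.
  by move: hy; rewrite !inE => /or3P[]/eqP->.
have [kU kR kR2] : [/\ reg s1 rU = reg s rU, reg s1 rR = r & reg s1 rR2 = r.*2].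
  by split; rewrite kp.
have dE : x %/ r.*2 ^ i %% r.*2 = dig r.*2 i x by [].
have uS : undig r i.+1 (dig r.*2 ^~ x) = undig r i (dig r.*2 ^~ x) + dig r.*2 i x * r ^ i.
  by rewrite /undig big_ord_recr.
rewrite 4!denSeq; set s2 := den (Asg vdg _) _.
have [d2 l2 p2 w2 x2] : [/\ reg s2 vdg = dig r.*2 i x, reg s2 vfl = small_digits r i x,
    reg s2 vpos = undig r i (dig r.*2 ^~ x), reg s2 vpw = r ^ i & reg s2 vx = x %/ r.*2 ^ i].
  by rewrite /s2 !exE /= h1 h2 h3 h4 kR2 dE.
have [U2 R2 R22] : [/\ reg s2 rU = reg s rU, reg s2 rR = r & reg s2 rR2 = r.*2] by [].
clearbody s2; split; rewrite !exE /= ?U2 ?R2 ?R22 ?d2 ?l2 ?p2 ?w2 ?x2.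
- by rewrite -uS modn_small // fu.
- by rewrite -expnSr modn_small // pu.
- by rewrite -divnMA -expnSr.
- have U1 : 1 < reg s rU by apply: leq_ltn_trans (pu 0 isT).
  have -> : small_digits r i.+1 x = small_digits r i x && (dig r.*2 i x < r).
    apply/forallP/andP => [h|[/forallP h hlast] t].
      split; last exact: (h ord_max).
      by apply/forallP => t; apply: (h (widen_ord (leqnSn i) t)).
    case: (ltnP t i) => ti; first exact: (h (Ordinal ti)).
    by have -> : t = i :> nat by have := ltn_ord t; lia.
  have -> : 1 - dig r.*2 i x %/ r = (dig r.*2 i x < r).
    have hd : dig r.*2 i x < r.*2 by rewrite dig_lt // double_gt0.
    case: ltnP => hh; first by rewrite divn_small.
    by move: hh; rewrite -divn_gt0 //; case: (_ %/ _).
  by case: (small_digits _ _ _); case: (_ < r) => /=; rewrite ?muln0 ?muln1 ?mod0n ?modn_small.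
Qed.

Lemma spreadP rho k A X s : A < 16 -> X < 16 -> A != X -> env rho k s ->
  let s' := den (spread_prog A X) s in
  forall i, i < (2 ^ rho).*2 ^ k.+1 -> arr X s' i =
    (small_digits (2 ^ rho) k.+1 i * arr A s (fold (2 ^ rho) k.+1 i)) %% (2 ^ 2 ^ rho).+1.
Proof.
move=> hA hX AX he; rewrite /spread_prog /=.
have [] := @fillP vs X rS digits ((vfl * A.[vpos]) %% rM)%X s
  (fun i => (small_digits (2 ^ rho) k.+1 i * arr A s (fold (2 ^ rho) k.+1 i)) %% (2 ^ 2 ^ rho).+1).
- by [].
- by [].
- by [].
- move=> i s1; rewrite exE (envS he) => hi hf hx _.
  have he1 := env_frame hf he isT.
  have [dp df] := digitsP he1.
  rewrite !exE dp df hx /= [reg _ rM]den_reg // (envM he1) den_arr //.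
  by have [_ ->] := hf; rewrite // inE.
- by rewrite exE (envS he) => h _.
Qed.

Import GRing.Theory.

Section Polymul.
Variables (rho k : nat).
Let r := 2 ^ rho.
Let M := (2 ^ r).+1.
Let S := r.*2 ^ k.+1.
Let w : 'Z_M := 2%:R%R.

Let M1 : 1 < M. Proof. by rewrite /M ltnS expn_gt0. Qed.

Lemma natZ_eq (a b : nat) : a = b %[mod M] <-> (a%:R = b%:R :> 'Z_M)%R.
Proof.
split=> [h|/(congr1 val)]; last by rewrite /= !val_Zp_nat.
by apply: val_inj; rewrite /= !val_Zp_nat.
Qed.

Lemma natZ_mod (a : nat) : ((a %% M)%:R = a%:R :> 'Z_M)%R.
Proof. by apply/natZ_eq; rewrite modn_mod. Qed.

Lemma w_pow_r : (w ^+ r = -1)%R.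
Proof.
have : (M%:R = 0 :> 'Z_M)%R by apply: (iffLR (natZ_eq M 0)); rewrite modnn mod0n.
by rewrite /M -natr1 natrX => /eqP; rewrite addr_eq0 => /eqP.
Qed.

Definition vals (X : nat) (s : state) (i : nat) : 'Z_M := (arr X s i)%:R%R.

Let r0 : 0 < r. Proof. by rewrite expn_gt0. Qed.
Let r20 : 0 < r.*2. Proof. by rewrite double_gt0. Qed.

Let frame_setr2 xs As s0 s x v : frame xs As s0 s -> x \in xs -> frame xs As s0 (setr s x v).
Proof. by move=> h1 h2; apply: frame_trans h1 _; apply: frame_setr. Qed.

Lemma fwdP X s : X < 16 -> X \notin [:: aT; aW; aV] -> env rho k s -> tables rho s ->
  forall i, i < S -> vals X (den (fwd_prog X) s) i = fwd w rho k (vals X s) i /\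
     arr X (den (fwd_prog X) s) i < M.
Proof.
move=> hX; rewrite !inE !negb_or => /and3P[XT XW XV] he ht i hi.
rewrite /fwd_prog denSeq; set body := CSeq (Asg ve _) _.
set s1 := den (For vs _ (CSeq body _)) s.
pose v i := (\sum_(d < r.*2) arr aW s ((i %/ r.*2 ^ k * d) %% r.*2) * arr X s (i %% r.*2 ^ k * r.*2 + d)) %% M.
have s1T j : j < S -> arr aT s1 j = v j.
  move=> hj; have [] := @fillP vs aT rS body vacc s v.
  - by [].
  - by [].
  - by [].
  - move=> j' s2 hj' hf hx _; rewrite evVar /body !denSeq.
    set s3 := den (Asg vacc _) _.
    have f3 : frame (vs :: wr body) (aT :: awr body) s s3.
      by rewrite /s3 !denAsg; do 3 apply: frame_setr2 => //.
    have he3 := env_frame f3 he isT.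
    rewrite (@sumP vd vacc rM rR2 _ s3 (fun d => arr aW s ((j' %/ r.*2 ^ k * d) %% r.*2) * arr X s (j' %% r.*2 ^ k * r.*2 + d))) //.
      by rewrite (envM he3) evVar (envR2 he3).
    move=> d s4 _ f4 hd.
    have f5 : frame (vs :: wr body) (aT :: awr body) s s4.
      apply: frame_trans f3 _; apply: frame_sub f4 => z //.
      by rewrite !inE => /orP[]/eqP->.
    have he5 := env_frame f5 he isT.
    have kq : reg s4 vq = j' %% r.*2 ^ k.
      have [-> //] := f4; rewrite /s3 !exE /= hx.
      by have [-> //] := hf; rewrite (envQ he).
    have ke : reg s4 ve = j' %/ r.*2 ^ k.
      have [-> //] := f4; rewrite /s3 !exE /= hx.
      by have [-> //] := hf; rewrite (envQ he).
    rewrite !exE /= kq ke hd (envR2 he5).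
    by have [_ fa] := f5; rewrite !fa //= inE.
  - by rewrite evVar (envS he) => h _; apply: h.
have he1 : env rho k s1.
  by rewrite /s1; apply: (env_frame (den_frame _ _) he).
have [] := @fill0P vs X rS aT.[vs]%X s1 v.
- by [].
- move=> j s2; rewrite evVar (envS he1) => hj hf hx _.
  rewrite !exE hx; have [_ ->] := hf; rewrite ?inE //; last by rewrite eq_sym.
  exact: s1T.
rewrite evVar (envS he1) => h _; rewrite /vals h //; split; last by rewrite ltn_pmod.
rewrite natZ_mod natr_sum; apply: eq_bigr => d _.
rewrite natrM; congr (_ * _)%R.
rewrite -(w_mod w_pow_r) -natrX; apply/natZ_eq.
by have [-> //] := ht; rewrite ltn_pmod.
Qed.

Lemma bwdP X s : X < 16 -> X \notin [:: aT; aW; aV] -> env rho k s -> tables rho s ->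
  forall i, i < S -> vals X (den (bwd_prog X) s) i = bwd w rho k (vals X s) i /\
     arr X (den (bwd_prog X) s) i < M.
Proof.
move=> hX; rewrite !inE !negb_or => /and3P[XT XW XV] he ht i hi.
rewrite /bwd_prog denSeq; set body := CSeq (Asg vq _) _.
set s1 := den (For vs _ (CSeq body _)) s.
pose v i := (\sum_(e < r.*2) arr aV s ((e * (i %% r.*2)) %% r.*2) * arr X s (e * r.*2 ^ k + i %/ r.*2)) %% M.
have s1T j : j < S -> arr aT s1 j = v j.
  move=> hj; have [] := @fillP vs aT rS body vacc s v.
  - by [].
  - by [].
  - by [].
  - move=> j' s2 hj' hf hx _; rewrite evVar /body !denSeq.
    set s3 := den (Asg vacc _) _.
    have f3 : frame (vs :: wr body) (aT :: awr body) s s3.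
      by rewrite /s3 !denAsg; do 3 apply: frame_setr2 => //.
    have he3 := env_frame f3 he isT.
    rewrite (@sumP ve vacc rM rR2 _ s3 (fun e => arr aV s ((e * (j' %% r.*2)) %% r.*2) * arr X s (e * r.*2 ^ k + j' %/ r.*2))) //.
      by rewrite (envM he3) evVar (envR2 he3).
    move=> e s4 _ f4 hd.
    have f5 : frame (vs :: wr body) (aT :: awr body) s s4.
      apply: frame_trans f3 _; apply: frame_sub f4 => z //.
      by rewrite !inE => /orP[]/eqP->.
    have he5 := env_frame f5 he isT.
    have kq : reg s4 vq = j' %/ r.*2.
      have [-> //] := f4; rewrite /s3 !exE /= hx.
      by have [-> //] := hf; rewrite (envR2 he).
    have ke : reg s4 vd = j' %% r.*2.
      have [-> //] := f4; rewrite /s3 !exE /= hx.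
      by have [-> //] := hf; rewrite (envR2 he).
    rewrite !exE /= kq ke hd (envR2 he5) (envQ he5).
    by have [_ fa] := f5; rewrite !fa //= inE.
  - by rewrite evVar (envS he) => h _; apply: h.
have he1 : env rho k s1.
  by rewrite /s1; apply: (env_frame (den_frame _ _) he).
have [] := @fill0P vs X rS aT.[vs]%X s1 v.
- by [].
- move=> j s2; rewrite evVar (envS he1) => hj hf hx _.
  rewrite !exE hx; have [_ ->] := hf; rewrite ?inE //; last by rewrite eq_sym.
  exact: s1T.
rewrite evVar (envS he1) => h _; rewrite /vals h //; split; last by rewrite ltn_pmod.
rewrite natZ_mod natr_sum; apply: eq_bigr => e _.
rewrite natrM; congr (_ * _)%R.
rewrite exprD -(w'_mod w_pow_r) -exprD /w' -!natrX; apply/natZ_eq.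
by have [_ -> //] := ht; rewrite ltn_pmod.
Qed.

Lemma iter_fwdP n X s : X < 16 -> X \notin [:: aT; aW; aV] -> env rho k s -> tables rho s ->
  reg s rK = n -> forall i, i < S ->
  vals X (den (For vu rK (fwd_prog X)) s) i = iter n (fwd w rho k) (vals X s) i.
Proof.
move=> hX XT he ht hn.
pose I n s1 := forall i, i < S -> vals X s1 i = iter n (fwd w rho k) (vals X s) i.
suff : I (ev rK s) (den (For vu rK (fwd_prog X)) s) by rewrite evVar hn.
apply: for_inv => // j s1 _ hf hI i hi.
have hA : (aW \notin awr (fwd_prog X)) && (aV \notin awr (fwd_prog X)).
  by rewrite /= hX; move: XT; rewrite !inE !negb_or ![_ == X]eq_sym => /and3P[_ -> ->].
have f1 : frame (vu :: wr (fwd_prog X)) (awr (fwd_prog X)) s (setr s1 vu j).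
  by apply: frame_setr2.
have [-> _] := fwdP hX XT (env_frame f1 he isT) (tables_frame f1 ht hA) hi.
by rewrite iterS; apply: eq_fwd.
Qed.

(** At least one pass must be made for the entries to be reduced, whence [n.+1]. Reducedness is what
    lets residues modulo [M] determine the integers stored. *)
Lemma iter_bwdP n X s : X < 16 -> X \notin [:: aT; aW; aV] -> env rho k s -> tables rho s ->
  reg s rK = n.+1 -> forall i, i < S ->
  vals X (den (For vu rK (bwd_prog X)) s) i = iter n.+1 (bwd w rho k) (vals X s) i /\
  arr X (den (For vu rK (bwd_prog X)) s) i < M.
Proof.
move=> hX XT he ht hn.
pose I n s1 := forall i, i < S -> vals X s1 i = iter n (bwd w rho k) (vals X s) i /\
  (0 < n -> arr X s1 i < M).
suff : I (ev rK s) (den (For vu rK (bwd_prog X)) s).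
  by rewrite evVar hn => h i /h[-> /(_ isT)].
apply: for_inv => // j s1 _ hf hI i hi.
have hA : (aW \notin awr (bwd_prog X)) && (aV \notin awr (bwd_prog X)).
  by rewrite /= hX; move: XT; rewrite !inE !negb_or ![_ == X]eq_sym => /and3P[_ -> ->].
have f1 : frame (vu :: wr (bwd_prog X)) (awr (bwd_prog X)) s (setr s1 vu j).
  by apply: frame_setr2.
have [] := bwdP hX XT (env_frame f1 he isT) (tables_frame f1 ht hA) hi.
move=> -> h; split=> //; rewrite iterS; apply: eq_bwd => // u hu.
by have [h1 _] := hI u hu; exact: h1.
Qed.

Lemma foldP p s : 0 < p -> reg s rP = p -> env rho k s ->
  forall m, m < r ^ k.+1 -> arr aC (den fold_prog s) m =
    (\sum_(x < S | fold r k.+1 x == m) arr aX s x) %% p.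
Proof.
move=> p0 hp he; rewrite /fold_prog denSeq; set s1 := den (For _ _ _) s.
have he1 : env rho k s1 by rewrite /s1; apply: (env_frame (den_frame _ _) he).
have s10 m : m < r ^ k.+1 -> arr aC s1 m = 0.
  have [] := @fill0P vs aC rRK #0%X s (fun=> 0); [by []|by []|].
  by rewrite evVar (envRK he) => h _; apply: h.
have s1X x : arr aX s1 x = arr aX s x by rewrite den_arr.
have s1p : reg s1 rP = p by rewrite den_reg.
clearbody s1.
pose I n s2 := forall m, m < r ^ k.+1 ->
  arr aC s2 m = (\sum_(x < n | fold r k.+1 x == m) arr aX s x) %% p.
suff : I (ev rS s1) (den (For vs rS (digits;; aC$[vpos] ::= ((aC.[vpos] + aX.[vs]) %% rP))%C) s1).
  by rewrite evVar (envS he1).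
apply: for_inv => [m hm|n s2 hn hf hI m hm]; first by rewrite big_ord0 mod0n s10.
set s3 := setr s2 vs n.
have f3 : frame (vs :: wr (digits;; aC$[vpos] ::= ((aC.[vpos] + aX.[vs]) %% rP))%C) [:: aC] s1 s3.
  exact: frame_setr2.
have [dp _] := digitsP (env_frame f3 he1 isT).
have vsn : reg s3 vs = n by rewrite /s3 reg_setr.
rewrite denSeq denSt arr_setm // eqxx !exE !dp !vsn /=.
have -> : reg (den digits s3) rP = p by rewrite den_reg //; have [-> //] := f3.
have -> : reg (den digits s3) vs = n by rewrite den_reg.
have aCE x : arr aC (den digits s3) x = arr aC s2 x by rewrite den_arr.
have aXE x : arr aX (den digits s3) x = arr aX s x.
  by rewrite den_arr // -s1X; have [_ ->] := f3.
rewrite !aCE aXE big_mkcond big_ord_recr /= -big_mkcond /= eq_sym.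
case: eqP => [->|_]; last by rewrite addn0 hI.
by rewrite hI // modnDml.
Qed.

Let N := r ^ k.+1.

(** Every entry of the integer convolution over spread indices is at most [N ^ 2 * p ^ 2 < M], so it
    is recovered exactly from its residue modulo [M]; only then are the entries added up modulo
    [p]. *)
Lemma polymulP p s : 0 < p -> reg s rP = p -> env rho k s -> tables rho s ->
  (forall i, i < N -> arr aA s i < p) -> (forall i, i < N -> arr aB s i < p) ->
  N ^ 2 * p ^ 2 < M ->
  forall m, m < N -> arr aC (den polymul s) m =
    (\sum_(i < N) \sum_(j < N | i + j == m) arr aA s i * arr aB s j) %% p.
Proof.
move=> p0 hp he ht hA hB hM m hm.
have pM : p <= M.
  have N0 : 0 < N by rewrite expn_gt0 r0.
  apply: leq_trans (ltnW hM); rewrite -{1}[p]mul1n; apply: leq_mul; first by rewrite expn_gt0 N0.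
  by rewrite -mulnn leq_pmull.
pose a i := ((arr aA s i)%:R : 'Z_M)%R; pose b i := ((arr aB s i)%:R : 'Z_M)%R.
rewrite /polymul 6!denSeq.
set s1 := den (spread_prog _ _) s.
have f1 := den_frame (spread_prog aA aX) s; rewrite -/s1 in f1.
have he1 := env_frame f1 he isT.
set s2 := den (spread_prog _ _) s1.
have f2 := den_frame (spread_prog aB aY) s1; rewrite -/s2 in f2.
have he2 := env_frame f2 he1 isT; have ht2 := tables_frame f2 (tables_frame f1 ht isT) isT.
have X2 i : i < S -> vals aX s2 i = spread_seq rho k a i.
  move=> hi; rewrite /vals /spread_seq; have [_ ->] := f2; rewrite //.
  rewrite /s1 (@spreadP rho k) // natZ_mod; case: small_digits => //.
  by rewrite mul1n.
have Y2 i : i < S -> vals aY s2 i = spread_seq rho k b i.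
  move=> hi; rewrite /vals /spread_seq /s2 (@spreadP rho k) // natZ_mod.
  case: small_digits => //; rewrite mul1n /b.
  by have [_ ->] := f1.
set s3 := den _ s2.
have f3 := den_frame (For vu rK (fwd_prog aX)) s2; rewrite -/s3 in f3.
have he3 := env_frame f3 he2 isT; have ht3 := tables_frame f3 ht2 isT.
have X3 i : i < S -> vals aX s3 i = iter k.+1 (fwd w rho k) (spread_seq rho k a) i.
  move=> hi; rewrite (iter_fwdP (n := k.+1)) //; last exact: envK he2.
  exact: eq_iter_fwd.
have Y3 i : i < S -> vals aY s3 i = spread_seq rho k b i.
  by move=> hi; rewrite -Y2 // /vals; have [_ ->] := f3.
set s4 := den _ s3.
have f4 := den_frame (For vu rK (fwd_prog aY)) s3; rewrite -/s4 in f4.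
have he4 := env_frame f4 he3 isT; have ht4 := tables_frame f4 ht3 isT.
have X4 i : i < S -> vals aX s4 i = iter k.+1 (fwd w rho k) (spread_seq rho k a) i.
  by move=> hi; rewrite -X3 // /vals; have [_ ->] := f4.
have Y4 i : i < S -> vals aY s4 i = iter k.+1 (fwd w rho k) (spread_seq rho k b) i.
  by move=> hi; rewrite (iter_fwdP (n := k.+1)) //; [exact: eq_iter_fwd | exact: envK he3].
set s5 := den _ s4.
have f5 := den_frame (For vs rS (St aX (Var vs) ((aX.[vs] * aY.[vs]) %% rM)%X)) s4; rewrite -/s5 in f5.
have he5 := env_frame f5 he4 isT; have ht5 := tables_frame f5 ht4 isT.
have X5 i : i < S -> vals aX s5 i = (iter k.+1 (fwd w rho k) (spread_seq rho k a) i *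
   iter k.+1 (fwd w rho k) (spread_seq rho k b) i)%R.
  move=> hi; have [] := @fill0P vs aX rS ((aX.[vs] * aY.[vs]) %% rM)%X s4
    (fun i => (arr aX s4 i * arr aY s4 i) %% M).
  - by [].
  - move=> j s' hj hf hx hu; rewrite !exE hx hu //=.
    have [fr fa] := hf; rewrite fr // fa //; by rewrite (envM he4).
  - rewrite evVar (envS he4) => h _; rewrite /vals h // natZ_mod natrM -X4 // -Y4 //.
set s6 := den _ s5.
have f6 := den_frame (For vu rK (bwd_prog aX)) s5; rewrite -/s6 in f6.
have he6 := env_frame f6 he5 isT.
pose c (x : nat) := \sum_(i < N) \sum_(j < N | spread r k.+1 i + spread r k.+1 j == x)
   arr aA s i * arr aB s j.
have cM x : c x < M.
  apply: leq_ltn_trans hM; apply: (@leq_trans (\sum_(i < N) \sum_(j < N) p * p)); last first.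
    by rewrite !sum_nat_const !card_ord; nia.
  apply: leq_sum => i _; rewrite [X in X <= _]big_mkcond; apply: leq_sum => j _.
  by case: ifP => // _; apply: leq_mul; apply: ltnW; [apply: hA | apply: hB].
have X6 x : x < S -> arr aX s6 x = c x.
  move=> hx; have [] := iter_bwdP (X := aX) isT isT he5 ht5 (envK he5) hx.
  rewrite -/s6 (iter_bwd_conv (erefl _) w_pow_r X5 hx) /spread_conv => h1 h2.
  have : (arr aX s6 x)%:R%R = (c x)%:R%R :> 'Z_M.
    rewrite -/(vals aX s6 x) h1 /c natr_sum; apply: eq_bigr => i _; rewrite natr_sum.
    by apply: eq_bigr => j _; rewrite natrM.
  by move/natZ_eq; rewrite !modn_small.
have p6 : reg s6 rP = p.
  have [-> //] := f6; have [-> //] := f5; have [-> //] := f4; have [-> //] := f3.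
  by have [-> //] := f2; have [-> //] := f1.
rewrite (foldP p0 p6 he6) //; congr (_ %% _).
transitivity (\sum_(x < S | fold r k.+1 x == m) c x).
  by apply: eq_bigr => x _; apply: X6.
exact: (@sum_fold_conv nat r k.+1 r0 (arr aA s) (arr aB s) m).
Qed.
End Polymul.

(** * Primitive roots modulo a prime *)

Section PrimitiveRoot.
Local Open Scope ring_scope.
Variable p : nat.
Hypothesis p_pr : prime p.
Let p1 : (1 < p)%N := prime_gt1 p_pr.

Lemma natF_eq (a b : nat) : (a%:R == b%:R :> 'F_p) = (a == b %[mod p]).
Proof. by rewrite -val_eqE /= !val_Fp_nat. Qed.

Lemma natF_mod (a : nat) : (a %% p)%:R = a%:R :> 'F_p.
Proof. by apply/eqP; rewrite natF_eq modn_mod. Qed.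

Lemma natF_eq0 (a : nat) : (a%:R == 0 :> 'F_p) = (p %| a)%N.
Proof. by rewrite (natF_eq a 0) mod0n. Qed.

Lemma natF_lt_eq0 (a : nat) : (a < p)%N -> (a%:R == 0 :> 'F_p) = (a == 0)%N.
Proof. by move=> ap; rewrite natF_eq0; case: a ap => [|a] ap; [rewrite dvdn0 | rewrite gtnNdvd]. Qed.

Lemma natF_val (x : 'F_p) : (val x)%:R = x.
Proof. by rewrite natr_Zp. Qed.

Lemma valF_lt (x : 'F_p) : (val x < p)%N.
Proof. by rewrite -[X in (_ < X)%N](Fp_cast p_pr); apply: ltn_ord. Qed.

Lemma fermatF (x : 'F_p) : x != 0 -> x ^+ p.-1 = 1.
Proof.
move=> x0; apply: (mulfI x0); rewrite -exprS prednK ?prime_gt0 // mulr1.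
by have := expf_card x; rewrite card_Fp.
Qed.

(* The least element [m] outside a proper subgroup containing [1..B] exceeds
   [B]; with [k = p %/ m + 1] both [k] and [k m - p] are smaller than [m]. *)
Lemma small_nonresidue B d : (p <= B ^ 2)%N -> (0 < d < p.-1)%N ->
  exists a, (0 < a <= B)%N && ((a%:R : 'F_p) ^+ d != 1) && (a%:R != 0 :> 'F_p).
Proof.
move=> hB /andP[d0 dp].
have [/existsP[a ha]|no] := boolP [exists a : 'I_B.+1,
    (0 < a <= B)%N && ((a%:R : 'F_p) ^+ d != 1) && (a%:R != 0 :> 'F_p)].
  by exists a.
have small a : (0 < a <= B)%N -> (a < p)%N -> (a%:R : 'F_p) ^+ d = 1.
  move=> /andP[a0 aB] ap; move/existsPn: no => /(_ (Ordinal (aB : (a < B.+1)%N))) /=.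
  by rewrite a0 aB /= negb_and !negbK natF_lt_eq0 // (gtn_eqF a0) orbF => /eqP.
have all m : (0 < m < p)%N -> (m%:R : 'F_p) ^+ d = 1.
  elim/ltn_ind: m => m IH /andP[m0 mp].
  have [mB|Bm] := leqP m B; first by apply: small => //; rewrite m0.
  have m1 : (1 < m)%N.
    apply: leq_ltn_trans Bm; rewrite lt0n; apply/negP => /eqP B0.
    by move: hB; rewrite B0; lia.
  pose k := (p %/ m).+1.
  have pm := divn_eq p m; have lm := ltn_pmod p m0.
  have pm0 : (0 < p %% m)%N.
    rewrite lt0n; apply/negP => /eqP h; have : (m %| p)%N by rewrite /dvdn h.
    by move/(primeP p_pr).2; rewrite (gtn_eqF m1) (ltn_eqF mp).
  have kB : (k <= B)%N.
    rewrite /k ltn_divLR //; nia.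
  have h1 : (k%:R : 'F_p) ^+ d = 1.
    by apply: IH; [apply: leq_ltn_trans Bm | rewrite /= (leq_ltn_trans kB (ltn_trans Bm mp))].
  have h2 : ((k * m - p)%:R : 'F_p) ^+ d = 1.
    by apply: IH; rewrite /k; nia.
  have h3 : (k * m - p)%:R = k%:R * m%:R :> 'F_p.
    by rewrite -natrM; apply/eqP; rewrite natF_eq -(modnDr (k * m - p)) subnK // /k; nia.
  by move: h2; rewrite h3 exprMn h1 mul1r.
(* By now all [p - 1] nonzero elements are roots of [X ^ d - 1] with [d < p - 1], which is too
   many. *)
pose rs := [seq x <- enum 'F_p | x != 0].
have := @max_unity_roots 'F_p d rs d0 _ _.
rewrite /rs filter_uniq ?enum_uniq //.
have -> : size [seq x <- enum 'F_p | x != 0] = p.-1.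
  rewrite size_filter -[in RHS](card_Fp p_pr) -(cardC1 (0 : 'F_p)) cardE size_filter.
  by rewrite enumT.
rewrite leqNgt dp => /(_ _ isT) h; suff: false by []; apply: h.
apply/allP => x; rewrite mem_filter => /andP[x0 _]; apply/unity_rootP.
rewrite -(natF_val x); apply: all; rewrite valF_lt andbT lt0n.
by apply: contra x0 => /eqP h; rewrite -(natF_val x) h.
Qed.

(** If the order [m] of the product were a proper divisor of [q = p - 1], a prime [l] dividing
    [q / m] would give [g ^+ (q %/ l) = 1]. In this power the factors of the primes other than [l]
    become 1 by Fermat. What remains says that [b = h l ^+ (q %/ l)] has order dividing the
    prime-to-[l] part of [q]; it also divides [l], so [b = 1], against the choice of [h l]. *)
Lemma prim_root_of_cofactors (h : nat -> 'F_p) :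
  (forall l, l \in primes p.-1 -> h l != 0 /\ h l ^+ (p.-1 %/ l) != 1) ->
  (p.-1).-primitive_root (\prod_(l <- primes p.-1) h l ^+ (p.-1)`_l^').
Proof.
move=> hh; set q := p.-1 in hh *; set g := \prod_(_ <- _) _.
have q0 : (0 < q)%N by rewrite /q -subn1 subn_gt0.
have g0 : g != 0.
  rewrite prodf_seq_neq0; apply/allP => l hl /=; rewrite expf_neq0 //.
  by have [] := hh l hl.
have [m pm mq] := prim_order_exists q0 (fermatF g0).
have [->//|/eqP mneq] := eqVneq q m.
have qm1 : (1 < q %/ m)%N.
  have := divnK mq; case: (q %/ m)%N => [|[|?]] //; first by move=> hz; move: q0; rewrite -hz.
  by rewrite mul1n => hz; case: mneq.
pose l := pdiv (q %/ m).
have lp : prime l := pdiv_prime qm1.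
have lqm : (l %| q %/ m)%N := pdiv_dvd _.
have lq : (l %| q)%N by apply: dvdn_trans lqm _; apply/dvdnP; exists m; rewrite mulnC divnK.
have lin : l \in primes q by rewrite mem_primes lp q0.
have mql : (m %| q %/ l)%N.
  by rewrite -(divnK mq) -divn_mulAC // dvdn_mull.
have gl : g ^+ (q %/ l) = 1 by apply/eqP; rewrite -(prim_order_dvd pm).
have [hl0 hl1] := hh l lin.
move: gl; rewrite /g (bigD1_seq l) ?primes_uniq //= exprMn.
rewrite -[X in _ * X]prodrXl big_seq_cond big1 ?mulr1; last first.
  move=> l' /andP[l'in ll']; have [h0 _] := hh l' l'in.
  have l'p : prime l' by move: l'in; rewrite mem_primes => /and3P[].
  rewrite -exprM; suff /dvdnP[c ->] : (q %| q`_l'^' * (q %/ l))%N.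
    by rewrite mulnC exprM fermatF // expr1n.
  rewrite -{1}(partnC l' q0) mulnC dvdn_pmul2l ?part_gt0 //.
  have : (q`_l' %| q %/ l * l)%N by rewrite divnK // dvdn_part.
  rewrite Gauss_dvdl // p_part coprimeXl // prime_coprime // dvdn_prime2 //.
rewrite -exprM mulnC exprM => /eqP hb; case/negP: hl1.
set b := h l ^+ _ in hb *.
have bl : b ^+ l = 1 by rewrite /b -exprM divnK // fermatF.
have [c pc cl] := prim_order_exists (prime_gt0 lp) bl.
have := prim_order_dvd pc q`_l^'; rewrite hb => cq.
have c1 : (c %| gcdn l q`_l^')%N by rewrite dvdn_gcd cl cq.
have : coprime l q`_l^' by rewrite prime_coprime // -p'natE // part_pnat.
rewrite /coprime => /eqP cop; move: c1; rewrite cop dvdn1 => /eqP c1.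
by apply/eqP; have := prim_expr_order pc; rewrite c1 expr1.
Qed.

Lemma prim_root_powers (g x : 'F_p) : (p.-1).-primitive_root g -> x != 0 ->
  exists2 e, (e < p.-1)%N & x = g ^+ e.
Proof.
move=> pg x0; have [i ->] := prim_rootP pg (fermatF x0).
by exists i.
Qed.
End PrimitiveRoot.

(** * Block products and chirp evaluation *)

Section PolyField.
Local Open Scope ring_scope.
Variable F : fieldType.
Implicit Types (f h : {poly F}) (c d q x y : F).

Definition pol (N : nat) (a : nat -> nat) : {poly F} := \poly_(i < N) (a i)%:R.

Lemma pol_conv (N : nat) (a b : nat -> nat) (m : nat) : (m < N)%N ->
  ((\sum_(i < N) \sum_(j < N | (i + j == m)%N) a i * b j)%N)%:R = (pol N a * pol N b)`_m.
Proof.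
move=> mN; rewrite coefM natr_sum.
transitivity (\sum_(i < N) if (i < m.+1)%N then (a i)%:R * (pol N b)`_(m - i) else 0 : F).
  apply: eq_bigr => i _; rewrite natr_sum; case: ltnP => him.
    have hj : (m - i < N)%N by apply: leq_ltn_trans mN; apply: leq_subr.
    rewrite (big_pred1 (Ordinal hj)) => [|j]; first by rewrite /= natrM coef_poly hj.
    by rewrite /= -val_eqE /=; apply/eqP/eqP; lia.
  rewrite big_pred0 // => j; apply/eqP; lia.
rewrite -(big_mkord xpredT (fun i => if (i < m.+1)%N then (a i)%:R * (pol N b)`_(m - i) else 0)).
rewrite (big_cat_nat (n := m.+1)) //= [X in _ + X]big1_seq ?addr0; last first.
  by move=> i /=; rewrite mem_index_iota => /andP[mi _]; rewrite ltnNge mi.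
rewrite big_mkord; apply: eq_bigr => i _; rewrite ltn_ord.
by have -> : (pol N a)`_i = (a i)%:R by rewrite coef_poly (leq_trans (ltn_ord i) mN).
Qed.

Definition scalex f c : {poly F} := f \Po (c *: 'X).

Lemma scalex_coef f c i : (scalex f c)`_i = f`_i * c ^+ i.
Proof.
rewrite /scalex comp_polyE coef_sum.
under eq_bigr do rewrite exprZn !coefZ coefXn.
have [hi|hi] := ltnP i (size f).
  rewrite (bigD1 (Ordinal hi)) //= eqxx mulr1 big1 ?addr0 // => j.
  by rewrite -val_eqE /= eq_sym => /negbTE ->; rewrite !mulr0.
rewrite big1 ?(nth_default _ hi) ?mul0r // => j _.
by rewrite gtn_eqF ?mulr0 // (leq_trans (ltn_ord j)).
Qed.

Lemma scalexM f h c : scalex (f * h) c = scalex f c * scalex h c.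
Proof. exact: comp_polyM. Qed.

Lemma scalex_scalex f c d : scalex (scalex f c) d = scalex f (c * d).
Proof. by apply/polyP => i; rewrite !scalex_coef exprMn mulrA. Qed.

Lemma scalex1 f : scalex f 1 = f.
Proof. by rewrite /scalex scale1r comp_polyXr. Qed.

Lemma horner_scalex f c x : (scalex f c).[x] = f.[c * x].
Proof. by rewrite /scalex horner_comp hornerZ hornerX. Qed.

Lemma size_scalex f c : (size (scalex f c) <= size f)%N.
Proof. by apply/leq_sizeP => i hi; rewrite scalex_coef (nth_default _ hi) mul0r. Qed.

Definition block f (g : F) (l : nat) : {poly F} := \prod_(i < 2 ^ l) scalex f (g ^+ i).

Lemma block0 f g : block f g 0 = f.
Proof. by rewrite /block big_ord1 expr0 scalex1. Qed.

Lemma blockS f g l : block f g l.+1 = block f g l * scalex (block f g l) (g ^+ (2 ^ l)).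
Proof.
have scalexP (n : nat) (G : nat -> {poly F}) c :
    scalex (\prod_(i < n) G i) c = \prod_(i < n) scalex (G i) c.
  elim: n => [|n IH]; first by rewrite !big_ord0 /scalex comp_polyC.
  by rewrite !big_ord_recr /= scalexM IH.
rewrite /block (scalexP _ (fun i => scalex f (g ^+ i))) expnS mul2n -addnn big_split_ord /=.
by congr (_ * _); apply: eq_bigr => i _; rewrite scalex_scalex -exprD addnC.
Qed.

Lemma size_block f g l n : (size f <= n.+1)%N -> (size (block f g l) <= (n * 2 ^ l).+1)%N.
Proof.
move=> hf; elim: l => [|l IH]; first by rewrite block0 muln1.
rewrite blockS; apply: leq_trans (size_polyMleq _ _) _.
have := leq_trans (size_scalex (block f g l) (g ^+ (2 ^ l))) IH.
rewrite expnS; move: IH; lia.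
Qed.

Lemma horner_block0 f g l x :
  ((block f g l).[x] == 0) = [exists i : 'I_(2 ^ l), f.[g ^+ i * x] == 0].
Proof.
rewrite /block horner_prod prodf_seq_eq0; apply/hasP/existsP => [[i _ /=]|[i hi]].
  by rewrite horner_scalex => h; exists i.
by exists i; rewrite ?mem_index_enum //= horner_scalex.
Qed.

(* Bluestein's identity: [ij = C(i+j,2) - C(i,2) - C(j,2)]. *)
Lemma chirp (N len : nat) (S a b : nat -> nat) (y q q' : F) (j : nat) :
  q * q' = 1 -> (0 < len)%N -> (len.-1 + j < N)%N ->
  (forall i, (i < len)%N -> (a (len.-1 - i)%N)%:R = (S i)%:R * q' ^+ 'C(i, 2) * y ^+ i :> F) ->
  (forall i, (len <= i < N)%N -> a i = 0%N) ->
  (forall i, (i < N)%N -> (b i)%:R = q ^+ 'C(i, 2) :> F) ->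
  (pol N a * pol N b)`_(len.-1 + j) = q ^+ 'C(j, 2) * (pol len S).[y * q ^+ j].
Proof.
move=> qq l0 hN ha ha0 hb; rewrite coefM.
have la : (len <= (len.-1 + j).+1)%N by lia.
rewrite -(big_mkord xpredT (fun i => (pol N a)`_i * (pol N b)`_(len.-1 + j - i))).
rewrite (big_cat_nat (n := len)) //= [X in _ + X]big1_seq ?addr0; last first.
  move=> i /=; rewrite mem_index_iota => /andP[h1 h2].
  by rewrite /pol coef_poly; case: ifP => h3; rewrite ?ha0 ?mul0r //; lia.
(* [a] stores the twisted coefficients backwards, so at total degree [len.-1 + j] the coefficient of
   index [i] meets [b (i + j)]. *)
rewrite big_nat_rev /= add0n big_mkord /pol horner_poly mulr_sumr; apply: eq_bigr => i _.
have il := ltn_ord i.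
rewrite !coef_poly (_ : (len - i.+1 < N)%N); last lia.
rewrite (_ : (len.-1 + j - (len - i.+1) = i + j)%N); last lia.
rewrite (_ : (i + j < N)%N); last lia.
rewrite (_ : (len - i.+1 = len.-1 - i)%N); last lia.
rewrite ha // hb; last lia.
(* Binomials take the place of halved squares, so no square root of [q] is required. *)
have -> : 'C(i + j, 2) = ('C(i, 2) + 'C(j, 2) + i * j)%N.
  elim: (nat_of_ord i) => [|k IH]; first by rewrite mul0n addn0 bin0n add0n.
  by rewrite addSn !binS !bin1 IH; ring.
rewrite !exprD exprMn [q ^+ (i * j)]exprM -exprM mulnC.
have h : q' ^+ 'C(i, 2) * q ^+ 'C(i, 2) = 1 by rewrite -exprMn mulrC qq expr1n.
transitivity ((q' ^+ 'C(i, 2) * q ^+ 'C(i, 2)) * ((S i)%:R * y ^+ i * (q ^+ 'C(j, 2) * q ^+ (j * i)))).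
  by ring.
by rewrite h mul1r -exprM; ring.
Qed.
End PolyField.

(** * Enumerating roots by blocks of exponents *)

Section Blocks.
Variables (T : Type) (P : nat -> bool) (B : nat).

Definition hits (j : nat) : seq nat := [seq (j * B + i) | i <- iota 0 B & P (j * B + i)].

Lemma hits_filter j : hits j = filter P (iota (j * B) B).
Proof.
transitivity (filter P (iota (j * B + 0) B)); last by rewrite addn0.
by rewrite iotaDl filter_map.
Qed.

Lemma flatten_hits J : flatten [seq hits j | j <- iota 0 J] = filter P (iota 0 (J * B)).
Proof.
elim: J => // J IH; rewrite -addn1 iotaD map_cat flatten_cat IH /= cats0 add0n.
by rewrite addn1 mulSnr iotaD filter_cat hits_filter.
Qed.

Lemma flatten_hits_filter (bad : nat -> bool) J :
  (forall j, has (fun i => P (j * B + i)) (iota 0 B) -> bad j) ->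
  flatten [seq hits j | j <- iota 0 J & bad j] = filter P (iota 0 (J * B)).
Proof.
move=> hb; rewrite -flatten_hits; elim: (iota 0 J) => //= j s IH.
case: ifP => hj /=; rewrite IH //.
suff -> : hits j = [::] by [].
rewrite /hits; have : ~~ has (fun i => P (j * B + i)) (iota 0 B) by apply/negP => /hb; rewrite hj.
by rewrite has_filter negbK => /eqP ->.
Qed.

(** Blocks are disjoint and each bad one contains at least one hit. *)
Lemma size_hits_filter (bad : nat -> bool) J :
  (forall j, bad j = has (fun i => P (j * B + i)) (iota 0 B)) ->
  size [seq j <- iota 0 J | bad j] <= count P (iota 0 (J * B)).
Proof.
move=> hb; rewrite -size_filter -(@flatten_hits_filter bad) => [|j]; last by rewrite hb.
rewrite size_flatten /shape -map_comp.
have : all bad [seq j <- iota 0 J | bad j] by apply: filter_all.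
elim: [seq _ <- _ | _] => //= j s IH /andP[hj hs]; rewrite -addn1 addnC leq_add ?IH //.
by move: hj; rewrite hb has_filter -size_eq0 -lt0n size_map.
Qed.
End Blocks.

Section FieldRoots.
Local Open Scope ring_scope.
Variables (p : nat) (f : {poly 'F_p}) (g : 'F_p).
Hypotheses (p_pr : prime p) (f0 : f != 0) (pg : (p.-1).-primitive_root g).

Definition root_exp (e : nat) : bool := f.[g ^+ e] == 0.

(** Zero is the one residue that is not a power of [g], so it is treated apart. *)
Lemma perm_roots :
  perm_eq ((if f.[0] == 0 then [:: 0%N] else [::]) ++
           [seq val (g ^+ e) | e <- iota 0 p.-1 & root_exp e])
          [seq val x | x <- enum 'F_p & root f x].
Proof.
have gn e : g ^+ e != 0.
  apply: expf_neq0; apply/negP => /eqP g0; have := prim_expr_order pg.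
  have q0 := prim_order_gt0 pg.
  by rewrite g0 expr0n gtn_eqF // => /eqP; rewrite eq_sym oner_eq0.
have vE : 0%N = val (0 : 'F_p) by [].
have -> : (if f.[0] == 0 then [:: 0%N] else [::]) =
    map val (if f.[0] == 0 then [:: 0 : 'F_p] else [::]) by case: ifP.
rewrite map_comp -map_cat; apply: perm_map; apply: uniq_perm.
- rewrite cat_uniq (map_inj_in_uniq (_ : {in _ &, injective (GRing.exp g)})) ?filter_uniq ?iota_uniq //; last first.
    move=> a b; rewrite !mem_filter !mem_iota !add0n /= => /andP[_ ha] /andP[_ hb] /eqP.
    by rewrite (eq_prim_root_expr pg) !modn_small // => /eqP.
  rewrite andbT; apply/andP; split; first by case: ifP.
  apply/hasPn => x /mapP[e _ ->]; case: ifP => // _.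
  by rewrite inE gn.
- by rewrite filter_uniq // enum_uniq.
- move=> x; rewrite mem_cat mem_filter mem_enum andbT rootE.
  have [->|x0] := eqVneq x 0.
    case: ifP => h; first by rewrite inE eqxx.
    apply/negP; rewrite in_nil /= => /mapP[e _ /esym/eqP]; by rewrite (negbTE (gn e)).
  have -> : (x \in (if f.[0] == 0 then [:: 0] else [::])) = false.
    by case: ifP; rewrite ?inE // (negbTE x0).
  rewrite /=; apply/mapP/idP => [[e he ->]|fx].
    by move: he; rewrite mem_filter => /andP[].
  have [e he xe] := prim_root_powers p_pr pg x0.
  exists e => //; rewrite mem_filter mem_iota /= /root_exp -xe fx add0n he //.
Qed.

Lemma count_root_exp : (count root_exp (iota 0 p.-1) <= (size f).-1)%N.
Proof.
have h := perm_size perm_roots.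
have : (size [seq val x | x <- enum 'F_p & root f x] <= (size f).-1)%N.
  rewrite size_map -ltnS prednK ?size_poly_gt0 //.
  apply: max_poly_roots => //; last by rewrite filter_uniq // enum_uniq.
  by apply/allP => x; rewrite mem_filter => /andP[].
by rewrite -h size_cat size_map size_filter; apply: leq_trans; apply: leq_addl.
Qed.

(** The exponents inspected fill whole blocks and may run past [p - 1]. Within two periods each
    nonzero root is met at most twice. *)
Lemma count_root_exp2 n : (n <= p.-1 + p.-1)%N ->
  (count root_exp (iota 0 n) <= 2 * (size f).-1)%N.
Proof.
move=> hn; apply: (@leq_trans (count root_exp (iota 0 (p.-1 + p.-1)))).
  by rewrite -(subnKC hn) iotaD count_cat leq_addr.
have e2 : iota p.-1 p.-1 = map (addn p.-1) (iota 0 p.-1) by rewrite -iotaDl addn0.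
rewrite iotaD count_cat add0n e2 count_map mul2n -addnn leq_add ?count_root_exp //.
rewrite (eq_count (a2 := root_exp)) ?count_root_exp // => e /=.
by rewrite /root_exp exprD prim_expr_order // mul1r.
Qed.
End FieldRoots.

(** * Programs for the factorization of [p - 1] and for a primitive root *)

Notation rL := 10 (only parsing).
Notation rB := 11 (only parsing).
Notation rG := 12 (only parsing).
Notation rb := 13 (only parsing).
Notation rrho := 14 (only parsing).
Notation rY := 15 (only parsing).
Notation rq := 16 (only parsing).
Notation rqi := 17 (only parsing).
Notation rLen := 18 (only parsing).
Notation rneed := 19 (only parsing).
Notation vbase := 32 (only parsing).
Notation vexp := 33 (only parsing).
Notation vz := 34 (only parsing).
Notation vm := 35 (only parsing).
Notation vl := 36 (only parsing).
Notation vc := 37 (only parsing).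
Notation vi := 38 (only parsing).
Notation va := 39 (only parsing).
Notation vh := 40 (only parsing).
Notation aL := 13 (only parsing).

(** The number of rounds is [rL] whatever the exponent: in the spare rounds the exponent is 0 and
    [vz] stays put. *)
Definition powmod : com :=
  (vz ::= #1;;
   for vt < rL do
     (CIf (vexp %% #2)%X (vz ::= (vz * vbase) %% rP) (vz ::= vz);;
      vbase ::= (vbase * vbase) %% rP;;
      vexp ::= vexp / #2))%C.

(* [rL] rounds suffice to divide all factors [vl] out of [vm]. *)
Definition strip : com :=
  (for vt < rL do CIf (vm %% vl)%X (vm ::= vm) (vm ::= vm / vl))%C.

(** Divisors from 2 to [B] are tried. The cofactor left over is below [p <= B ^ 2] and has no prime
    factor up to [B], so it is 1 or a prime. *)
Definition primes_prog : com :=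
  (vm ::= rP - #1;; vc ::= #0;;
   for vi < (rB - #1) do
     (vl ::= (vi + #2) %% rU;;
      CIf (vm %% vl)%X (vm ::= vm)
        (aL$[vc] ::= vl;; vc ::= (vc + #1) %% rU;; strip));;
   CIf (vm - #1)%X (aL$[vc] ::= vm;; vc ::= (vc + #1) %% rU) (vc ::= vc))%C.

(* Leaves in [vh] an element that is not a [vl]-th power. *)
Definition search : com :=
  (for va < rB do
     (vbase ::= (va + #1) %% rU;; vexp ::= (rP - #1) / vl;; powmod;;
      CIf (vz - #1)%X (vh ::= (va + #1) %% rU) (vh ::= vh)))%C.

(** Stripping [l] from [p - 1] yields the exponent, the prime-to-[l] part of [p - 1], to which the
    element found by [search] is raised. *)
Definition gen_prog : com :=
  (rG ::= #1;;
   for vi < vc do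
     (vl ::= aL.[vi];; vh ::= #0;; search;;
      vm ::= rP - #1;; strip;;
      vbase ::= vh;; vexp ::= vm;; powmod;;
      rG ::= (rG * vz) %% rP))%C.

Definition list_of (A x : nat) (s : state) : seq nat := mkseq (arr A s) (reg s x).

Lemma list_of_push A x e u s : A < 16 -> (reg s x).+1 < reg s u -> u != x ->
  list_of A x (den (A$[x] ::= e;; x ::= (x + #1) %% u)%C s) = rcons (list_of A x s) (ev e s) /\
  reg (den (A$[x] ::= e;; x ::= (x + #1) %% u)%C s) x = (reg s x).+1.
Proof.
move=> hA hu ux; rewrite denSeq /list_of !exE eqxx /= addn1 modn_small //; split=> //.
rewrite /mkseq -addn1 iotaD map_cat add0n cats1 /=; congr rcons; last first.
  by rewrite !exE arr_setm // !eqxx.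
apply/eq_in_map => i; rewrite mem_iota add0n => /andP[_ hi].
by rewrite !exE arr_setm // eqxx (ltn_eqF hi).
Qed.

Section PrimRootProg.
Variables (p L : nat).
Hypothesis p_pr : prime p.
Hypothesis pL : p < 2 ^ L.
Let p1 : 1 < p := prime_gt1 p_pr.

Lemma powmodP s : reg s rP = p -> reg s rL = L -> reg s vexp < 2 ^ L ->
  ((reg (den powmod s) vz)%:R = (reg s vbase)%:R ^+ reg s vexp :> 'F_p)%R /\
  reg (den powmod s) vz < p.
Proof.
move=> hp hL he; set a := ((reg s vbase)%:R : 'F_p)%R; set e := reg s vexp in he *.
pose I n s1 := [/\ ((reg s1 vz)%:R * (reg s1 vbase)%:R ^+ reg s1 vexp = a ^+ e)%R,
  reg s1 vexp < 2 ^ (L - n) & reg s1 vz < p].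
rewrite /powmod denSeq; set s0 := den (Asg _ _) s.
have [] : I (ev rL s0) (den (For vt rL
     (CIf (vexp %% #2)%X (vz ::= (vz * vbase) %% rP) (vz ::= vz);;
      vbase ::= (vbase * vbase) %% rP;;
      vexp ::= vexp / #2)%C) s0).
  apply: for_inv => [|n s1].
    by split; rewrite /s0 !exE //= ?mul1r ?subn0.
  rewrite exE /s0 exE reg_setr /= hL => hn hf [I1 I2 I3].
  have kp : reg s1 rP = p by have [-> //] := hf.
  have p0 : 0 < p by apply: ltnW.
  have e2 : reg s1 vexp %/ 2 < 2 ^ (L - n.+1).
    by rewrite ltn_divLR // -expnSr subnSK.
  have ed := divn_eq (reg s1 vexp) 2.
  rewrite !denSeq denIf; case: ifP; rewrite !exE /= => hod; split; rewrite !exE /= ?kp ?ltn_pmod //.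
  - rewrite -I1 {2}ed exprD !natF_mod // !natrM.
    have -> : reg s1 vexp %% 2 = 1 by move: hod; rewrite modn2; case: odd.
    by rewrite expr1 mulnC exprM expr2 -!mulrA; congr (_ * _)%R; rewrite mulrC.
  - rewrite -I1 {2}ed exprD !natF_mod // !natrM.
    move/eqP: hod => ->.
    by rewrite expr0 mulr1 mulnC exprM expr2.
rewrite {2}/s0 !exE /= hL subnn => h1 h2 h3; split => //.
by move: h1; case: (reg _ vexp) h2 => // _; rewrite expr0 mulr1.
Qed.

Lemma stripP s : prime (reg s vl) -> 0 < reg s vm < 2 ^ L -> reg s rL = L ->
  reg (den strip s) vm = (reg s vm)`_(reg s vl)^'.
Proof.
set l := reg s vl; set m := reg s vm => lp /andP[m0 mL] hL.
pose I n s1 := exists k, [/\ m = reg s1 vm * l ^ k & (n <= k) || ~~ (l %| reg s1 vm)].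
have [] : I (ev rL s) (den strip s).
  apply: for_inv => [|n s1 hn hf [k [I1 I2]]]; first by exists 0; rewrite muln1.
  have kl : reg s1 vl = l by have [-> //] := hf.
  rewrite denIf !exE /= kl -/(dvdn _ _); case: ifP => hd.
    by exists k; rewrite !exE /= /dvdn hd orbT.
  move/negbFE: hd => /dvdnP[c hc]; exists k.+1; rewrite !exE /= hc mulnK ?prime_gt0 //.
  split; first by rewrite I1 hc expnS mulnA.
  move: I2; rewrite hc dvdn_mull // orbF => h; by rewrite ltnS h.
rewrite exE hL => k [h1 h2].
set m' := reg (den strip s) vm in h1 h2 *.
have m'0 : 0 < m' by move: m0; rewrite h1 muln_gt0 => /andP[].
have lm : ~~ (l %| m').
  case/orP: h2 => // Lk; suff : 2 ^ L <= m by rewrite leqNgt mL.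
  rewrite h1; apply: leq_trans (leq_pmull _ m'0).
  apply: leq_trans (_ : l ^ L <= _).
    by case: L => // n; rewrite leq_exp2r // prime_gt1.
  by rewrite leq_pexp2l // prime_gt0.
have cop : coprime m' (l ^ k) by rewrite coprime_sym coprimeXl // prime_coprime.
rewrite -(p'natE _ lp) in lm.
rewrite h1 partnM ?expn_gt0 ?(prime_gt0 lp) // (part_pnat_id lm).
have lk : l.-nat (l ^ k) by rewrite pnatX pnat_id.
by rewrite (part_p'nat (pi := l^')) ?muln1 // pnatNK.
Qed.

Variable B : nat.
Hypothesis hB : p <= B ^ 2.
Hypothesis B2 : 2 <= B.

(** Besides recording that the listed primes are those already divided out, the invariant keeps [2 ^
    (number of listed primes) * cofactor <= p - 1], which bounds the length of the list by [L]. *)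
Lemma primes_progP s : reg s rP = p -> reg s rL = L -> reg s rB = B ->
  L < reg s rU -> B.+2 < reg s rU ->
  let s' := den primes_prog s in
  perm_eq (mkseq (arr aL s') (reg s' vc)) (primes p.-1) /\ reg s' vc < L.
Proof.
move=> hp hL hb hU hU2; set q := p.-1; have q0 : 0 < q by rewrite /q; lia.
have qL : q < 2 ^ L by apply: leq_ltn_trans pL; apply: leq_pred.
pose ls := list_of aL vc.
pose I n s1 := [/\ [/\ 0 < reg s1 vm, reg s1 vm %| q & 2 ^ reg s1 vc * reg s1 vm <= q],
  forall l, prime l -> l %| reg s1 vm -> n.+2 <= l,
  forall l, prime l -> l %| q -> (l %| reg s1 vm) || (l \in ls s1),
  forall l, l \in ls s1 -> [&& prime l, l %| q & ~~ (l %| reg s1 vm)] & uniq (ls s1)].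
have vcL n s1 : I n s1 -> reg s1 vc < L.
  case=> [[h1 h2 h3] _ _ _ _]; rewrite -(ltn_exp2l _ _ (isT : 1 < 2)).
  apply: leq_ltn_trans qL; apply: leq_trans h3; exact: leq_pmulr.
rewrite /primes_prog 3!denSeq; set s0 := den (Asg vc _) _; set s2 := den (For _ _ _) s0.
have s0P : reg s0 rP = p by [].
have [s0L s0B s0U] : [/\ reg s0 rL = L, reg s0 rB = B & reg s0 rU = reg s rU] by [].
have s0m : reg s0 vm = q by rewrite /s0 !exE /= hp /q subn1.
have s0c : reg s0 vc = 0 by [].
clearbody s0.
have : I (ev (rB - #1)%X s0) s2.
  apply: for_inv => [|i s1].
    split.
    - by rewrite s0m s0c q0 dvdnn mul1n leqnn.
    - by move=> l lp _; apply: prime_gt1.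
    - by move=> l lp lq; rewrite s0m lq.
    - by move=> l; rewrite /ls /list_of s0c.
    - by rewrite /ls /list_of s0c.
  rewrite !exE /= s0B => hi hf II; have vcl := vcL _ _ II; case: II => [[I1 I2 I3] I4 I5 I6 I7].
  have [hfr _] := hf.
  have [kL kU] : reg s1 rL = L /\ reg s1 rU = reg s rU by rewrite !hfr.
  set s3 := setr s1 vi i.
  rewrite denSeq; set s4 := den (Asg vl _) s3.
  have l4 : reg s4 vl = i.+2.
    by rewrite /s4 /s3 !exE /= kU addn2 modn_small //; lia.
  have m4 : reg s4 vm = reg s1 vm by [].
  have c4 : reg s4 vc = reg s1 vc by [].
  have ls4 : ls s4 = ls s1 by [].
  have L4 : reg s4 rL = L by [].
  have U4 : reg s4 rU = reg s rU by [].
  clearbody s4.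
  rewrite denIf !exE /= m4 l4; case: ifP => hd.
    have noti l : prime l -> l %| reg s1 vm -> i.+3 <= l.
      move=> lp lm; have := I4 l lp lm; rewrite leq_eqVlt => /orP[/eqP il|//].
      by move: hd; rewrite il; move: lm; rewrite /dvdn => ->.
    have lt : ls (setr s4 vm (reg s1 vm)) = ls s1 := ls4.
    by split; rewrite ?lt ?reg_setr /= ?c4.
  move/negbFE: hd => hd; have {}hd : i.+2 %| reg s1 vm := hd.
  (* The least prime factor of [i.+2] divides the cofactor, whose prime factors are all at least
     [i.+2]. *)
  have dp : prime i.+2.
    have h1 := pdiv_prime (isT : 1 < i.+2); have h2 := pdiv_dvd i.+2.
    have h3 := I4 _ h1 (dvdn_trans h2 hd).
    by have -> : i.+2 = pdiv i.+2 by apply/eqP; rewrite eqn_leq h3 (dvdn_leq _ h2).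
  rewrite -[CSeq (St _ _ _) _]/(CSeq (St aL vc vl) (CSeq (Asg vc ((vc + #1) %% rU)%X) strip)).
  set c1 := St aL vc vl; set c2 := Asg vc _.
  have -> : den (CSeq c1 (CSeq c2 strip)) s4 = den strip (den (CSeq c1 c2) s4) by [].
  have [|e1 e2] := @list_of_push aL vc vl rU s4 isT _ isT.
    by rewrite c4 U4; lia.
  set s5 := den (CSeq c1 c2) s4 in e1 e2 *.
  have m5 : reg s5 vm = reg s1 vm by rewrite /s5 den_reg.
  have l5 : reg s5 vl = i.+2 by rewrite /s5 den_reg.
  have mq : reg s1 vm <= q := dvdn_leq q0 I2.
  have e3 : reg (den strip s5) vm = (reg s1 vm)`_(i.+2)^'.
    have L5 : reg s5 rL = L by rewrite /s5 den_reg.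
    have mL : 0 < reg s1 vm < 2 ^ L by rewrite I1 (leq_ltn_trans mq).
    by have := @stripP s5; rewrite l5 m5; apply.
  have e4 : reg (den strip s5) vc = (reg s1 vc).+1 by rewrite den_reg // -c4.
  have e5 : ls (den strip s5) = rcons (ls s1) i.+2.
    rewrite -ls4 -l4 -[reg s4 vl]/(ev vl s4) -e1 /ls /list_of [reg _ vc]den_reg //.
    by apply: eq_map => j; rewrite den_arr.
  have mE := partnC i.+2 I1.
  have dvm' : (reg s1 vm)`_(i.+2)^' %| reg s1 vm by apply: dvdn_part.
  have ndvd : ~~ (i.+2 %| (reg s1 vm)`_(i.+2)^').
    by rewrite -p'natE // part_pnat.
  have dpart : i.+2 %| (reg s1 vm)`_i.+2.
    by rewrite p_part dvdn_exp // logn_gt0 mem_primes dp I1 hd.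
  have inls : i.+2 \notin ls s1.
    by apply/negP => /I6/and3P[_ _]; rewrite hd.
  split; rewrite ?e3 ?e4 ?e5.
  - split; first by rewrite part_gt0.
      exact: dvdn_trans I2.
    apply: leq_trans I3; rewrite expnSr -mulnA leq_mul2l -{2}mE; apply/orP; right.
    apply: leq_mul => //; apply: leq_trans (dvdn_leq _ dpart); first by [].
    by rewrite part_gt0.
  - move=> l lp lm; have := I4 l lp (dvdn_trans lm dvm').
    by rewrite leq_eqVlt => /orP[/eqP il|//]; case/negP: ndvd; rewrite {1}il.
  - move=> l lp lq; rewrite mem_rcons inE; case/orP: (I5 l lp lq) => [lm|->]; last by rewrite !orbT.
    move: lm; rewrite -{1}mE Euclid_dvdM // => /orP[|->] //.
    rewrite p_part (Euclid_dvdX _ _ lp) => /andP[]; rewrite dvdn_prime2 // => -> _.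
    by rewrite orbT.
  - move=> l; rewrite mem_rcons inE => /orP[/eqP ->|/I6/and3P[-> -> h]].
      by rewrite dp ndvd (dvdn_trans hd I2).
    by apply: contra h => h; apply: dvdn_trans dvm'.
  - by rewrite rcons_uniq inls.
rewrite evOp evVar evNum /= s0B => II; have vcl := vcL _ _ II; case: II => [[I1 I2 I3] I4 I5 I6 I7].
have kU : reg s2 rU = reg s rU by rewrite /s2 den_reg.
have mq : reg s2 vm <= q := dvdn_leq q0 I2.
rewrite denIf evOp evVar evNum /=; case: ifP => hm.
  have m2 : 1 < reg s2 vm by rewrite -subn_gt0 lt0n.
  have mp : prime (reg s2 vm).
    apply/negPn/negP => /primePns[|[l [lp l2 lm]]]; first by rewrite ltnNge m2.
    have := I4 l lp lm; rewrite leqNgt => /negP; apply.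
    rewrite subn1 prednK //; last exact: ltnW.
    by rewrite -(@ltn_exp2r _ _ 2) //; move: hB l2 mq; rewrite /q; lia.
  have [|e1 e2] := @list_of_push aL vc vm rU s2 isT _ isT; first by rewrite kU; lia.
  rewrite -/(list_of aL vc _) e1 e2 exE; set m := reg s2 vm in mp m2 *; split.
    apply: uniq_perm; rewrite ?primes_uniq ?rcons_uniq ?I7 ?andbT //.
      by apply/negP => /I6/and3P[_ _]; rewrite dvdnn.
    move=> l; rewrite mem_rcons inE mem_primes q0; apply/orP/and3P => [[/eqP ->//|/I6/and3P[-> ->]//]|[lp _ lq]].
    case/orP: (I5 l lp lq) => [lm|->]; last by right.
    by left; move: lm; rewrite dvdn_prime2.
  rewrite -(ltn_exp2l _ _ (isT : 1 < 2)) expnS; apply: leq_ltn_trans qL.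
  by apply: leq_trans I3; rewrite mulnC leq_mul2l m2 orbT.
have m1 : reg s2 vm = 1 by move/negbFE: hm; rewrite subn_eq0; move: I1; lia.
rewrite -/(list_of aL vc _) !exE /=; split=> //.
apply: uniq_perm; rewrite ?primes_uniq //.
move=> l; rewrite mem_primes q0 /=; apply/idP/andP => [/I6/and3P[-> ->]//|[lp lq]].
by case/orP: (I5 l lp lq) => //; rewrite m1 dvdn1 => /eqP l1; rewrite l1 in lp.
Qed.

Definition nonresidue (l a : nat) : bool :=
  ((a%:R : 'F_p) != 0)%R && ((a%:R : 'F_p) ^+ (p.-1 %/ l) != 1)%R.

(** The invariant is conditional: [vh] is suitable as soon as some candidate seen so far is. That
    one occurs up to [B] is [small_nonresidue]. *)
Lemma searchP s l : reg s rP = p -> reg s rL = L -> reg s rB = B -> B.+1 < reg s rU ->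
  reg s vl = l -> prime l -> l %| p.-1 -> reg s vh = 0 ->
  nonresidue l (reg (den search s) vh).
Proof.
move=> hp hL hb hU hl lp lq h0.
have q0 : 0 < p.-1 by rewrite -subn1 subn_gt0.
have d0 : 0 < p.-1 %/ l < p.-1.
  by rewrite divn_gt0 ?prime_gt0 // dvdn_leq //= ltn_Pdiv ?prime_gt1.
pose I n s1 := (exists2 a, 0 < a <= n & nonresidue l a) -> nonresidue l (reg s1 vh).
have : I (ev rB s) (den search s).
  apply: for_inv => [[[|a]]|i s1] //.
  rewrite evVar hb => hi hf II.
  have [hfr _] := hf.
  have [kP kL kU kl] : [/\ reg s1 rP = p, reg s1 rL = L, reg s1 rU = reg s rU & reg s1 vl = l].
    by rewrite !hfr.
  rewrite 3!denSeq; set s2 := den (Asg vexp _) _.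
  have b2 : reg s2 vbase = i.+1.
    by rewrite /s2 !exE /= kU addn1 modn_small //; lia.
  have e2 : reg s2 vexp = p.-1 %/ l by rewrite /s2 !exE /= kP kl subn1.
  have P2 : reg s2 rP = p by [].
  have L2 : reg s2 rL = L by [].
  have A2 : reg s2 va = i by [].
  have U2 : reg s2 rU = reg s rU by [].
  have H2 : reg s2 vh = reg s1 vh by [].
  clearbody s2.
  have [|z1 z2] := powmodP P2 L2.
    rewrite e2; apply: leq_ltn_trans (leq_div _ _) _; apply: leq_ltn_trans pL; exact: leq_pred.
  rewrite b2 e2 in z1.
  (* Subtraction is truncated, so the test also rejects [vz = 0], that is, the multiples of [p]. *)
  have Z : (reg (den powmod s2) vz - 1 != 0) = nonresidue l i.+1.
    have zE : ((i.+1)%:R == 0 :> 'F_p)%R = (reg (den powmod s2) vz == 0).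
      by rewrite -(natF_lt_eq0 p_pr z2) z1 expf_eq0; case/andP: d0 => ->.
    rewrite /nonresidue zE -z1 (natF_eq p_pr _ 1) !modn_small //.
    by case: (reg _ vz) => [|[|?]].
  rewrite denIf evOp evVar evNum /= Z; case: ifP => hz.
    rewrite /I exE reg_setr !exE /= [reg _ va]den_reg // [reg _ rU]den_reg // A2 U2 addn1.
    by rewrite modn_small //; lia.
  rewrite /I exE reg_setr !exE /= [reg _ vh]den_reg // H2 => -[a /andP[a0 ai] ha].
  apply: II; exists a => //; rewrite a0 /=; move: ai; rewrite leq_eqVlt => /orP[/eqP aE|//].
  by rewrite aE hz in ha.
rewrite evVar hb; apply.
have [a /andP[/andP[a1 a2] a3]] := small_nonresidue p_pr hB d0.
by exists a => //; rewrite /nonresidue a2 a3.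
Qed.

(** The function [h] of the invariant remembers which element was found for which prime. Each round
    overrides it at the current prime, which is harmless to the earlier ones because the list has no
    repetition. *)
Lemma gen_progP s : reg s rP = p -> reg s rL = L -> reg s rB = B -> B.+1 < reg s rU ->
  p < reg s rU -> perm_eq (list_of aL vc s) (primes p.-1) ->
  let s' := den gen_prog s in
  reg s' rG < p /\ ((p.-1).-primitive_root ((reg s' rG)%:R : 'F_p))%R.
Proof.
move=> hp hL hb hU hU2 hperm; set ls := list_of aL vc s in hperm.
have q0 : 0 < p.-1 by rewrite -subn1 subn_gt0.
have lsU : uniq ls by rewrite (perm_uniq hperm) primes_uniq.
pose I n s1 := reg s1 rG < p /\ exists h : nat -> nat,
  (forall l, l \in take n ls -> nonresidue l (h l)) /\
  ((reg s1 rG)%:R = \prod_(l <- take n ls) (h l)%:R ^+ (p.-1)`_l^' :> 'F_p)%R.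
rewrite /gen_prog denSeq; set s0 := den (Asg _ _) s; set s' := den _ s0.
have sz : size ls = reg s vc by rewrite size_mkseq.
have : I (ev vc s0) s'.
  apply: for_inv => [|i s1].
    by split; [rewrite /s0 !exE | exists id; rewrite take0 big_nil /s0 !exE].
  rewrite evVar /s0 exE reg_setr /= => hi hf [I0 [h [I1 I2]]].
  have [hfr hfa] := hf.
  have [kP kL kU kB] : [/\ reg s1 rP = p, reg s1 rL = L, reg s1 rU = reg s rU & reg s1 rB = B].
    by rewrite !hfr.
  set l := nth 0 ls i.
  have lin : l \in ls by apply: mem_nth; rewrite sz.
  have /and3P[lp _ lq] : [&& prime l, 0 < p.-1 & l %| p.-1].
    by rewrite -mem_primes -(perm_mem hperm).
  rewrite 8!denSeq; set s2 := den (Asg vh _) _.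
  have l2 : reg s2 vl = l.
    rewrite /s2 !exE /= hfa // !exE /l /ls /list_of nth_mkseq //.
  have h2 : reg s2 vh = 0 by [].
  have [P2 L2 U2 B2'] : [/\ reg s2 rP = p, reg s2 rL = L, reg s2 rU = reg s rU & reg s2 rB = B] by [].
  have G2 : reg s2 rG = reg s1 rG by [].
  clearbody s2.
  have := searchP P2 L2 B2' (_ : B.+1 < reg s2 rU) l2 lp lq h2; rewrite U2 => /(_ hU).
  have [P3 L3 l3 G3] : [/\ reg (den search s2) rP = p, reg (den search s2) rL = L,
     reg (den search s2) vl = l & reg (den search s2) rG = reg s1 rG] by rewrite !den_reg.
  set a := reg (den search s2) vh => ha.
  set s3 := den (Asg vm _) (den search s2).
  have H3 : reg s3 vh = a by rewrite /s3 !exE.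
  have m3 : reg s3 vm = p.-1 by rewrite /s3 !exE /= P3 subn1.
  have {}P3 : reg s3 rP = p by rewrite /s3 !exE.
  have {}L3 : reg s3 rL = L by rewrite /s3 !exE.
  have {}l3 : reg s3 vl = l by rewrite /s3 !exE.
  have {}G3 : reg s3 rG = reg s1 rG by rewrite /s3 !exE.
  clearbody s3 a.
  have qL : 0 < p.-1 < 2 ^ L by rewrite q0 (leq_ltn_trans (leq_pred _) pL).
  have := @stripP s3; rewrite l3 m3 => /(_ lp qL L3) m4.
  have [P4 L4 H4 G4] : [/\ reg (den strip s3) rP = p, reg (den strip s3) rL = L,
     reg (den strip s3) vh = a & reg (den strip s3) rG = reg s1 rG] by rewrite !den_reg.
  set s4 := den strip s3 in m4 P4 L4 H4 G4 *; clearbody s4.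
  set s5 := den (Asg vexp _) _.
  have b5 : reg s5 vbase = a by rewrite /s5 !exE.
  have e5 : reg s5 vexp = (p.-1)`_l^' by rewrite /s5 !exE.
  have P5 : reg s5 rP = p by rewrite /s5 !exE.
  have L5 : reg s5 rL = L by rewrite /s5 !exE.
  have G5 : reg s5 rG = reg s1 rG by rewrite /s5 !exE.
  clearbody s5.
  have [|z1 z2] := powmodP P5 L5.
    rewrite e5; apply: leq_ltn_trans (_ : p.-1 < _); last by case/andP: qL.
    by apply: dvdn_leq q0 _; apply: dvdn_part.
  have [P6 G6] : reg (den powmod s5) rP = p /\ reg (den powmod s5) rG = reg s1 rG by rewrite !den_reg.
  have lni : l \notin take i ls by rewrite in_take // index_uniq ?sz // ltnn.
  split.
    by rewrite !exE /= P6 ltn_pmod // prime_gt0.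
  exists (fun l' => if l' == l then a else h l'); rewrite (take_nth 0) ?sz // -/l; split.
    move=> l'; rewrite mem_rcons inE; case: eqP => [-> _ //|_ /=]; exact: I1.
  rewrite !exE /= P6 natF_mod // natrM G6 I2 z1 b5 e5 -cats1 big_cat big_seq1 eqxx; congr (_ * _)%R.
  rewrite !big_seq; apply: eq_bigr => l' l'in; case: eqP => // ll.
  by rewrite -ll l'in in lni.
rewrite evVar /s0 exE reg_setr /= -sz /I take_size => -[h1 [h [h2 h3]]].
split=> //; rewrite h3 (perm_big _ hperm) /=.
apply: (@prim_root_of_cofactors p p_pr (fun l => (h l)%:R)%R) => l.
by rewrite -(perm_mem hperm) => /h2 /andP[].
Qed.
End PrimRootProg.

(** * Parameters *)

Notation vw := 41 (only parsing).
Notation vj := 42 (only parsing).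

(* With [t] the integer square root of [L], the bit length of [p]: the radix is
   [r = 2 ^ (t + 6)], the transforms live modulo [M = 2 ^ r + 1], and all
   numbers stay below [U = 2 ^ (r + 1)]. *)
Definition params : com :=
  (Bits rL rP;; rrho ::= #0;;
   for vt < rL do
     CIf ((rL + #1) - (rrho + #1) * (rrho + #1))%X (rrho ::= rrho + #1) (rrho ::= rrho);;
   rrho ::= rrho + #6;; rR ::= #1;;
   for vt < rrho do (rR ::= rR + rR);;
   rR2 ::= rR + rR;; rM ::= #1;;
   for vt < rR do (rM ::= rM + rM);;
   rU ::= rM + rM;; rM ::= rM + #1)%C.

(** [params] creates the moduli on which the syntactic check relies, by additions that this check
    would reject. Its word sizes therefore depend on what it computes and are proved along with the
    invariants. *)
Lemma for_ok W (I : nat -> state -> Prop) x e b s : x < nvars -> evok W e s -> I 0 s ->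
  (forall i s', i < ev e s -> frame (x :: wr b) (awr b) s s' -> I i s' ->
    okc W b (setr s' x i) /\ I i.+1 (den b (setr s' x i))) ->
  okc W (For x e b) s /\ I (ev e s) (den (For x e b) s).
Proof.
move=> hx he h0 hS.
have inv i : i <= ev e s -> I i (loop_state x b s i).
  elim: i => // i IH hi; have [_] := hS i _ hi (loop_frame x b s i) (IH (ltnW hi)).
  by [].
split; last exact: inv.
split=> // i hi; have [] // := hS i _ hi (loop_frame x b s i) (inv _ (ltnW hi)).
Qed.

Lemma denBits d x s : den (Bits d x) s = setr s d (bitlen (reg s x)). Proof. by []. Qed.

Definition isqrt (L : nat) : nat := \max_(t < L.+1 | t ^ 2 <= L) t.

Lemma isqrtP L t : t ^ 2 <= L -> L < t.+1 ^ 2 -> isqrt L = t.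
Proof.
move=> h1 h2; rewrite /isqrt; apply/eqP; rewrite eqn_leq; apply/andP; split.
  by apply/bigmax_leqP => i hi; rewrite -ltnS -(@ltn_exp2r _ _ 2) //; apply: leq_ltn_trans h2.
have tL : t < L.+1 by rewrite ltnS; apply: leq_trans h1; rewrite -mulnn; case: t {h2} => // t; rewrite leq_pmulr.
exact: (@leq_bigmax_cond _ (fun i : 'I_L.+1 => i ^ 2 <= L) (@nat_of_ord _) (Ordinal tL)).
Qed.

(** The summand 6 makes [radix_large] hold for every bit length, small ones included. *)
Definition lgr (p : nat) : nat := isqrt (bitlen p) + 6.

Record params_spec (p : nat) (s : state) : Prop := ParamsSpec {
  psL : reg s rL = bitlen p;
  psrho : reg s rrho = lgr p;
  psR : reg s rR = 2 ^ lgr p;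
  psR2 : reg s rR2 = (2 ^ lgr p).*2;
  psM : reg s rM = (2 ^ 2 ^ lgr p).+1;
  psU : reg s rU = 2 ^ (2 ^ lgr p).+1 }.

Lemma okSeq W c1 c2 s : okc W (CSeq c1 c2) s = (okc W c1 s /\ okc W c2 (den c1 s)).
Proof. by []. Qed.

Lemma paramsP p s : reg s rP = p -> p < 2 ^ (2 ^ lgr p) ->
  okc (6 * (2 ^ lgr p).+2) params s /\ params_spec p (den params s).
Proof.
move=> hp pr; set L := bitlen p; set rho := lgr p in pr *; set W := 6 * _.
set r := 2 ^ rho in pr W *.
have r6 : rho < r by apply: ltn_expl.
have bb n : n <= 2 ^ r.+1 -> n < 2 ^ W.
  by move=> h; apply: leq_ltn_trans h _; rewrite ltn_exp2l // /W; lia.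
have bn n : n <= r.+1 -> n < 2 ^ W.
  by move=> h; apply: bb; apply: leq_trans h (ltnW (ltn_expl _ _)).
have Lr : L <= r.
  have r0 : 0 < r by rewrite expn_gt0.
  have : p < 2 ^ r.-1.+1 by rewrite prednK.
  by move/bitlen_lt; rewrite prednK.
rewrite /params; set c1 := Bits _ _; set c2 := Asg rrho #0; set c3 := For vt rL _.
set c4 := Asg rrho (rrho + #6)%X; set c5 := Asg rR #1; set c6 := For vt rrho _.
set c7 := Asg rR2 _; set c8 := Asg rM #1; set c9 := For vt rR _; set c10 := Asg rU _; set c11 := Asg rM _.
rewrite 10!denSeq 10!okSeq; set s2 := den c2 (den c1 s).
have L2 : reg s2 rL = L by rewrite /s2 /c2 /c1 !exE /= hp.
have t2 : reg s2 rrho = 0 by rewrite /s2 /c2 !exE.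
have hok2 : okc W c1 s /\ okc W c2 (den c1 s).
  split; split=> //; first by rewrite hp; apply: ltn_trans pr _; rewrite ltn_exp2l // /W; lia.
  by rewrite /= bn.
set s3 := den c3 s2.
clearbody s2.
pose I3 n s1 := [/\ reg s1 rL = L, reg s1 rrho <= n, reg s1 rrho ^ 2 <= L &
  reg s1 rrho = n \/ L < (reg s1 rrho).+1 ^ 2].
have [hok3 [L3 _ t3 t3']] : okc W c3 s2 /\ I3 (ev rL s2) s3.
  apply: for_ok => //; first by rewrite /= L2 bn //; lia.
    by split=> //; rewrite ?t2 //; left.
  move=> i s1; rewrite evVar L2 => hi hf [I1 Ii I2 I3'].
  have tL : reg s1 rrho < L by lia.
  have h1 : reg s1 rrho < 2 ^ W by apply: bn; lia.
  have h2 : (reg s1 rrho).+1 < 2 ^ W by apply: bn; lia.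
  have h3 : L < 2 ^ W by apply: bn; lia.
  have h4 : L.+1 < 2 ^ W by apply: bn; lia.
  have h5 : 1 < 2 ^ W by apply: bn; lia.
  have h6 : (reg s1 rrho).+1 * (reg s1 rrho).+1 < 2 ^ W.
    have h7 : (reg s1 rrho).+1 < 2 ^ r by apply: leq_ltn_trans (ltn_expl r _) => //; lia.
    apply: ltn_trans (ltn_mul h7 h7) _; rewrite -expnD ltn_exp2l // /W; lia.
  have h8 : L.+1 - (reg s1 rrho).+1 * (reg s1 rrho).+1 < 2 ^ W.
    by apply: leq_ltn_trans h4; apply: leq_subr.
  split.
    split; first by rewrite /= !exE /update /= I1 !addn1 h1 h2 h3 h4 h5 h6 h8.
    by case: ifP => _; rewrite /= ?exE /update /= ?addn1 ?h1 ?h2 ?h5.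
  rewrite denIf !exE /= I1 !addn1; case: ifP => hc.
    have {}hc : (reg s1 rrho).+1 ^ 2 <= L by move: hc; rewrite -mulnn -lt0n subn_gt0 ltnS.
    have ti : reg s1 rrho = i.
      by case: I3' => // h; move: (leq_ltn_trans hc h); rewrite ltnn.
    by split; rewrite !exE /= ?addn1 ?ti //; [rewrite -ti | left].
  have {}hc : L < (reg s1 rrho).+1 ^ 2.
    by move/negbFE: hc; rewrite -mulnn subn_eq0.
  by split; rewrite !exE //=; [apply: leqW | right].
have L0 : 0 < L by [].
have tE : reg s3 rrho = isqrt L.
  apply/esym/isqrtP => //; case: t3' => // ->; rewrite evVar L2.
  by rewrite -mulnn; nia.
have P3 : reg s3 rP = reg s2 rP by rewrite /s3 den_reg.
clearbody s3.
set s5 := den c5 (den c4 s3).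
have rho5 : reg s5 rrho = rho by rewrite /s5 /c5 /c4 !exE /= tE.
have R5 : reg s5 rR = 1 by rewrite /s5 /c5 !exE.
have L5 : reg s5 rL = L by rewrite /s5 /c5 /c4 !exE.
have hok5 : okc W c4 s3 /\ okc W c5 (den c4 s3).
  split; split=> //; rewrite /= ?exE /= ?tE; last by apply: bn; lia.
  have h : isqrt L + 6 < 2 ^ W by apply: bn; exact: leqW (ltnW r6).
  by rewrite h (leq_ltn_trans _ h) ?leq_addr //= bn // (leq_trans (leq_addl (isqrt L) 6)) // leqW // ltnW.
clearbody s5.
set s6 := den c6 s5.
pose I6 n s1 := reg s1 rR = 2 ^ n.
have [hok6 R6] : okc W c6 s5 /\ I6 (ev rrho s5) s6.
  apply: for_ok => //; first by rewrite /= rho5 bn //; lia.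
  move=> i s1; rewrite evVar rho5 => hi hf Ii.
  have h1 : 2 ^ i.+1 <= r by rewrite leq_exp2l.
  have h2 : 2 ^ i + 2 ^ i = 2 ^ i.+1 by rewrite expnS mul2n addnn.
  split; last by rewrite /I6 !exE /= Ii h2.
  by split; rewrite //= !exE /update /= Ii h2 !bn //; lia.
have {}R6 : reg s6 rR = r by rewrite R6 evVar rho5.
have [L6 rho6] : reg s6 rL = L /\ reg s6 rrho = rho by rewrite /s6 !den_reg.
clearbody s6.
set s8 := den c8 (den c7 s6).
have R8 : reg s8 rR = r by rewrite /s8 /c8 /c7 !exE.
have R28 : reg s8 rR2 = r.*2 by rewrite /s8 /c8 /c7 !exE /= R6 addnn.
have M8 : reg s8 rM = 1 by rewrite /s8 /c8 !exE.
have [L8 rho8] : reg s8 rL = L /\ reg s8 rrho = rho by rewrite /s8 /c8 /c7 !exE.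
have r2W : r + r < 2 ^ W.
  by apply: bb; rewrite expnS mul2n -addnn leq_add // ltnW // ltn_expl.
have hok8 : okc W c7 s6 /\ okc W c8 (den c7 s6).
  by split; split=> //; rewrite /= ?exE /= ?R6 ?r2W ?bn //; lia.
clearbody s8.
set s9 := den c9 s8.
pose I9 n s1 := reg s1 rM = 2 ^ n.
have [hok9 M9] : okc W c9 s8 /\ I9 (ev rR s8) s9.
  apply: for_ok => //; first by rewrite /= R8 bn //; lia.
  move=> i s1; rewrite evVar R8 => hi hf Ii.
  have h1 : 2 ^ i.+1 <= 2 ^ r.+1 by rewrite leq_exp2l // leqW.
  have h3 : 2 ^ i <= 2 ^ r.+1 by rewrite leq_exp2l // leqW // ltnW.
  have h2 : 2 ^ i + 2 ^ i = 2 ^ i.+1 by rewrite expnS mul2n addnn.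
  split; last by rewrite /I9 !exE /= Ii h2.
  by split; rewrite //= !exE /update /= Ii h2 !bb.
have {}M9 : reg s9 rM = 2 ^ r by rewrite M9 evVar R8.
have [L9 rho9 R9 R29] : [/\ reg s9 rL = L, reg s9 rrho = rho, reg s9 rR = r & reg s9 rR2 = r.*2].
  by rewrite /s9 !den_reg.
clearbody s9.
have MM : 2 ^ r + 2 ^ r = 2 ^ r.+1 by rewrite expnS mul2n addnn.
have h1 : 2 ^ r < 2 ^ W by apply: bb; rewrite leq_exp2l.
have ok11 : okc W c10 s9 /\ okc W c11 (den c10 s9).
  have h0 : 1 < 2 ^ W by apply: bn.
  have h2 : (2 ^ r).+1 < 2 ^ W by apply: bb; rewrite ltn_exp2l.
  have h3 : 2 ^ r.+1 < 2 ^ W by apply: bb.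
  by split; split=> //; rewrite /= ?exE /update /= ?M9 ?MM ?addn1 ?h0 ?h1 ?h2 ?h3.
split.
  case: hok2 hok5 hok8 ok11 => ? ? [? ?] [? ?] [? ?].
  by do 10 (split; first by []).
split; rewrite /c11 /c10 !exE //=.
- by rewrite M9 addn1.
- by rewrite M9 MM.
Qed.

Lemma bitlen_gt x : x < 2 ^ bitlen x.
Proof. by rewrite /bitlen trunc_log_ltn. Qed.

Lemma bitlen_le x : 0 < x -> 2 ^ (bitlen x).-1 <= x.
Proof. by move=> x0; rewrite /bitlen trunc_logP. Qed.

Lemma isqrt_bounds L : isqrt L ^ 2 <= L < (isqrt L).+1 ^ 2.
Proof.
suff [t h1 h2] : exists2 t, t ^ 2 <= L & L < t.+1 ^ 2 by rewrite (isqrtP h1 h2) h1.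
elim: L => [|L [t h1 h2]]; first by exists 0.
have [h|h] := ltnP L.+1 (t.+1 ^ 2); first by exists t => //; apply: leqW.
by exists t.+1 => //; rewrite -!mulnn in h2 *; lia.
Qed.

(** Coefficients of a product must fit in [r] bits. The square of the transform length takes at most
    [6 L + 2 * lgr p] bits and [p ^ 2] another [2 L]. With [t = isqrt L], the inequality holds since
    [L < (t + 1) ^ 2] and [64 * 2 ^ t] dominates the resulting quadratic in [t]. *)
Lemma radix_large L : 8 * L + 2 * (isqrt L + 6) <= 2 ^ (isqrt L + 6).
Proof.
have /andP[_ h] := isqrt_bounds L.
have : 8 * (isqrt L).+1 ^ 2 + 2 * isqrt L + 12 <= 64 * 2 ^ isqrt L.
  elim: (isqrt L) => // t IH; rewrite expnS -!mulnn in IH *.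
  by case: t IH => [|t] IH; [|rewrite expnS; move: IH; rewrite expnS; nia].
by rewrite expnD; lia.
Qed.

(** * Block length, tables of roots of unity, input layout and transform size *)

Definition bound_prog : com :=
  (rB ::= #1;; rb ::= #0;;
   for vt < rL do
     CIf (rP - rB * rB)%X (rB ::= (rB + rB) %% rU;; rb ::= (rb + #1) %% rU) (rB ::= rB))%C.

Lemma bound_progP p s : 1 < p -> reg s rP = p -> reg s rL = bitlen p -> 4 * p < reg s rU ->
  let s' := den bound_prog s in
  [/\ reg s' rB = 2 ^ reg s' rb, p <= reg s' rB ^ 2, reg s' rB ^ 2 < 4 * p & 2 <= reg s' rB].
Proof.
move=> p1 hp hL hU.
pose I n s1 := [/\ reg s1 rB = 2 ^ reg s1 rb, reg s1 rB ^ 2 < 4 * p, reg s1 rb <= n &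
  (p <= reg s1 rB ^ 2) || (n <= reg s1 rb)].
rewrite /bound_prog 2!denSeq; set s0 := den (Asg rb _) _; set s' := den (For _ _ _) s0.
have : I (ev rL s0) s'.
  apply: for_inv => [|i s1]; first by split; rewrite /s0 !exE //=; lia.
  rewrite evVar => hi [hfr _] [I1 I2 I3 I4].
  have [kP kU] : reg s1 rP = p /\ reg s1 rU = reg s rU by rewrite !hfr.
  rewrite denIf !exE /= kP; case: ifP => hc.
    have {}hc : reg s1 rB ^ 2 < p by rewrite -subn_gt0 -mulnn lt0n.
    have bi : reg s1 rb = i.
      by apply/eqP; rewrite eqn_leq I3; move: I4; rewrite leqNgt hc.
    have BU : reg s1 rB + reg s1 rB < reg s rU.
      by apply: ltn_trans hU; move: hc; rewrite -mulnn; nia.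
    have bU : reg s1 rb + 1 < reg s rU.
      by have := ltn_expl (reg s1 rb) (isT : 1 < 2); rewrite -I1; lia.
    rewrite denSeq; split; rewrite !exE /= ?kU !modn_small //.
    - by rewrite addn1 expnS mul2n -I1 addnn.
    - by rewrite addnn -mul2n expnMn ltn_pmul2l.
    - by rewrite addn1 bi.
    - by rewrite addn1 bi leqnn orbT.
  move/negbFE: hc; rewrite subn_eq0 mulnn => hc.
  by split; rewrite !exE //= ?hc // leqW.
rewrite evVar => -[I1 I2 I3 I4].
have I5 : p <= reg s' rB ^ 2.
  case/orP: I4 => //; rewrite /s0 !exE /= hL I1 => h; rewrite -expnM.
  apply: leq_trans (ltnW (bitlen_gt p)) _; rewrite leq_exp2l //; lia.
split=> //; rewrite -(@leq_exp2r _ _ 2) //.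
have h : reg s' rB ^ 2 != 1 by lia.
by have : reg s' rB > 1; [rewrite ltnNge; apply/negP => h2; case: (reg s' rB) h2 h I5 => [|[|]] //=; lia | rewrite leq_exp2r].
Qed.

(** [vw] is [2 ^ (2 r - 1)], the inverse of 2 modulo [2 ^ r + 1]; the loop over [rrho] raises the
    first entry of the second table to the power [rho.+1]. *)
Definition tables_prog : com :=
  (vx ::= #1;; for vs < rR2 do (aW$[vs] ::= vx;; vx ::= (vx + vx) %% rM);;
   vw ::= #1;; for vs < (rR2 - #1) do (vw ::= (vw + vw) %% rM);;
   vx ::= vw;; for vs < rrho do (vx ::= (vx * vw) %% rM);;
   for vs < rR2 do (aV$[vs] ::= vx;; vx ::= (vx * vw) %% rM))%C.

Lemma geo_table A e m (c x : nat) i0 s b : A < 16 -> reg s rM = m ->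
  reg s vx = x * c ^ i0 %[mod m] ->
  (forall s1, frame [:: vs; vx] [:: A] s s1 -> ev b s1 = reg s1 vx * c %[mod m]) ->
  forall j, j < ev e s ->
    arr A (den (For vs e (A$[vs] ::= vx;; vx ::= b %% rM)%C) s) j = x * c ^ (i0 + j) %[mod m].
Proof.
move=> hA hm hx hb.
pose I n s1 := reg s1 vx = x * c ^ (i0 + n) %[mod m] /\
  (forall j, j < n -> arr A s1 j = x * c ^ (i0 + j) %[mod m]).
suff [] : I (ev e s) (den (For vs e (A$[vs] ::= vx;; vx ::= b %% rM)%C) s) by [].
apply: for_inv => [|i s1 hi]; first by split; rewrite ?addn0.
rewrite [wr _]/= [awr _]/= hA => hf [I1 I2].
set s2 := setr s1 vs i; rewrite denSeq denSt.
have f2 : frame [:: vs; vx] [:: A] s (setm s2 (cell A (ev vs s2)) (ev vx s2)).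
  have [hfr hfa] := hf; split=> [y hy|A' j hA' hAA'].
    by rewrite reg_setm /s2 reg_setr; case: eqP hy => [->|_ hy] //; rewrite hfr.
  rewrite arr_setm //; case: eqP hAA' => [->|_]; first by rewrite inE eqxx.
  by move=> h /=; rewrite arr_setr hfa.
have hb2 := hb _ f2.
split=> [|j hj]; rewrite denAsg ?reg_setr /= ?arr_setr.
  rewrite evOp [ev (Var rM) _]evVar (_ : reg _ rM = m); last by have [-> //] := f2.
  rewrite /= hb2 !exE /=; by rewrite modn_mod addnS expnSr mulnA -modnMml I1 modnMml.
rewrite arr_setm // eqxx /=; case: eqP => [->|/eqP jn].
  by rewrite !exE /=.
by rewrite arr_setr; apply: I2; move: jn; rewrite !exE /= => /eqP jn; lia.
Qed.

Lemma tables_progP p s : params_spec p s -> tables (lgr p) (den tables_prog s).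
Proof.
case=> _ hrho hR hR2 hM _; set rho := lgr p in hrho hR hR2 hM *.
set M := (2 ^ 2 ^ rho).+1 in hM.
have M1 : 1 < M by rewrite /M ltnS expn_gt0.
rewrite /tables_prog 6!denSeq.
set s1 := den (Asg vx _) s; set s2 := den (For _ _ _) s1.
have W2 j : j < (2 ^ rho).*2 -> arr aW s2 j = 2 ^ j %[mod M].
  move=> hj; rewrite /s2 (@geo_table aW rR2 M 2 1 0 s1 (vx + vx)%X) ?mul1n ?add0n //.
  - by move=> s3 _; rewrite !exE /= muln2 addnn.
  - by rewrite evVar /s1 !exE /= hR2.
have [M2 R2 rho2] : [/\ reg s2 rM = M, reg s2 rR2 = (2 ^ rho).*2 & reg s2 rrho = rho].
  by rewrite /s2 !den_reg.
clearbody s2.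
set s3 := den (Asg vw _) s2; set s4 := den (For _ _ _) s3.
have w4 : reg s4 vw = 2 ^ (2 ^ rho).*2.-1 %[mod M].
  pose I n s1 := reg s1 vw = 2 ^ n %[mod M].
  have : I (ev (rR2 - #1)%X s3) s4.
    apply: for_inv => [|i s5 _ hf Ii]; first by rewrite /I /s3 !exE.
    rewrite /I !exE /= (_ : reg s5 rM = M) ?modn_mod; last by have [-> //] := hf.
    by rewrite -modnDm Ii modnDm addnn -mul2n expnS.
  by rewrite /I !exE /= R2 subn1.
have [M4 R4 rho4] : [/\ reg s4 rM = M, reg s4 rR2 = (2 ^ rho).*2 & reg s4 rrho = rho].
  by rewrite /s4 !den_reg.
have W4 j : arr aW s4 j = arr aW s2 j by rewrite /s4 den_arr.
clearbody s4.
set c := 2 ^ _ in w4.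
set s5 := den (Asg vx _) s4; set s6 := den (For _ _ _) s5.
have [M5 vw5] : reg s5 rM = M /\ reg s5 vw = reg s4 vw by [].
have x6 : reg s6 vx = c ^ rho.+1 %[mod M].
  pose I n s1 := reg s1 vx = c ^ n.+1 %[mod M].
  have : I (ev rrho s5) s6.
    apply: for_inv => [|i s7 _ hf Ii]; first by rewrite /I /s5 !exE /= w4 expn1.
    rewrite /I !exE /= (_ : reg s7 rM = M) ?modn_mod; last by have [-> //] := hf.
    rewrite (_ : reg s7 vw = reg s4 vw); last by have [-> //] := hf.
    by rewrite -modnMm Ii w4 modnMm -expnSr.
  by rewrite evVar /s5 /I !exE /= rho4.
have [M6 R6 vw6] : [/\ reg s6 rM = M, reg s6 rR2 = (2 ^ rho).*2 & reg s6 vw = reg s4 vw].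
  by rewrite /s6 !den_reg.
have W6 j : arr aW s6 j = arr aW s2 j by rewrite /s6 den_arr // -W4.
clearbody s6; split=> j hj; first by rewrite den_arr // W6 W2.
rewrite addnC (@geo_table aV rR2 M c 1 rho.+1 s6 (vx * vw)%X) ?mul1n //.
- move=> s7 [hfr _]; rewrite !exE /= (_ : reg s7 vw = reg s4 vw); last by rewrite hfr.
  by rewrite -modnMmr w4 modnMmr.
- by rewrite evVar R6.
Qed.

(** Coefficient [j] moves from cell [j] to cell [16 j + 1]. Going down from [j = n], a write lands
    above all coefficients still unread; going up it would destroy some of them. *)
Definition load_input : com :=
  (aI$[rN] ::= Peek rN;;
   for vi < rN do (vj ::= (rN - #1) - vi;; aI$[vj] ::= Peek vj))%C.

Lemma evLoad a s : ev (Peek a) s = mem s (ev a s). Proof. by []. Qed.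

Lemma load_inputP n s : reg s rN = n ->
  forall j, j <= n -> arr aI (den load_input s) j = mem s j.
Proof.
move=> hn; rewrite /load_input denSeq; set s1 := den (St _ _ _) s.
have N1 : reg s1 rN = n by [].
pose I i s2 := (forall j, n - i <= j <= n -> arr aI s2 j = mem s j) /\
  (forall j, j < n - i -> mem s2 j = mem s j).
suff [h _] : I (ev rN s1) (den (For vi rN (vj ::= (rN - #1) - vi;; aI$[vj] ::= Peek vj)%C) s1).
  by move=> j hj; apply: h; rewrite evVar N1 subnn.
apply: for_inv => [|i s2].
  split=> j; rewrite subn0.
    move=> h; have -> : j = n by lia.
    by rewrite /s1 denSt arr_setm // evLoad !exE hn !eqxx.
  move=> hj; rewrite /s1 denSt /= updN // evVar hn /cell; lia.
rewrite evVar N1 => hi [hfr _] [I1 I2].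
have N2 : reg s2 rN = n by rewrite hfr.
rewrite denSeq denSt; set s3 := den (Asg _ _) _.
have j3 : reg s3 vj = n - i.+1 by rewrite /s3 !exE /= N2; lia.
have L3 : ev (Peek vj) s3 = mem s (n - i.+1).
  by rewrite evLoad evVar j3 /= I2 //; lia.
rewrite L3 evVar j3; split=> j hj.
  rewrite arr_setm // eqxx /=; case: eqP => [->//|ne].
  by apply: I1; lia.
by rewrite /= updN ?I2 //; rewrite ?/cell; lia.
Qed.

(* Chooses the dimension of the transform for polynomials of length [rneed]. *)
Definition setup : com :=
  (rK ::= #1;; rRK ::= rR;; rQ ::= #1;; rS ::= rR2;;
   for vt < rR do
     CIf (rneed - rRK)%X
       (rK ::= (rK + #1) %% rU;; rRK ::= (rRK * rR) %% rU;; rQ ::= rS;; rS ::= (rS * rR2) %% rU)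
       (rK ::= rK))%C.

(** From [r ^ k < len <= 2 ^ (3 L)] comes [lgr p * k < 3 L]. The first two bounds then follow from
    [radix_large], the third from [L < (t + 1) ^ 2] and [lgr p = t + 6]. *)
Lemma setup_bound p len k : 1 < p -> len <= 2 ^ (3 * bitlen p) -> (k == 0) || ((2 ^ lgr p) ^ k < len) ->
  [/\ (2 ^ lgr p).*2 ^ k.+1 < 2 ^ (2 ^ lgr p).+1,
      ((2 ^ lgr p) ^ k.+1) ^ 2 * p ^ 2 < (2 ^ 2 ^ lgr p).+1
    & k < 3 * (isqrt (bitlen p)).+1].
Proof.
move=> p1 hlen hk; set L := bitlen p in hlen *; set t := isqrt L.
have rE : lgr p = t + 6 by [].
set rho := lgr p in rE hk *; set r := 2 ^ rho.
have /andP[t1 t2] := isqrt_bounds L; rewrite -/t in t1 t2.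
have rL : 8 * L + 2 * rho <= r by rewrite /r rE; apply: radix_large.
have L2 : 1 < L by rewrite /L bitlen_div2.
have kL : rho * k < 3 * L.
  case/orP: hk => [/eqP ->|h]; first by rewrite muln0; lia.
  by rewrite -(ltn_exp2l _ _ (isT : 1 < 2)) expnM; apply: leq_trans hlen.
split.
- by rewrite -mul2n -expnS -expnM ltn_exp2l //; nia.
- rewrite ltnS -!expnM; apply: (@leq_trans (2 ^ (rho * (k.+1 * 2)) * (2 ^ L) ^ 2)).
    by rewrite leq_mul2l leq_exp2r // ltnW ?orbT // bitlen_gt.
  by rewrite -expnM -expnD leq_exp2l //; nia.
- by rewrite ltnNge; apply/negP => h; move: t2; rewrite -mulnn; nia.
Qed.

Lemma setupP p len s : 1 < p -> params_spec p s -> reg s rneed = len ->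
  0 < len <= 2 ^ (3 * bitlen p) ->
  exists k, [/\ env (lgr p) k (den setup s), len <= (2 ^ lgr p) ^ k.+1 &
    (k == 0) || ((2 ^ lgr p) ^ k < len)].
Proof.
move=> p1 ps hlen /andP[len0 lenL]; have [_ _ hR hR2 hM hU] := ps.
set r := 2 ^ lgr p in hR hR2 hM hU *.
rewrite /setup 4!denSeq; set s0 := den (Asg rS _) _; set s' := den (For _ _ _) s0.
pose I n s1 := exists k, [/\ [/\ reg s1 rK = k.+1, reg s1 rRK = r ^ k.+1, reg s1 rQ = r.*2 ^ k
  & reg s1 rS = r.*2 ^ k.+1], (k == 0) || (r ^ k < len) & (len <= r ^ k.+1) || (k == n)].
have r1 : 1 < r by rewrite -[X in X < _](expn0 2) ltn_exp2l // /lgr addnS.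
have [k [[hK hRK hQ hS] hk hlast]] : I (ev rR s0) s'.
  apply: for_inv => [|i s1].
    by exists 0; rewrite /s0 !exE /= hR hR2 !expn1 eqxx orbT.
  rewrite evVar => hi [hfr _] [k [[hK hRK hQ hS] hk hlast]].
  have [kU kN kR kR2] : [/\ reg s1 rU = 2 ^ r.+1, reg s1 rneed = len, reg s1 rR = r & reg s1 rR2 = r.*2].
    by rewrite !hfr.
  have [b1 _ _] := setup_bound p1 lenL hk.
  rewrite denIf !exE /= kN hRK; case: ifP => hc.
    have {}hc : r ^ k.+1 < len by rewrite -subn_gt0 lt0n.
    have hk' : (k.+1 == 0) || ((2 ^ lgr p) ^ k.+1 < len) by rewrite hc.
    have [b2 _ b3] := setup_bound p1 lenL hk'.
    have b4 : r ^ k.+2 < 2 ^ r.+1.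
      by apply: leq_ltn_trans b2; rewrite leq_exp2r // -addnn leq_addr.
    have b5 : k.+2 < 2 ^ r.+1 by apply: ltn_trans b4; apply: ltn_expl.
    exists k.+1; split; [|exact: hk'|].
    - rewrite 3!denSeq !exE /= !kU hK hRK kR kR2 hS addn1 -!expnSr.
      by split; rewrite ?modn_small.
    - by apply/orP; right; move: hlast; rewrite leqNgt hc.
  exists k; rewrite !exE /=; split=> //.
  by apply/orP; left; move/negbFE: hc; rewrite subn_eq0.
exists k; have [b1 _ b3] := setup_bound p1 lenL hk.
have kp y : y \notin [:: rK; rRK; rQ; rS; vt] -> reg s' y = reg s y.
  move=> hy; rewrite /s' den_reg; last by move: hy; rewrite !inE !negb_or => /and5P[-> -> -> -> ->].
  by rewrite /s0 !exE; move: hy; rewrite !inE !negb_or => /and5P[/negbTE-> /negbTE-> /negbTE-> /negbTE-> _].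
split=> //; first by split=> //; rewrite kp ?hU.
(* The rounds cannot run out: [k = r] contradicts [k < 3 (t + 1)], since [r] is at least [8 L]. *)
case/orP: hlast => // /eqP kE; move: b3.
have rL := radix_large (bitlen p).
rewrite kE evVar /s0 !exE /= hR /r {1}/lgr => b3.
have := isqrt_bounds (bitlen p) => /andP[h1 _]; exfalso.
have L1 : 0 < bitlen p by [].
by rewrite -mulnn in h1; nia.
Qed.

(** * Evaluation on geometric progressions and block products *)

Notation vJ := 45 (only parsing).
Notation vq1 := 46 (only parsing).
Notation vs1 := 47 (only parsing).
Notation vy1 := 48 (only parsing).
Notation vg2 := 50 (only parsing).
Notation vk := 52 (only parsing).
Notation vb := 53 (only parsing).
Notation aH := 10 (only parsing).

Definition chirp_prog (A : nat) : com :=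
  (for vs < rRK do (aA$[vs] ::= #0);;
   vq1 ::= #1;; vs1 ::= #1;; vy1 ::= #1;;
   for vk < rLen do
     (aA$[(rLen - #1) - vk] ::= (((A.[vk] * vq1) %% rP) * vy1) %% rP;;
      vq1 ::= (vq1 * vs1) %% rP;; vs1 ::= (vs1 * rqi) %% rP;; vy1 ::= (vy1 * rY) %% rP);;
   vq1 ::= #1;; vs1 ::= #1;;
   for vk < rRK do
     (aB$[vk] ::= vq1;; vq1 ::= (vq1 * vs1) %% rP;; vs1 ::= (vs1 * rq) %% rP);;
   polymul)%C.

Definition copy_input : com :=
  (for vs < rRK do (aH$[vs] ::= #0);;
   for vs < rN do (aH$[vs] ::= aI.[vs]);;
   aH$[rN] ::= aI.[rN])%C.

(* Replaces [H(X)] by [H(X) H(g X)] and [g] by its square. *)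
Definition double_step : com :=
  (for vs < rRK do (aA$[vs] ::= aH.[vs]);;
   vy1 ::= #1;;
   for vk < rRK do (aB$[vk] ::= (aH.[vk] * vy1) %% rP;; vy1 ::= (vy1 * vg2) %% rP);;
   polymul;;
   for vs < rRK do (aH$[vs] ::= aC.[vs]);;
   vg2 ::= (vg2 * vg2) %% rP)%C.

Definition block_prog : com :=
  (copy_input;; vg2 ::= rG;; for vb < rb do double_step)%C.

Lemma frame_weaken xs As xs' As' s s' :
  all (fun x => x \in xs') xs && all (fun A => A \in As') As ->
  frame xs As s s' -> frame xs' As' s s'.
Proof. by case/andP=> /allP h1 /allP h2; apply: frame_sub. Qed.

Section ChirpProg.
Variables (p rho k : nat).
Hypothesis p_pr : prime p.
Let N := (2 ^ rho) ^ k.+1.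
Hypothesis NM : N ^ 2 * p ^ 2 < (2 ^ 2 ^ rho).+1.
Let p0 : 0 < p := prime_gt0 p_pr.
Let p1 : 1 < p := prime_gt1 p_pr.
Let polF (n : nat) (a : nat -> nat) : {poly 'F_p} := pol 'F_p n a.

Lemma polymul_polP s : reg s rP = p -> env rho k s -> tables rho s ->
  (forall i, i < N -> arr aA s i < p) -> (forall i, i < N -> arr aB s i < p) ->
  forall m, m < N -> arr aC (den polymul s) m < p /\
    ((arr aC (den polymul s) m)%:R = (polF N (arr aA s) * polF N (arr aB s))`_m)%R.
Proof.
move=> hp he ht hA hB m hm; rewrite (polymulP p0 hp he ht hA hB NM hm) ltn_pmod //; split=> //.
by rewrite natF_mod // pol_conv.
Qed.

(** Only the vanishing of the values is of interest, so the unit [q ^+ 'C(j, 2)] is left in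
    place. *)
Lemma chirp_progP A s len : reg s rP = p -> env rho k s -> tables rho s ->
  A < 16 -> A \notin [:: aA; aB; aC; aX; aY; aT] ->
  reg s rLen = len -> 0 < len <= N ->
  ((reg s rq)%:R * (reg s rqi)%:R = 1 :> 'F_p)%R ->
  forall j, len.-1 + j < N ->
  (arr aC (den (chirp_prog A) s) (len.-1 + j) == 0) =
  ((polF len (arr A s)).[(reg s rY)%:R * (reg s rq)%:R ^+ j] == 0)%R.
Proof.
move=> hp he ht hA16 hA hlen /andP[len0 lenN] hq j hj.
set q := ((reg s rq)%:R : 'F_p)%R in hq *; set q' := ((reg s rqi)%:R : 'F_p)%R in hq.
set y := ((reg s rY)%:R : 'F_p)%R.
have [nAA nAB] : A != aA /\ A != aB by move: hA; rewrite !inE !negb_or => /and3P[-> -> _].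
rewrite /chirp_prog 8!denSeq; set s1 := den (For _ _ _) s.
have f1 : frame [:: vs] [:: aA] s s1 := den_frame (For vs rRK (St aA vs #0)) s.
have z1 i : i < N -> arr aA s1 i = 0.
  have [] := @fill0P vs aA rRK #0%X s (fun=> 0); [by []|by []|].
  by rewrite evVar (envRK he) => h _; apply: h.
clearbody s1.
set s2 := den (Asg vy1 _) _.
have f2 : frame [:: vs; vq1; vs1; vy1] [:: aA] s s2.
  apply: (@frame_trans _ _ _ s1); first by apply: frame_sub f1 => // z; rewrite !inE => ->.
  by rewrite /s2 !denAsg; do 3 (apply: frame_trans; last by apply: frame_setr).
have [q2 s2E y2] : [/\ reg s2 vq1 = 1, reg s2 vs1 = 1 & reg s2 vy1 = 1] by [].
have z2 i : i < N -> arr aA s2 i = 0 by apply: z1.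
clearbody s2.
set s3 := den (For vk rLen _) s2.
have f3 : frame [:: vs; vq1; vs1; vy1; vk] [:: aA] s s3.
  apply: (@frame_trans _ _ _ s2); first by apply: frame_sub f2 => // z; rewrite !inE => /or4P[]->; rewrite ?orbT.
  by apply: frame_sub (den_frame _ s2) => // z; rewrite /= !inE => /or4P[]->; rewrite ?orbT.
pose I3 n st := [/\ [/\ ((reg st vq1)%:R = q' ^+ 'C(n, 2) :> 'F_p)%R, ((reg st vs1)%:R = q' ^+ n :> 'F_p)%R
  & ((reg st vy1)%:R = y ^+ n :> 'F_p)%R],
  forall i, i < N -> arr aA st i < p,
  forall i, len <= i < N -> arr aA st i = 0 &
  forall i, i < n -> ((arr aA st (len.-1 - i))%:R = (arr A s i)%:R * q' ^+ 'C(i, 2) * y ^+ i :> 'F_p)%R].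
have [_ A3 z3 V3] : I3 len s3.
  suff : I3 (ev rLen s2) s3 by rewrite evVar; have [-> //] := f2; rewrite hlen.
  apply: for_inv => [|n st].
    split=> //; first by rewrite q2 s2E y2 !expr0.
    - by move=> i hi; rewrite z2.
    - by move=> i /andP[_ hi]; rewrite z2.
  rewrite evVar (_ : reg s2 rLen = len); last by have [-> //] := f2.
  move=> hn hf [[I1 I2 I4] I5 I6 I7].
  have ff : frame [:: vs; vq1; vs1; vy1; vk] [:: aA] s st.
    apply: (@frame_trans _ _ _ s2); first by apply: frame_sub f2 => // z; rewrite !inE => /or4P[]->; rewrite ?orbT.
    by apply: frame_sub hf => // z; rewrite /= !inE => /or4P[]->; rewrite ?orbT.
  have [hfr hfa] := ff.
  have [kP kq kY kl] : [/\ reg st rP = p, reg st rqi = reg s rqi, reg st rY = reg s rY & reg st rLen = len].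
    by rewrite !hfr.
  have kA i : arr A st i = arr A s i by rewrite hfa // inE.
  rewrite 3!denSeq denSt !denAsg; set st' := setm _ _ _.
  have idx : ev ((rLen - #1) - vk)%X (setr st vk n) = len.-1 - n.
    by rewrite !exE /= kl subn1.
  have arrE i : arr aA st' i = if i == len.-1 - n then
      ((arr A s n * reg st vq1) %% p * reg st vy1) %% p else arr aA st i.
    by rewrite /st' arr_setm // idx eqxx /=; case: eqP => // _; rewrite !exE /= kA kP.
  split.
  - rewrite !exE /= kP kq kY !natF_mod // !natrM I1 I2 I4 -exprD -!exprSr.
    by rewrite binS bin1.
  - move=> i hi; rewrite !arr_setr arrE; case: eqP => _; [by rewrite ltn_pmod | exact: I5].
  - move=> i hi; rewrite !arr_setr arrE; case: eqP => [ie|_]; [lia | exact: I6].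
  - move=> i hi; rewrite !arr_setr arrE; case: eqP => [ie|ie].
      have -> : i = n by lia.
      by rewrite natF_mod // natrM natF_mod // natrM I1 I4.
    by apply: I7; lia.
clearbody s3.
set s4 := den (Asg vs1 _) _.
have f4 : frame [:: vs; vq1; vs1; vy1; vk] [:: aA] s s4.
  apply: (@frame_trans _ _ _ s3) => //.
  by rewrite /s4 !denAsg; do 2 (apply: frame_trans; last by apply: frame_setr).
have [q4 s4E] : reg s4 vq1 = 1 /\ reg s4 vs1 = 1 by [].
have A4 i : arr aA s4 i = arr aA s3 i by [].
clearbody s4.
set s5 := den (For vk rRK _) s4.
have f5 : frame [:: vs; vq1; vs1; vy1; vk] [:: aA; aB] s s5.
  apply: (@frame_trans _ _ _ s4); first by apply: frame_sub f4 => // z; rewrite !inE => ->.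
  by apply: frame_sub (den_frame _ s4) => z; rewrite /= !inE => h; do ?[case/orP: h => h]; rewrite h ?orbT.
pose I5 n st := [/\ ((reg st vq1)%:R = q ^+ 'C(n, 2) :> 'F_p)%R, ((reg st vs1)%:R = q ^+ n :> 'F_p)%R,
  reg st vq1 < p & forall i, i < n -> ((arr aB st i)%:R = q ^+ 'C(i, 2) :> 'F_p)%R /\ arr aB st i < p].
have [_ _ _ V5] : I5 N s5.
  suff : I5 (ev rRK s4) s5 by rewrite evVar; have [-> //] := f4; rewrite (envRK he).
  apply: for_inv => [|n st _ hf [I1 I2 I3' I4]].
    by split=> //; rewrite ?q4 ?s4E ?expr0.
  have [hfr _] : frame [:: vs; vq1; vs1; vy1; vk] [:: aA; aB] s st.
    apply: (@frame_trans _ _ _ s4); first by apply: frame_sub f4 => // z; rewrite !inE => ->.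
    by apply: frame_sub hf => z; rewrite /= !inE => h; do ?[case/orP: h => h]; rewrite h ?orbT.
  have [kP kq] : reg st rP = p /\ reg st rq = reg s rq by rewrite !hfr.
  rewrite 2!denSeq denSt !denAsg; split.
  - by rewrite !exE /= kP natF_mod // natrM I1 I2 -exprD binS bin1.
  - by rewrite !exE /= kP kq natF_mod // natrM I2 -exprSr.
  - by rewrite !exE /= kP ltn_pmod.
  - move=> i hi; rewrite !arr_setr arr_setm // eqxx !exE /=.
    case: eqP => [->//|ne]; apply: I4; lia.
have A5 i : arr aA s5 i = arr aA s3 i by rewrite /s5 den_arr // A4.
clearbody s5.
have he5 := env_frame f5 he isT; have ht5 := tables_frame f5 ht isT.
have P5 : reg s5 rP = p by have [-> //] := f5.
have [||C1 C2] := polymul_polP P5 he5 ht5 _ _ hj.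
- by move=> i hi; rewrite A5 A3.
- by move=> i hi; have [] := V5 i hi.
have qn0 : (q != 0)%R by apply/eqP => q0; move/eqP: hq; rewrite q0 mul0r eq_sym oner_eq0.
rewrite -(natF_lt_eq0 p_pr C1) C2 (@chirp _ N len (arr A s) _ _ y q q' j) //.
- by rewrite mulf_eq0 expf_eq0 (negbTE qn0) andbF.
- by move=> i hi; rewrite A5 V3.
- by move=> i hi; rewrite A5 z3.
- by move=> i hi; have [] := V5 i hi.
Qed.

Lemma pol_eq n (a : nat -> nat) (f : {poly 'F_p}) : size f <= n ->
  (forall i, i < n -> ((a i)%:R = f`_i)%R) -> polF n a = f.
Proof.
move=> hs h; apply/polyP => i; rewrite /polF /pol coef_poly; case: ltnP => hi; first exact: h.
by rewrite nth_default // (leq_trans hs).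
Qed.

Lemma pol_congr n (a b : nat -> nat) : (forall i, i < n -> a i = b i) -> polF n a = polF n b.
Proof.
move=> h; apply/polyP => i; rewrite /polF /pol !coef_poly; case: ltnP => // hi.
by rewrite h.
Qed.

Lemma copy_inputP s n : env rho k s -> reg s rN = n -> n < N ->
  forall i, i < N -> arr aH (den copy_input s) i = if i <= n then arr aI s i else 0.
Proof.
move=> he hn nN i hi; rewrite /copy_input 2!denSeq; set s1 := den (For vs rRK _) s.
have z1 j : j < N -> arr aH s1 j = 0.
  have [] := @fill0P vs aH rRK #0%X s (fun=> 0); [by []|by []|].
  by rewrite evVar (envRK he) => h _; apply: h.
have I1 j : arr aI s1 j = arr aI s j by rewrite /s1 den_arr.
have N1 : ev rN s1 = n by rewrite evVar /s1 den_reg.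
clearbody s1; set s2 := den (For vs rN _) s1.
have [H2 z2] : (forall i, i < n -> arr aH s2 i = arr aI s i) /\ (forall i, n <= i -> arr aH s2 i = arr aH s1 i).
  have [] := @fill0P vs aH rN aI.[vs]%X s1 (arr aI s) isT; last by rewrite N1.
  by move=> j st _ [_ hfa] hx _; rewrite !exE hx hfa // I1.
have N2 : reg s2 rN = n by rewrite /s2 den_reg.
have I2 j : arr aI s2 j = arr aI s j by rewrite /s2 den_arr.
clearbody s2; rewrite denSt arr_setm // !exE N2 I2 /= leq_eqVlt.
case: eqP => [->|ne] //=; case: ltnP => hin; first exact: H2.
by rewrite z2 // z1.
Qed.

(** The multiplication delivers the coefficients below [N]; [d * 2 < N] ensures that these are all
    of them. *)
Lemma double_stepP s f g d : reg s rP = p -> env rho k s -> tables rho s ->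
  polF N (arr aH s) = f -> ((reg s vg2)%:R = g :> 'F_p)%R ->
  (forall i, i < N -> arr aH s i < p) -> size f <= d.+1 -> d * 2 < N ->
  [/\ polF N (arr aH (den double_step s)) = (f * scalex f g)%R,
    ((reg (den double_step s) vg2)%:R = g ^+ 2 :> 'F_p)%R &
    forall i, i < N -> arr aH (den double_step s) i < p].
Proof.
move=> hp he ht hH hg hHp szf dN; rewrite /double_step 5!denSeq.
set s1 := den (For vs rRK _) s.
have A1 i : i < N -> arr aA s1 i = arr aH s i.
  have [] := @fill0P vs aA rRK aH.[vs]%X s (arr aH s) isT.
    by move=> j st _ [_ hfa] hx _; rewrite !exE hx hfa.
  by rewrite evVar (envRK he) => h _; apply: h.
have f1 : frame [:: vs; vy1; vk] [:: aA] s s1.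
  by apply: frame_weaken (den_frame (For vs rRK (St aA vs aH.[vs])%X) s).
clearbody s1; set s2 := den (Asg vy1 _) s1.
have f2 : frame [:: vs; vy1; vk] [:: aA] s s2.
  by apply: frame_trans f1 _; apply: frame_setr.
have y2 : reg s2 vy1 = 1 by [].
have A2 i : i < N -> arr aA s2 i = arr aH s i by apply: A1.
clearbody s2; set s3 := den (For vk rRK _) s2.
have f3 : frame [:: vs; vy1; vk] [:: aA; aB] s s3.
  apply: (@frame_trans _ _ _ s2); first by apply: frame_sub f2 => // z; rewrite !inE => ->.
  by apply: frame_weaken (den_frame (For vk rRK _) s2).
pose I n st := ((reg st vy1)%:R = g ^+ n :> 'F_p)%R /\
  forall i, i < n -> arr aB st i < p /\ ((arr aB st i)%:R = (arr aH s i)%:R * g ^+ i :> 'F_p)%R.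
have [_ B3] : I N s3.
  suff : I (ev rRK s2) s3 by rewrite evVar; have [-> //] := f2; rewrite (envRK he).
  apply: for_inv => [|n st _ hf [I1 I2]]; first by rewrite /I y2 expr0.
  have [hfr hfa] : frame [:: vs; vy1; vk] [:: aA; aB] s st.
    apply: (@frame_trans _ _ _ s2); first by apply: frame_sub f2 => // z; rewrite !inE => ->.
    by apply: frame_weaken hf.
  have kP : reg st rP = p by rewrite hfr.
  have kg : ((reg st vg2)%:R = g :> 'F_p)%R by rewrite -hg hfr.
  have kH i : arr aH st i = arr aH s i by rewrite hfa.
  rewrite denSeq denSt denAsg; split.
    by rewrite !exE /= kP natF_mod // natrM I1 kg -exprSr.
  move=> i hi; rewrite !arr_setr arr_setm // eqxx !exE /= kP kH.
  case: eqP => [->|ne]; last by apply: I2; lia.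
  by rewrite ltn_pmod // natF_mod // natrM I1.
have A3 i : i < N -> arr aA s3 i = arr aH s i by move=> hi; rewrite /s3 den_arr // A2.
clearbody s3.
have he3 := env_frame f3 he isT; have ht3 := tables_frame f3 ht isT.
have P3 : reg s3 rP = p by have [-> //] := f3.
have hA3 i : i < N -> arr aA s3 i < p by move=> hi; rewrite A3 // hHp.
have hB3 i : i < N -> arr aB s3 i < p by move=> /B3[].
have C4 := polymul_polP P3 he3 ht3 hA3 hB3.
have pA : polF N (arr aA s3) = f by rewrite -hH; apply: pol_congr.
have pB : polF N (arr aB s3) = scalex f g.
  apply: pol_eq => [|i hi]; first by apply: leq_trans (size_scalex _ _) (leq_trans szf _); lia.
  have [_ ->] := B3 i hi; rewrite scalex_coef -hH.
  by rewrite /polF /pol coef_poly hi.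
rewrite pA pB in C4.
set s4 := den polymul s3 in C4 *.
have [R4 P4 g4] : [/\ reg s4 rRK = N, reg s4 rP = p & reg s4 vg2 = reg s vg2].
  split; rewrite /s4 den_reg ?(envRK he3) //.
  by have [-> //] := f3.
clearbody s4; set s5 := den (For vs rRK _) s4.
have H5 i : i < N -> arr aH s5 i = arr aC s4 i.
  have [] := @fill0P vs aH rRK aC.[vs]%X s4 (arr aC s4) isT.
    by move=> j st _ [_ hfa] hx _; rewrite !exE hx hfa.
  by rewrite evVar R4 => h _; apply: h.
have [P5 g5] : reg s5 rP = p /\ reg s5 vg2 = reg s vg2 by rewrite /s5 !den_reg.
clearbody s5; rewrite denAsg; split.
- apply: pol_eq => [|i hi]; last by rewrite arr_setr H5 //; have [_ ->] := C4 i hi.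
  apply: leq_trans (size_polyMleq _ _) _.
  have := leq_trans (size_scalex f g) szf; move: (size (scalex f g)) (size f) szf dN => x y; lia.
- by rewrite !exE /= P5 g5 natF_mod // natrM hg.
- by move=> i hi; rewrite arr_setr H5 //; have [] := C4 i hi.
Qed.

(** The repeated squarings leave [g ^+ (2 ^ b)] in [vg2]: this is the ratio of the progression on
    which the block product is evaluated next. *)
Lemma block_progP s n b : reg s rP = p -> env rho k s -> tables rho s ->
  reg s rN = n -> reg s rb = b -> n * 2 ^ b < N ->
  (forall i, i <= n -> arr aI s i < p) ->
  let s' := den block_prog s in
  (polF N (arr aH s') = block (polF n.+1 (arr aI s)) (reg s rG)%:R b)%R /\
  ((reg s' vg2)%:R = (reg s rG)%:R ^+ (2 ^ b) :> 'F_p)%R.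
Proof.
move=> hp he ht hn hb hN hI.
have n1N : n < N by apply: leq_ltn_trans hN; rewrite leq_pmulr // expn_gt0.
set f := polF n.+1 (arr aI s); set g := ((reg s rG)%:R : 'F_p)%R.
have szf : size f <= n.+1 by apply: size_poly.
have H1 := copy_inputP he hn n1N.
rewrite /block_prog 2!denSeq; set s1 := den (Asg _ _) _.
have f1 : frame (vg2 :: wr copy_input) (awr copy_input) s s1.
  rewrite /s1 denAsg; apply: frame_trans (_ : frame _ _ s (den copy_input s)) _.
    by apply: frame_weaken (den_frame copy_input s).
  exact: frame_setr.
have g1 : reg s1 vg2 = reg s rG by rewrite /s1 denAsg reg_setr eqxx evVar den_reg.
have {}H1 i : i < N -> arr aH s1 i = if i <= n then arr aI s i else 0 by apply: H1.
have he1 := env_frame f1 he isT; have ht1 := tables_frame f1 ht isT.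
have P1 : reg s1 rP = p by have [-> //] := f1.
have b1 : reg s1 rb = b by have [-> //] := f1.
clearbody s1.
pose I m st := [/\ polF N (arr aH st) = block f g m, ((reg st vg2)%:R = g ^+ (2 ^ m) :> 'F_p)%R &
  forall i, i < N -> arr aH st i < p].
set s2 := den _ s1; suff : I (ev rb s1) s2 by rewrite evVar b1; case.
apply: for_inv => [|m st].
  split.
  - rewrite block0; apply: pol_eq => [|i hi]; first exact: leq_trans szf n1N.
    by rewrite H1 // /f /polF /pol coef_poly ltnS; case: ifP.
  - by rewrite g1 expn0 expr1.
  - by move=> i hi; rewrite H1 //; case: ifP => // hin; apply: hI.
rewrite evVar b1 => hm hf [I1 I2 I3].
have f2 : frame (vb :: wr double_step) (awr double_step) s1 (setr st vb m).
  by apply: frame_trans hf _; apply: frame_setr; rewrite inE eqxx.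
have P2 : reg (setr st vb m) rP = p by have [-> //] := f2.
have dN : n * 2 ^ m * 2 < N.
  by apply: leq_ltn_trans hN; rewrite -mulnA -expnSr leq_mul2l leq_exp2l // hm orbT.
have szb : size (block f g m) <= (n * 2 ^ m).+1 by apply: size_block.
have [J1 J2 J3] := double_stepP P2 (env_frame f2 he1 isT) (tables_frame f2 ht1 isT) I1 I2 I3 szb dN.
split=> //; first by rewrite J1 blockS.
by rewrite J2 -exprM expnSr.
Qed.
End ChirpProg.

(** * The root finding program *)

Notation vcnt := 43 (only parsing).
Notation vo := 44 (only parsing).
Notation vgB := 54 (only parsing).
Notation vy2 := 55 (only parsing).
Notation aJ := 11 (only parsing).
Notation aO := 12 (only parsing).

Definition inv_prog : com :=
  (vbase ::= rq;; vexp ::= rP - #2;; powmod;; rqi ::= vz)%C.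

Definition prepare : com :=
  (load_input;; bound_prog;; tables_prog;; primes_prog;; gen_prog)%C.

(** The chirp product is read at the indices [n B + j] with [j < B], and a transform of length
    [(n + 1) B + 1] covers them. *)
Definition setup_blocks : com := (rneed ::= ((rN + #1) * rB + #1) %% rU;; setup)%C.

Definition eval_blocks : com :=
  (rLen ::= (rN * rB + #1) %% rU;; rY ::= #1;; rq ::= vg2;; inv_prog;; chirp_prog aH)%C.

(* Lists the blocks of exponents that contain a root. *)
Definition collect_loop : com :=
  (for vi < vJ do
     CIf (aC.[(rLen - #1) + vi])%X (vcnt ::= vcnt)
       (aJ$[vcnt] ::= vi;; vcnt ::= (vcnt + #1) %% rU))%C.

Definition collect : com :=
  (vJ ::= ((rP - #2) / rB + #1) %% rU;; vcnt ::= #0;; collect_loop)%C.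

(** Inside a block the ratio is [g], whose inverse is computed once for all blocks; [g ^ B] is saved
    in [vgB] to obtain the starting points. The root 0, not being a power of [g], is detected here
    from the constant coefficient. *)
Definition setup_scan : com :=
  (rneed ::= (rN + rB + #1) %% rU;; setup;;
   rLen ::= (rN + #1) %% rU;; vgB ::= rq;; rq ::= rG;; inv_prog;; vo ::= #0;;
   CIf (aI.[#0])%X (vo ::= vo) (aO$[vo] ::= #0;; vo ::= (vo + #1) %% rU))%C.

(** The comparison of the exponent with [p - 1] discards the excess of the last block, which would
    list a root twice. *)
Definition emit : com :=
  (CIf (aC.[rN + vk])%X (vo ::= vo)
     (CIf ((rP - #1) - (vj * rB + vk))%X
        (aO$[vo] ::= vy2;; vo ::= (vo + #1) %% rU) (vo ::= vo));;
   vy2 ::= (vy2 * rG) %% rP)%C.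

Definition scan_block : com :=
  (vj ::= aJ.[vi];; vbase ::= vgB;; vexp ::= vj;; powmod;; rY ::= vz;;
   chirp_prog aI;; vy2 ::= rY;; for vk < rB do emit)%C.

Definition scan : com := (for vi < vcnt do scan_block)%C.

Definition write_out : com := (for vi < vo do Raw vi aO.[vi])%C.

Definition main_prog : com :=
  (prepare;; setup_blocks;; block_prog;; eval_blocks;; collect;; setup_scan;; scan;; write_out)%C.

(** * Correctness of the root search *)

Record ctx (p n b g : nat) (a : nat -> nat) (s : state) : Prop := Ctx {
  cP : reg s rP = p;
  cN : reg s rN = n;
  cps : params_spec p s;
  cB : reg s rB = 2 ^ b;
  cb : reg s rb = b;
  cG : reg s rG = g;
  ctab : tables (lgr p) s;
  cI : forall j, j <= n -> arr aI s j = a j }.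

Lemma ctx_frame p n b g a xs As s s' : frame xs As s s' -> ctx p n b g a s ->
  all (fun x => x \notin xs) [:: rP; rN; rL; rrho; rR; rR2; rM; rU; rB; rb; rG] &&
  all (fun A => A \notin As) [:: aI; aW; aV] -> ctx p n b g a s'.
Proof.
move=> hf [c1 c2 c3 c4 c5 c6 c7 c8] /andP[/allP hx /allP hA].
have [hfr hfa] := hf.
have kr x : x \in [:: rP; rN; rL; rrho; rR; rR2; rM; rU; rB; rb; rG] -> reg s' x = reg s x.
  by move=> h; apply: hfr; apply: hx.
case: c3 => d1 d2 d3 d4 d5 d6.
split; rewrite ?kr //; first by split; rewrite kr.
  by apply: tables_frame hf c7 _; rewrite !hA // !inE ?eqxx ?orbT.
by move=> j hj; rewrite hfa ?c8 // hA.
Qed.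

Lemma block_le_prime p B : p <= B ^ 2 -> B ^ 2 < 4 * p -> B <= p.
Proof.
move=> Bp B4p; rewrite leqNgt; apply/negP => h.
have : p.+1 ^ 2 <= B ^ 2 by rewrite leq_exp2r.
by move: B4p; rewrite -!mulnn; nia.
Qed.

Lemma bitlen_gt1 p : 1 < p -> 1 < bitlen p.
Proof. by move=> p1; rewrite bitlen_div2. Qed.

Lemma square_small p : 1 < p -> 8 * p ^ 2 < 2 ^ (2 ^ lgr p).+1.
Proof.
move=> p1; have := radix_large (bitlen p); rewrite -/(lgr p) => h.
have hp := bitlen_gt p; have L2 := bitlen_gt1 p1.
apply: (@leq_ltn_trans (8 * (2 ^ bitlen p) ^ 2)); first by rewrite leq_mul2l leq_exp2r // ltnW.
by rewrite -expnM (_ : 8 = 2 ^ 3) // -expnD ltn_exp2l //; lia.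
Qed.

Lemma linear_small p : 1 < p -> 8 * p < 2 ^ (2 ^ lgr p).+1.
Proof.
by move=> p1; apply: leq_ltn_trans (square_small p1); rewrite -mulnn leq_mul2l leq_pmulr // ltnW.
Qed.

Lemma need_le p x : 1 < p -> x <= 4 * p ^ 2 -> x <= 2 ^ (3 * bitlen p).
Proof.
move=> p1 hx; apply: leq_trans hx _; have hp := bitlen_gt p; have L2 := bitlen_gt1 p1.
apply: (@leq_trans (4 * (2 ^ bitlen p) ^ 2)); first by rewrite leq_mul2l leq_exp2r // ltnW.
by rewrite -expnM (_ : 4 = 2 ^ 2) // -expnD leq_exp2l //; lia.
Qed.

(* The exponents below [p - 1] are split into blocks of length [2 ^ b]. *)
Definition nblocks (p b : nat) : nat := (p - 2) %/ 2 ^ b + 1.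

Lemma nblocks_le p b : p <= (2 ^ b) ^ 2 -> 2 <= 2 ^ b -> nblocks p b <= 2 ^ b.
Proof. by move=> Bp B2; rewrite /nblocks addn1 ltn_divLR; move: Bp B2; rewrite -mulnn; lia. Qed.

Lemma nblocks_ge p b : 1 < p -> p.-1 <= nblocks p b * 2 ^ b.
Proof.
have B0 : 0 < 2 ^ b by rewrite expn_gt0.
move=> p1; have := divn_eq (p - 2) (2 ^ b); have := ltn_pmod (p - 2) B0.
by rewrite /nblocks mulnDl; lia.
Qed.

(** The blocks exceed [p - 2] by at most one block length, and that length is at most [p]. *)
Lemma nblocks_le2 p b : p <= (2 ^ b) ^ 2 -> (2 ^ b) ^ 2 < 4 * p -> 1 < p ->
  nblocks p b * 2 ^ b <= p.-1 + p.-1.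
Proof.
move=> Bp B4p p1; have := leq_divM (p - 2) (2 ^ b); have := block_le_prime Bp B4p.
by rewrite /nblocks mulnDl; lia.
Qed.

Section Main.
Variables (p n b g : nat) (a : nat -> nat).
Hypotheses (p_pr : prime p) (n0 : 0 < n) (np : n <= p).
Let B := 2 ^ b.
Hypotheses (Bp : p <= B ^ 2) (B4p : B ^ 2 < 4 * p) (B2 : 2 <= B).
Hypothesis ap : forall i, i <= n -> a i < p.
Let gF : 'F_p := (g%:R)%R.
Hypotheses (gp : g < p) (pg : (p.-1).-primitive_root%R gF).
Let f : {poly 'F_p} := pol 'F_p n.+1 a.
Hypothesis szf : size f = n.+1.
Let L := bitlen p.
Let r := 2 ^ lgr p.
Let p1 : 1 < p := prime_gt1 p_pr.
Let CTX := ctx p n b g a.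

Let B_le_p : B <= p := block_le_prime Bp B4p.
Let p2_small : 8 * p ^ 2 < 2 ^ r.+1 := square_small p1.
Let p_small : 8 * p < 2 ^ r.+1 := linear_small p1.
Let need_small x : x <= 4 * p ^ 2 -> x <= 2 ^ (3 * L) := @need_le p x p1.
Let pL : p < 2 ^ L := bitlen_gt p.
Let nblocks_le : nblocks p b <= B := nblocks_le Bp B2.
Let nblocks_le2 : nblocks p b * B <= p.-1 + p.-1 := nblocks_le2 Bp B4p p1.

Lemma gF0 : (gF != 0)%R.
Proof.
apply/negP => /eqP h; have := prim_expr_order pg; have := prim_order_gt0 pg.
by rewrite h expr0n => /gtn_eqF -> /eqP; rewrite eq_sym oner_eq0.
Qed.

Lemma inv_progP s : CTX s -> ((reg s rq)%:R != 0 :> 'F_p)%R ->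
  ((reg (den inv_prog s) rq)%:R * (reg (den inv_prog s) rqi)%:R = 1 :> 'F_p)%R.
Proof.
move=> hc q0; rewrite /inv_prog 3!denSeq; set s1 := den (Asg vexp _) _.
have P1 : reg s1 rP = p by rewrite /s1 !exE (cP hc).
have L1 : reg s1 rL = L by rewrite /s1 !exE; apply: psL (cps hc).
have b1 : reg s1 vbase = reg s rq by rewrite /s1 !exE.
have e1 : reg s1 vexp = p - 2 by rewrite /s1 !exE /= (cP hc).
have q1 : reg s1 rq = reg s rq by rewrite /s1 !exE.
clearbody s1.
have [|z1 z2] := powmodP p_pr P1 L1.
  by rewrite e1; apply: leq_ltn_trans pL; apply: leq_subr.
rewrite denAsg !reg_setr /= evVar [reg _ rq]den_reg // z1 b1 e1 q1.
by rewrite -exprS; apply: etrans (fermatF p_pr q0); congr (_ ^+ _)%R; have := p1; lia.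
Qed.

Lemma setup_blocksP s : CTX s -> exists k,
  [/\ env (lgr p) k (den setup_blocks s), n.+1 * B + 1 <= r ^ k.+1 &
    (k == 0) || (r ^ k < n.+1 * B + 1)].
Proof.
move=> hc; rewrite /setup_blocks denSeq; set s1 := den (Asg _ _) s.
have Bp' := B_le_p.
have h1 : n.+1 * B + 1 <= 4 * p ^ 2 by rewrite -mulnn; nia.
have need : reg s1 rneed = n.+1 * B + 1.
  rewrite /s1 !exE /= (cN hc) (cB hc) (psU (cps hc)) (addn1 n) modn_small //.
  by apply: leq_ltn_trans p2_small; apply: leq_trans h1 _; rewrite leq_mul2r orbT.
apply: (setupP p1 _ need); last by rewrite addn1 /= -addn1 need_small.
by case: (cps hc).
Qed.

Definition hit (e : nat) : bool := root_exp f gF e.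
Definition bad (j : nat) : bool := has (fun i => hit (j * B + i)) (iota 0 B).
Lemma eval_blocksP k s : CTX s -> env (lgr p) k s -> n.+1 * B + 1 <= r ^ k.+1 ->
  (k == 0) || (r ^ k < n.+1 * B + 1) ->
  let s' := den eval_blocks (den block_prog s) in
  (forall j, j < nblocks p b -> (arr aC s' (n * B + j) == 0) = bad j) /\
  reg s' rLen = n * B + 1 /\ ((reg s' rq)%:R = gF ^+ B :> 'F_p)%R.
Proof.
move=> hc he hN hk; have Bp' := B_le_p.
have h1 : n.+1 * B + 1 <= 4 * p ^ 2 by rewrite -mulnn; nia.
have [_ NM _] := setup_bound p1 (need_small h1) hk.
set N := r ^ k.+1 in hN.
have nN : n * 2 ^ b < N by move: hN; rewrite -/B; lia.
have aIp i : i <= n -> arr aI s i < p by move=> hi; rewrite (cI hc) // ap.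
have [hH hg2] := block_progP p_pr NM (cP hc) he (ctab hc) (cN hc) (cb hc) nN aIp.
have fE : pol 'F_p n.+1 (arr aI s) = f by apply: pol_congr => i hi; apply: (cI hc).
set s1 := den block_prog s in hH hg2 *.
have f1 := den_frame block_prog s; rewrite -/s1 in f1.
have hc1 := ctx_frame f1 hc isT; have he1 := env_frame f1 he isT.
rewrite (cG hc) -/gF fE in hH hg2.
clearbody s1; cbv zeta; rewrite /eval_blocks 4!denSeq.
set s2 := den (Asg rq _) _.
have f2 : frame [:: rLen; rY; rq] [::] s1 s2.
  by rewrite /s2 !denAsg; do 3 (apply: frame_trans; last by apply: frame_setr).
have hc2 := ctx_frame f2 hc1 isT; have he2 := env_frame f2 he1 isT.
have len2 : reg s2 rLen = n * B + 1.
  rewrite /s2 !exE /= (cN hc1) (cB hc1) (psU (cps hc1)) modn_small // -/B.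
  by apply: leq_ltn_trans p2_small; apply: leq_trans (_ : 4 * p ^ 2 <= _); rewrite ?leq_mul2r ?orbT //; lia.
have Y2 : reg s2 rY = 1 by rewrite /s2 !exE.
have q2 : reg s2 rq = reg s1 vg2 by rewrite /s2 !exE.
have H2 i : arr aH s2 i = arr aH s1 i by rewrite /s2 !exE.
clearbody s2.
have q20 : ((reg s2 rq)%:R != 0 :> 'F_p)%R by rewrite q2 hg2 expf_neq0 // gF0.
have qq := inv_progP hc2 q20.
set s3 := den inv_prog s2 in qq *.
have f3 := den_frame inv_prog s2; rewrite -/s3 in f3.
have hc3 := ctx_frame f3 hc2 isT; have he3 := env_frame f3 he2 isT.
have [len3 Y3 q3] : [/\ reg s3 rLen = n * B + 1, reg s3 rY = 1 & reg s3 rq = reg s2 rq].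
  by rewrite /s3 !den_reg.
have H3 i : arr aH s3 i = arr aH s1 i by rewrite /s3 den_arr.
clearbody s3.
have frL x : x \notin wr (chirp_prog aH) -> reg (den (chirp_prog aH) s3) x = reg s3 x.
  exact: den_reg.
split=> [j hj|]; last by rewrite !frL // len3 q3 q2 hg2.
have lenN : 0 < n * B + 1 <= N by rewrite addn1 /=; move: hN; rewrite mulSn; lia.
have jB : j < B := leq_trans hj nblocks_le.
have lE : (n * B + 1).-1 = n * B by rewrite addn1.
have jN : (n * B + 1).-1 + j < N by rewrite lE; move: hN; rewrite mulSn; lia.
have := chirp_progP (A := aH) p_pr NM (cP hc3) he3 (ctab hc3) isT isT len3 lenN qq jN.
rewrite lE => ->//; rewrite Y3 q3 q2 hg2 mul1r.
have -> : pol 'F_p (n * B + 1) (arr aH s3) = block f gF b.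
  apply: pol_eq => [|i hi].
    by rewrite addn1; apply: size_block; rewrite szf.
  by rewrite -hH coef_poly H3 (leq_trans hi) //; case/andP: lenN.
rewrite horner_block0 /bad; apply/existsP/hasP => [[i hi]|[i]].
  exists (nat_of_ord i); first by rewrite mem_iota add0n ltn_ord.
  by rewrite /hit /root_exp addnC exprD mulnC exprM.
rewrite mem_iota add0n => /= iB; rewrite /hit /root_exp addnC exprD mulnC exprM => hi.
by exists (Ordinal iB).
Qed.

Lemma collectP s : CTX s -> reg s rLen = n * B + 1 ->
  (forall j, j < nblocks p b -> (arr aC s (n * B + j) == 0) = bad j) ->
  list_of aJ vcnt (den collect s) = [seq j <- iota 0 (nblocks p b) | bad j].
Proof.
move=> hc hlen hC; have Bp' := B_le_p; have nB := nblocks_le.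
rewrite /collect 2!denSeq; set s1 := den (Asg vcnt _) _.
have f1 : frame [:: vJ; vcnt] [::] s s1.
  by rewrite /s1 !denAsg; do 2 (apply: frame_trans; last by apply: frame_setr).
have hc1 := ctx_frame f1 hc isT.
have J1 : reg s1 vJ = nblocks p b.
  rewrite /s1 !exE /= (cP hc) (cB hc) (psU (cps hc)) modn_small //.
  by apply: ltn_trans p_small; rewrite -/B -/(nblocks p b); lia.
have c1 : reg s1 vcnt = 0 by rewrite /s1 !exE.
have len1 : reg s1 rLen = n * B + 1 by rewrite /s1 !exE.
have C1 i : arr aC s1 i = arr aC s i by rewrite /s1 !exE.
clearbody s1.
pose I m st := list_of aJ vcnt st = [seq j <- iota 0 m | bad j].
suff : I (ev vJ s1) (den collect_loop s1) by rewrite evVar J1.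
apply: for_inv => [|m st]; first by rewrite /I /list_of c1.
rewrite evVar J1 => hm hf II.
have f2 : frame (wr collect_loop) (awr collect_loop) s1 (setr st vi m).
  by apply: frame_trans hf _; apply: frame_setr.
have hc2 := ctx_frame f2 hc1 isT.
have [hfr hfa] := f2.
have len2 : reg (setr st vi m) rLen = n * B + 1 by rewrite hfr.
have CE : arr aC (setr st vi m) (n * B + m) = arr aC s (n * B + m) by rewrite hfa.
have II2 : I m (setr st vi m) by [].
have vm2 : ev vi (setr st vi m) = m by [].
set st2 := setr st vi m in len2 CE hc2 II2 vm2 *.
have U2 := psU (cps hc2).
clearbody st2.
have szl : reg st2 vcnt <= m.
  by rewrite -(size_mkseq (arr aJ st2) (reg st2 vcnt)) -/(list_of _ _ _) II2 size_filter (leq_trans (count_size _ _)) ?size_iota.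
rewrite denIf evGet 2!evOp evNum vm2 evVar len2 /= addnK CE hC //.
rewrite /I -[m.+1]addn1 iotaD filter_cat add0n /=.
case: (bad m).
  have [|e1 _] := @list_of_push aJ vcnt vi rU st2 isT _ isT.
    by rewrite U2; apply: leq_ltn_trans p_small; lia.
  by rewrite /= e1 vm2 II2 cats1.
by rewrite /= cats0 -II2.
Qed.

Lemma size_bad : size [seq j <- iota 0 (nblocks p b) | bad j] <= 2 * n.
Proof.
have f0 : (f != 0)%R by rewrite -size_poly_gt0 szf.
apply: leq_trans (size_hits_filter (P := hit) (nblocks p b) (fun j => erefl _)) _.
by have := count_root_exp2 p_pr f0 pg nblocks_le2; rewrite szf.
Qed.

Lemma setup_scanP s : CTX s -> ((reg s rq)%:R = gF ^+ B :> 'F_p)%R -> exists k,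
  let s' := den setup_scan s in
  [/\ [/\ env (lgr p) k s', n + B + 1 <= r ^ k.+1 & (k == 0) || (r ^ k < n + B + 1)],
    [/\ reg s' rLen = n + 1, ((reg s' vgB)%:R = gF ^+ B :> 'F_p)%R, reg s' rq = g &
      ((reg s' rq)%:R * (reg s' rqi)%:R = 1 :> 'F_p)%R] &
    list_of aO vo s' = if a 0 == 0 then [:: 0] else [::]].
Proof.
move=> hc hq; have Bp' := B_le_p; have ps := p_small; have pp := prime_gt1 p_pr.
have U8 : n + B + 1 < 2 ^ r.+1 by lia.
rewrite /setup_scan 7!denSeq; set s1 := den (Asg rneed _) s.
have need : reg s1 rneed = n + B + 1.
  by rewrite /s1 !exE /= (cN hc) (cB hc) (psU (cps hc)) modn_small.
have f1 : frame [:: rneed] [::] s s1 by rewrite /s1 denAsg; apply: frame_setr.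
have hc1 := ctx_frame f1 hc isT; have q1 : reg s1 rq = reg s rq by [].
clearbody s1.
have h1 : n + B + 1 <= 4 * p ^ 2 by rewrite -mulnn; nia.
have [|k [he hN hk]] := setupP pp (cps hc1) need.
  by rewrite addn1 /= -addn1 need_small.
exists k; set s2 := den setup s1 in he *.
have f2 : frame (wr setup) (awr setup) s1 s2 := den_frame setup s1.
have hc2 := ctx_frame f2 hc1 isT.
have q2 : reg s2 rq = reg s rq by rewrite /s2 den_reg.
clearbody s2; set s3 := den (Asg rq _) _.
have f3 : frame [:: rLen; vgB; rq] [::] s2 s3.
  by rewrite /s3 !denAsg; do 3 (apply: frame_trans; last by apply: frame_setr).
have hc3 := ctx_frame f3 hc2 isT; have he3 := env_frame f3 he isT.
have len3 : reg s3 rLen = n + 1.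
  by rewrite /s3 !exE /= (cN hc2) (psU (cps hc2)) modn_small //; rewrite -/r; lia.
have gB3 : reg s3 vgB = reg s rq by rewrite /s3 !exE.
have q3 : reg s3 rq = g by rewrite /s3 !exE /= (cG hc2).
clearbody s3.
have q30 : ((reg s3 rq)%:R != 0 :> 'F_p)%R by rewrite q3; apply: gF0.
have qq := inv_progP hc3 q30; set s4 := den inv_prog s3 in qq *.
have f4 : frame (wr inv_prog) (awr inv_prog) s3 s4 := den_frame inv_prog s3.
have hc4 := ctx_frame f4 hc3 isT; have he4 := env_frame f4 he3 isT.
have [len4 gB4 q4] : [/\ reg s4 rLen = n + 1, reg s4 vgB = reg s rq & reg s4 rq = g].
  by rewrite /s4 !den_reg.
clearbody s4; set s5 := den (Asg vo _) s4.
have f5 : frame [:: vo] [::] s4 s5 by rewrite /s5 denAsg; apply: frame_setr.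
have hc5 := ctx_frame f5 hc4 isT; have he5 := env_frame f5 he4 isT.
have o5 : reg s5 vo = 0 by rewrite /s5 !exE.
have [len5 gB5 q5] : [/\ reg s5 rLen = n + 1, reg s5 vgB = reg s rq & reg s5 rq = g].
  by rewrite /s5 !exE.
have qi5 : reg s5 rqi = reg s4 rqi by rewrite /s5 !exE.
clearbody s5; set c := CIf _ _ _.
have f6 : frame (wr c) (awr c) s5 (den c s5) := den_frame c s5.
have [hfr _] := f6.
cbv zeta; rewrite !hfr // len5 gB5 q5 -q4 qi5; split=> //.
- by split=> //; apply: env_frame f6 he5 isT.
- rewrite /c denIf evGet evNum (cI hc5) //; case: eqP => a0 /=.
    have [|-> _] := @list_of_push aO vo (#0)%X rU s5 isT _ isT.
      by rewrite o5 (psU (cps hc5)); apply: leq_ltn_trans ps; lia.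
    by rewrite /list_of o5.
  by rewrite /list_of !exE /= o5.
Qed.

Definition hit_lt (e : nat) : bool := hit e && (e < p.-1).
Definition root_val (e : nat) : nat := val (gF ^+ e)%R.
Definition block_roots (j : nat) : seq nat := map root_val (hits hit_lt B j).

Lemma emitP e m s : CTX s -> reg s vk = m -> reg s vj * B + m = e ->
  (arr aC s (n + m) == 0) = hit e -> ((reg s vy2)%:R = gF ^+ e :> 'F_p)%R ->
  reg s vy2 < p -> (reg s vo).+1 < reg s rU ->
  [/\ list_of aO vo (den emit s) =
      list_of aO vo s ++ (if hit_lt e then [:: root_val e] else [::]),
    ((reg (den emit s) vy2)%:R = gF ^+ e.+1 :> 'F_p)%R, reg (den emit s) vy2 < p &
    reg (den emit s) vo <= (reg s vo).+1].
Proof.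
move=> hc hm he hC hy yp hU; rewrite /emit denSeq; set c := CIf _ _ _.
have [yc Pc Gc] : [/\ reg (den c s) vy2 = reg s vy2, reg (den c s) rP = p & reg (den c s) rG = g].
  by rewrite !den_reg // (cP hc) (cG hc).
suff [hl ho] : list_of aO vo (den c s) =
      list_of aO vo s ++ (if hit_lt e then [:: root_val e] else [::]) /\
    reg (den c s) vo <= (reg s vo).+1.
  clearbody c; rewrite denAsg; split; rewrite // !exE /= yc Pc Gc.
    by rewrite natF_mod // natrM hy exprSr.
  by rewrite ltn_pmod ?prime_gt0.
have yE : reg s vy2 = root_val e by rewrite /root_val -hy /= val_Fp_nat // modn_small.
rewrite /c denIf evGet evOp !evVar hm (cN hc) /= hC /hit_lt.
case: (hit e) => /=; last by rewrite denAsg evVar cats0 /list_of reg_setr /= leqnSn.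
rewrite denIf !evOp !evVar evNum hm (cP hc) (cB hc) /= he subn1 subn_eq0 -ltnNge.
case: ltnP => hlt; last by rewrite denAsg evVar cats0 /list_of reg_setr /= leqnSn.
have [|-> ->] := @list_of_push aO vo vy2 rU s isT _ isT; first exact: hU.
by rewrite -cats1 evVar yE.
Qed.

Lemma scan_blockP k s j : CTX s -> env (lgr p) k s -> n + B + 1 <= r ^ k.+1 ->
  (k == 0) || (r ^ k < n + B + 1) -> reg s rLen = n + 1 ->
  ((reg s vgB)%:R = gF ^+ B :> 'F_p)%R -> reg s rq = g ->
  ((reg s rq)%:R * (reg s rqi)%:R = 1 :> 'F_p)%R ->
  arr aJ s (reg s vi) = j -> j < nblocks p b -> reg s vo + B < reg s rU ->
  list_of aO vo (den scan_block s) = list_of aO vo s ++ block_roots j /\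
  reg (den scan_block s) vo <= reg s vo + B.
Proof.
move=> hc he hN hk hlen hgB hq hqq hj hjn hU.
have Bp' := B_le_p; have ps := p_small; have nB := nblocks_le; have pp := prime_gt1 p_pr.
have h1 : n + B + 1 <= 4 * p ^ 2 by rewrite -mulnn; nia.
have [_ NM _] := setup_bound pp (need_small h1) hk; set N := r ^ k.+1 in hN.
rewrite /scan_block 7!denSeq; set s1 := den (Asg vexp _) _.
have f1 : frame [:: vj; vbase; vexp] [::] s s1.
  by rewrite /s1 !denAsg; do 3 (apply: frame_trans; last by apply: frame_setr).
have hc1 := ctx_frame f1 hc isT; have he1 := env_frame f1 he isT; have [hfr1 hfa1] := f1.
have j1 : reg s1 vj = j by rewrite /s1 !exE /= hj.
have b1 : reg s1 vbase = reg s vgB by rewrite /s1 !exE.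
have e1 : reg s1 vexp = j by rewrite /s1 !exE /= hj.
clearbody s1.
have [|z1 z2] := powmodP p_pr (cP hc1) (psL (cps hc1)).
  by rewrite e1; apply: leq_ltn_trans pL; lia.
rewrite b1 e1 hgB -exprM in z1.
set s2 := den powmod s1 in z1 z2 *.
have f2 : frame (wr powmod) (awr powmod) s1 s2 := den_frame powmod s1.
have hc2 := ctx_frame f2 hc1 isT; have he2 := env_frame f2 he1 isT; have [hfr2 hfa2] := f2.
clearbody s2; set s3 := den (Asg rY _) s2.
have f3 : frame [:: rY] [::] s2 s3 by rewrite /s3 denAsg; apply: frame_setr.
have hc3 := ctx_frame f3 hc2 isT; have he3 := env_frame f3 he2 isT; have [hfr3 hfa3] := f3.
have Y3 : reg s3 rY = reg s2 vz by rewrite /s3 !exE.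
clearbody s3.
have len3 : reg s3 rLen = n + 1 by rewrite hfr3 // hfr2 // hfr1.
have q3 : reg s3 rq = g by rewrite hfr3 // hfr2 // hfr1.
have qq3 : ((reg s3 rq)%:R * (reg s3 rqi)%:R = 1 :> 'F_p)%R.
  by rewrite !hfr3 // !hfr2 // !hfr1.
have lenN : 0 < n + 1 <= N by rewrite addn1 /=; lia.
have C4 i : i < B -> (arr aC (den (chirp_prog aI) s3) (n + i) == 0) = hit (j * B + i).
  move=> iB; have lE : (n + 1).-1 = n by rewrite addn1.
  have iN : (n + 1).-1 + i < N by rewrite lE; lia.
  have := chirp_progP (A := aI) p_pr NM (cP hc3) he3 (ctab hc3) isT isT len3 lenN qq3 iN.
  rewrite lE => ->//; rewrite Y3 q3 z1 /hit /root_exp exprD [(j * B)%N]mulnC -/gF.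
  have -> : pol 'F_p (n + 1) (arr aI s3) = f; last by [].
  by rewrite addn1; apply: pol_congr => u hu; apply: (cI hc3).
set s4 := den (chirp_prog aI) s3 in C4 *.
have f4 : frame (wr (chirp_prog aI)) (awr (chirp_prog aI)) s3 s4 := den_frame _ s3.
have hc4 := ctx_frame f4 hc3 isT; have [hfr4 hfa4] := f4.
clearbody s4; set s5 := den (Asg vy2 _) s4.
have f5 : frame [:: vy2] [::] s4 s5 by rewrite /s5 denAsg; apply: frame_setr.
have hc5 := ctx_frame f5 hc4 isT; have [hfr5 hfa5] := f5.
have y5 : reg s5 vy2 = reg s2 vz by rewrite /s5 !exE /= hfr4.
have o5 : reg s5 vo = reg s vo by rewrite hfr5 // hfr4 // hfr3 // hfr2 // hfr1.
have l5 : list_of aO vo s5 = list_of aO vo s.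
  rewrite /list_of o5; apply: eq_map => i.
  by rewrite hfa5 // hfa4 // hfa3 // hfa2 // hfa1.
have j5 : reg s5 vj = j by rewrite hfr5 // hfr4 // hfr3 // hfr2.
have C5 i : i < B -> (arr aC s5 (n + i) == 0) = hit (j * B + i) by apply: C4.
have U5 : reg s5 rU = reg s rU by rewrite hfr5 // hfr4 // hfr3 // hfr2 // hfr1.
clearbody s5.
pose I m st := [/\ list_of aO vo st =
    list_of aO vo s ++ map root_val [seq j * B + i | i <- iota 0 m & hit_lt (j * B + i)],
  ((reg st vy2)%:R = gF ^+ (j * B + m) :> 'F_p)%R, reg st vy2 < p & reg st vo <= reg s vo + m].
suff : I (ev rB s5) (den (For vk rB emit) s5).
  by rewrite evVar (cB hc5) -/B => -[-> _ _ ->]; split.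
apply: for_inv => [|m st].
  split; rewrite ?cats0 ?l5 ?y5 ?o5 ?addn0 //=.
  by rewrite z1 mulnC.
rewrite evVar (cB hc5) -/B => hm hf [I1 I2 I3 I4].
set st1 := setr st vk m.
have f6 : frame (vk :: wr emit) (awr emit) s5 st1 by apply: frame_trans hf _; apply: frame_setr.
have hc6 := ctx_frame f6 hc5 isT; have [hfr6 hfa6] := f6.
have m6 : reg st1 vk = m by rewrite /st1 reg_setr.
have l6 : list_of aO vo st1 = list_of aO vo st by [].
have y6 : reg st1 vy2 = reg st vy2 by [].
have o6 : reg st1 vo = reg st vo by [].
clearbody st1.
have C6 : (arr aC st1 (n + m) == 0) = hit (j * B + m) by rewrite hfa6 // C5.
have j6 : reg st1 vj = j by rewrite hfr6.
have U6 : reg st1 rU = reg s rU by rewrite hfr6.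
have iotaS : [seq j * B + i | i <- iota 0 m.+1 & hit_lt (j * B + i)] =
    [seq j * B + i | i <- iota 0 m & hit_lt (j * B + i)] ++
    (if hit_lt (j * B + m) then [:: j * B + m] else [::]).
  by rewrite -[m.+1]addn1 iotaD filter_cat map_cat /=; case: ifP.
have [||||e1' e2' e3' e4'] := @emitP (j * B + m) m st1 hc6 m6 _ C6.
- by rewrite j6.
- by rewrite y6.
- by rewrite y6.
- by rewrite o6 U6; lia.
rewrite l6 I1 in e1'; split=> //; last by rewrite addnS (leq_trans e4') // o6 ltnS.
  by rewrite e1' iotaS map_cat catA; case: ifP.
by rewrite addnS.
Qed.
End Main.

(** * Running time *)

(** Minimality of [k] gives [r ^ k.+1 <= r * len]. Passing from base [r] to base [2 r] costs the
    factor [2 ^ k.+1], at most [2 ^ (3 t + 3)], which the spare powers of [2 r = 2 ^ (t + 7)]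
    absorb. This is where the choice of [t] pays off. *)
Lemma env_sizes p len k : 1 < p -> 0 < len <= 2 ^ (3 * bitlen p) ->
  (k == 0) || ((2 ^ lgr p) ^ k < len) ->
  [/\ k.+1 <= (2 ^ lgr p).*2, (2 ^ lgr p) ^ k.+1 <= (2 ^ lgr p).*2 * len &
    (2 ^ lgr p).*2 ^ k.+1 <= (2 ^ lgr p).*2 ^ 4 * len].
Proof.
move=> p1 /andP[l0 hl] hk; have [_ _ h3] := setup_bound p1 hl hk.
set t := isqrt (bitlen p) in h3; have rE : lgr p = t + 6 by [].
have rk : (2 ^ lgr p) ^ k.+1 <= 2 ^ lgr p * len.
  rewrite expnS leq_mul2l; apply/orP; right.
  by case/orP: hk => [/eqP ->|/ltnW].
have r2 : (2 ^ lgr p).*2 = 2 ^ (t + 7) by rewrite -mul2n -expnS rE -addnS.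
split.
- rewrite r2 expnD; have := ltn_expl t (isT : 1 < 2); lia.
- by apply: leq_trans rk _; rewrite leq_mul2r -addnn leq_addr orbT.
- rewrite -mul2n expnMn; apply: (@leq_trans (2 ^ k.+1 * (2 ^ lgr p * len))).
    by rewrite leq_mul2l rk orbT.
  rewrite mulnA leq_mul2r mul2n r2 rE -expnM -expnD leq_exp2l //; apply/orP; right; lia.
Qed.

Lemma cost_digits s Z : reg s rK <= Z -> 0 < Z -> cost digits s <= 100 * Z.
Proof. by rewrite /digits /= evVar; lia. Qed.

(** A pass evaluates naive transforms of order [2 r] at a cost of [2 r] per entry, and the number
    [k.+1] of passes is at most another [2 r]. *)
Lemma cost_polymul rho k s : env rho k s -> k.+1 <= (2 ^ rho).*2 ->
  cost polymul s <= 2000 * ((2 ^ rho).*2 ^ 2 * (2 ^ rho).*2 ^ k.+1).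
Proof.
move=> he kZ; have [eR eR2 eM eK eRK eQ eS eU] := he.
set Z := (2 ^ rho).*2 in kZ eR2 eQ eS *; set S := Z ^ k.+1 in eS *.
have Z0 : 0 < Z by rewrite double_gt0 expn_gt0.
have S0 : 0 < S by rewrite expn_gt0 Z0.
have RKS : (2 ^ rho) ^ k.+1 <= S by rewrite leq_exp2r // /Z -addnn leq_addr.
have cd : cost digits s <= 100 * Z by apply: cost_digits => //; rewrite eK.
rewrite /polymul /spread_prog /fwd_prog /bwd_prog /fold_prog.
move: cd; move: (digits) => D cd /=; rewrite !evVar eK eRK eS eR2.
move: (cost D s) ((2 ^ rho) ^ k.+1) cd RKS => d rk cd RKS.
have ZS : Z * S <= Z ^ 2 * S by rewrite leq_mul2r expnS expn1 leq_pmulr ?orbT.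
have SZ : S <= Z * S by rewrite leq_pmull.
have dS : S * d <= 100 * (Z * S) by move: cd; nia.
have Z2 : Z ^ 2 * S = Z * (Z * S) by rewrite expnS expn1 mulnA.
have k1 : k.+1 * S <= Z * S by rewrite leq_mul2r kZ orbT.
have k2 : k.+1 * (S * Z) <= Z ^ 2 * S by rewrite Z2 [S * Z]mulnC leq_mul2r kZ orbT.
rewrite Z2 in k2 ZS *; clear Z2 he eR eR2 eM eK eRK eQ eS eU cd D kZ.
clearbody S; clearbody Z; move: k.+1 k1 k2 => K k1 k2.
nia.
Qed.

Lemma cost_powmod s Z : reg s rL <= Z -> 0 < Z -> cost powmod s <= 100 * Z.
Proof. by rewrite /powmod /= evVar; lia. Qed.

Lemma cost_inv_prog s Z : reg s rL <= Z -> 0 < Z -> cost inv_prog s <= 200 * Z.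
Proof.
move=> hL Z0; rewrite /inv_prog; have := cost_powmod hL Z0.
by move: (powmod) => c hc /=; lia.
Qed.

Lemma cost_chirp_prog rho k A s len : env rho k s -> k.+1 <= (2 ^ rho).*2 ->
  reg s rLen <= len -> len <= (2 ^ rho).*2 ^ k.+1 ->
  cost (chirp_prog A) s <= 3000 * ((2 ^ rho).*2 ^ 2 * (2 ^ rho).*2 ^ k.+1).
Proof.
move=> he kZ hlen hS; have := cost_polymul he kZ.
rewrite /chirp_prog; move: (polymul) => c hc /=; rewrite !evVar (envRK he).
have : (2 ^ rho) ^ k.+1 <= (2 ^ rho).*2 ^ k.+1 by rewrite leq_exp2r // -addnn leq_addr.
move: hS hc; set S := _.*2 ^ _; set Z := _ ^ 2.
have : 0 < Z by rewrite expn_gt0 double_gt0 expn_gt0.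
have : 0 < S by rewrite expn_gt0 double_gt0 expn_gt0.
move: hlen; move: (reg s rLen) (cost c s) (_ ^ _) S Z => l d rk S Z; nia.
Qed.

Lemma cost_block_prog rho k s b : env rho k s -> k.+1 <= (2 ^ rho).*2 ->
  reg s rb = b -> reg s rN <= (2 ^ rho).*2 ^ k.+1 ->
  cost block_prog s <= 4000 * (b.+1 * ((2 ^ rho).*2 ^ 2 * (2 ^ rho).*2 ^ k.+1)).
Proof.
move=> he kZ hb hN; have := cost_polymul he kZ.
rewrite /block_prog /copy_input /double_step; move: (polymul) => c hc /=.
rewrite !evVar (envRK he) hb.
have : (2 ^ rho) ^ k.+1 <= (2 ^ rho).*2 ^ k.+1 by rewrite leq_exp2r // -addnn leq_addr.
move: hN hc; set S := _.*2 ^ _; set Z := _ ^ 2.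
have : 0 < Z by rewrite expn_gt0 double_gt0 expn_gt0.
have : 0 < S by rewrite expn_gt0 double_gt0 expn_gt0.
move: (reg s rN) (cost c s) (_ ^ _) S Z => l d rk S Z S0 Z0 hl hd hrk.
have SZ : S <= Z * S by rewrite leq_pmull.
move: (Z * S) SZ hd => T SZ hd; nia.
Qed.

Lemma cost_setup s Z : reg s rR <= Z -> 0 < Z -> cost setup s <= 200 * Z.
Proof. by rewrite /setup /= evVar; lia. Qed.

Lemma cost_load_input s n : reg s rN = n -> cost load_input s <= 100 * n.+1.
Proof. by rewrite /load_input /= evVar; lia. Qed.

Lemma cost_bound_prog s Z : reg s rL <= Z -> 0 < Z -> cost bound_prog s <= 200 * Z.
Proof. by rewrite /bound_prog /= evVar; lia. Qed.

Lemma cost_tables_prog s Z : reg s rR2 <= Z -> reg s rrho <= Z -> 0 < Z ->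
  cost tables_prog s <= 200 * Z.
Proof. by rewrite /tables_prog /= !evOp !evVar evNum /=; lia. Qed.

Lemma cost_primes_prog s B Z : reg s rL <= Z -> reg s rB = B -> 0 < Z -> 0 < B ->
  cost primes_prog s <= 300 * (B * Z).
Proof. by rewrite /primes_prog /strip /= !evOp !evVar evNum /= => hL -> Z0 B0; nia. Qed.

Lemma cost_gen_prog s B Z : reg s rL <= Z -> reg s rB = B -> reg s vc <= Z -> 0 < Z -> 0 < B ->
  cost gen_prog s <= 1000 * (Z * (B * Z)).
Proof.
move=> hL hB hc Z0 B0; have := cost_powmod hL Z0.
rewrite /gen_prog /search /strip; move: (powmod) => c h /=; rewrite !evVar hB.
have : cost c s <= 100 * (B * Z) by nia.
move: hL hc h; move: (reg s rL) (reg s vc) (cost c s) => l v d hl hv hd hd2.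
have h1 : B * (d + 50) <= 200 * (B * Z) by nia.
have h2 : l <= B * Z by nia.
have h3 : 1 <= B * Z by nia.
have h4 : B * d <= 100 * (B * Z) by nia.
have h5 : B <= B * Z by nia.
move: (B * Z) h1 h2 h3 h4 h5 hd2 => T h1 h2 h3 h4 h5 hd2.
move: (B * d) h4 => Bd h4.
nia.
Qed.

Lemma cost_collect_loop s J : reg s vJ = J -> cost collect_loop s <= 100 * J.+1.
Proof. by rewrite /collect_loop /= evVar; lia. Qed.

Lemma cost_write_out s v : reg s vo = v -> cost write_out s <= 100 * v.+1.
Proof. by rewrite /write_out /= evVar; lia. Qed.

Lemma cost_scan rho k s len B v : env rho k s -> k.+1 <= (2 ^ rho).*2 ->
  reg s rLen <= len -> len <= (2 ^ rho).*2 ^ k.+1 -> reg s rB = B ->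
  B <= (2 ^ rho).*2 ^ k.+1 -> reg s rL <= (2 ^ rho).*2 -> reg s vcnt = v ->
  cost scan s <= 10 + v * (4000 * ((2 ^ rho).*2 ^ 2 * (2 ^ rho).*2 ^ k.+1)).
Proof.
move=> he kZ hlen hS hB hBS hL hv.
have Z0 : 0 < (2 ^ rho).*2 by rewrite double_gt0 expn_gt0.
have := cost_chirp_prog aI he kZ hlen hS; have := cost_powmod hL Z0.
rewrite /scan /scan_block /emit; move: (powmod) (chirp_prog aI) => c1 c2 h1 h2 /=.
rewrite !evVar hB hv; rewrite leq_add //= leq_mul2l; apply/orP; right.
have S0 : 0 < (2 ^ rho).*2 ^ k.+1 by rewrite expn_gt0 Z0.
move: hBS h1 h2; move: ((2 ^ rho).*2 ^ k.+1) S0 (cost c1 s) (cost c2 s) => S S0 d1 d2.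
move: (2 ^ rho).*2 Z0 => Z Z0; rewrite expnS expn1; move=> hBS h1 h2.
have h3 : Z <= Z * Z * S by nia.
have h4 : S <= Z * Z * S by rewrite leq_pmull // muln_gt0 Z0.
by move: (Z * Z * S) h2 h3 h4 => T; lia.
Qed.

Section Scan.
Variables (p n b g : nat) (a : nat -> nat).
Hypotheses (p_pr : prime p) (n0 : 0 < n) (np : n <= p).
Let B := 2 ^ b.
Hypotheses (Bp : p <= B ^ 2) (B4p : B ^ 2 < 4 * p) (B2 : 2 <= B).
Hypothesis ap : forall i, i <= n -> a i < p.
Let gF : 'F_p := (g%:R)%R.
Hypotheses (gp : g < p) (pg : (p.-1).-primitive_root%R gF).
Let f : {poly 'F_p} := pol 'F_p n.+1 a.
Hypothesis szf : size f = n.+1.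
Let r := 2 ^ lgr p.
Let bads := [seq j <- iota 0 (nblocks p b) | bad p n b g a j].
Let out0 := if a 0 == 0 then [:: 0] else [::].

(** The blocks cover all exponents below [p - 1], the excess fails [hit_lt], and blocks that are not
    bad contribute nothing. *)
Lemma perm_block_roots :
  perm_eq (out0 ++ flatten [seq block_roots p n b g a j | j <- bads])
          [seq val x | x <- enum 'F_p & root f x].
Proof.
have f0 : (f != 0)%R by rewrite -size_poly_gt0 szf.
have -> : out0 = if (f.[0] == 0)%R then [:: 0] else [::].
  rewrite horner_coef0 /f coef_poly /= natF_lt_eq0 ?ap //.
have -> : flatten [seq block_roots p n b g a j | j <- bads] =
    map (root_val p g) (filter (hit_lt p n g a) (iota 0 (nblocks p b * B))).
  rewrite -(@flatten_hits_filter _ B (bad p n b g a)); first by rewrite map_flatten -map_comp.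
  by move=> j; apply: sub_has => i /andP[].
have -> : filter (hit_lt p n g a) (iota 0 (nblocks p b * B)) =
    filter (root_exp f gF) (iota 0 p.-1).
  have h := nblocks_ge b (prime_gt1 p_pr).
  rewrite -(subnKC h) iotaD filter_cat add0n.
  rewrite [X in _ ++ X](_ : _ = [::]) ?cats0; last first.
    apply/eqP; rewrite -(negbK (_ == _)) -has_filter; apply/hasPn => e.
    by rewrite mem_iota /hit_lt => /andP[he _]; rewrite negb_and -leqNgt he orbT.
  apply: eq_in_filter => e; rewrite mem_iota add0n => /andP[_ he].
  by rewrite /hit_lt he andbT.
exact: perm_roots.
Qed.

Lemma scanP k s : ctx p n b g a s -> env (lgr p) k s -> n + B + 1 <= r ^ k.+1 ->
  (k == 0) || (r ^ k < n + B + 1) -> reg s rLen = n + 1 ->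
  ((reg s vgB)%:R = gF ^+ B :> 'F_p)%R -> reg s rq = g ->
  ((reg s rq)%:R * (reg s rqi)%:R = 1 :> 'F_p)%R ->
  list_of aJ vcnt s = bads -> list_of aO vo s = out0 ->
  perm_eq (list_of aO vo (den scan s)) [seq val x | x <- enum 'F_p & root f x].
Proof.
move=> hc he hN hk hlen hgB hq hqq hJ hO.
pose I m st := list_of aO vo st = out0 ++ flatten [seq block_roots p n b g a j | j <- take m bads] /\
  reg st vo <= 1 + m * B.
have szb : size bads = reg s vcnt by rewrite -hJ size_mkseq.
have Bp' := block_le_prime Bp B4p.
suff : I (ev vcnt s) (den scan s).
  by rewrite evVar -szb /I take_size => -[-> _]; apply: perm_block_roots.
apply: for_inv => [|m st].
  rewrite /I take0 cats0 hO; split=> //.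
  have := size_mkseq (arr aO s) (reg s vo); rewrite -/(list_of _ _ _) hO => <-.
  by rewrite /out0; case: ifP.
rewrite evVar -szb => hm hf [I1 I2].
have f1 : frame (vi :: wr scan_block) (awr scan_block) s (setr st vi m).
  by apply: frame_trans hf _; apply: frame_setr; rewrite inE eqxx.
have hc1 := ctx_frame f1 hc isT; have he1 := env_frame f1 he isT; have [hfr hfa] := f1.
have i1 : reg (setr st vi m) vi = m by [].
have o1 : reg (setr st vi m) vo = reg st vo by [].
have l1 : list_of aO vo (setr st vi m) = list_of aO vo st by [].
set st1 := setr st vi m in f1 hc1 he1 hfr hfa i1 o1 l1 *; clearbody st1.
have mb : m < reg s vcnt by rewrite -szb.
have nm : nth 0 bads m = arr aJ st1 (reg st1 vi).
  by rewrite -hJ /list_of nth_mkseq // i1 hfa.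
have jn : nth 0 bads m < nblocks p b.
  have : nth 0 bads m \in bads by apply: mem_nth.
  by rewrite mem_filter mem_iota add0n => /andP[_ /andP[]].
have mJ : m < nblocks p b.
  apply: leq_trans hm _; rewrite size_filter.
  by apply: leq_trans (count_size _ _) _; rewrite size_iota.
have hU : reg st1 vo + B < reg st1 rU.
  rewrite o1 (psU (cps hc1)); have h2 := nblocks_le2 Bp B4p (prime_gt1 p_pr).
  apply: leq_ltn_trans (linear_small (prime_gt1 p_pr)); apply: (@leq_trans (1 + m.+1 * B)).
    by rewrite mulSn; move: I2; rewrite -/B; lia.
  have h3 : m.+1 * B <= nblocks p b * B by rewrite leq_mul2r mJ orbT.
  by move: h2 h3; rewrite -/B; lia.
have len1 : reg st1 rLen = n + 1 by rewrite hfr.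
have gB1 : ((reg st1 vgB)%:R = gF ^+ B :> 'F_p)%R by rewrite hfr.
have q1 : reg st1 rq = g by rewrite hfr.
have qq1 : ((reg st1 rq)%:R * (reg st1 rqi)%:R = 1 :> 'F_p)%R by rewrite !hfr.
have [e1 e2] := scan_blockP p_pr n0 np Bp B4p B2 gp pg szf hc1 he1 hN hk len1 gB1 q1 qq1 (esym nm) jn hU.
split.
  by rewrite e1 l1 I1 (take_nth 0) // map_rcons -cats1 flatten_cat /= cats0 catA.
by apply: leq_trans e2 _; rewrite o1 mulSn -/B; lia.
Qed.
End Scan.

(** * Output, assembly of the phases and total time *)

(** Output entry [m] is read from cell [16 m + 12] when only cells below [m] have been overwritten,
    so copying upwards is safe. *)
Lemma write_outP s :
  output (setr (den write_out s) 0 (reg (den write_out s) vo)) = list_of aO vo s.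
Proof.
pose I m st := (forall i, i < m -> mem st i = arr aO s i) /\ (forall x, m <= x -> mem st x = mem s x).
have [h _] : I (ev vo s) (den write_out s).
  apply: for_inv => // m st _ _ [I1 I2]; rewrite /write_out; set st1 := setr st vi m.
  have -> : den (Raw vi aO.[vi]%X) st1 = setm st1 m (mem st (cell aO m)) by [].
  have cm : m <= cell aO m by rewrite /cell; lia.
  split=> i hi /=.
    have [->|/eqP ne] := eqVneq i m; first by rewrite updE I2.
    by rewrite updN // I1 //; lia.
  by rewrite updN ?I2 //; lia.
rewrite /output /list_of /= updE den_reg //; apply/eq_in_map => i.
by rewrite mem_iota add0n => /andP[_ hi]; rewrite h.
Qed.

Lemma stepsSeq c1 c2 s : steps (CSeq c1 c2) s = steps c1 s + steps c2 (den c1 s).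
Proof. by []. Qed.

Lemma lgr_sizes p : [/\ bitlen p <= (2 ^ lgr p).*2, lgr p <= (2 ^ lgr p).*2 & 0 < (2 ^ lgr p).*2].
Proof.
have h := radix_large (bitlen p); rewrite -/(lgr p) in h.
by split; rewrite ?double_gt0 ?expn_gt0 //; lia.
Qed.

Lemma prepareP p n s (a : nat -> nat) : prime p -> 0 < n -> reg s rP = p -> reg s rN = n ->
  params_spec p s -> (forall j, j <= n -> mem s j = a j) ->
  exists b g, [/\ ctx p n b g a (den prepare s),
    [/\ p <= (2 ^ b) ^ 2, (2 ^ b) ^ 2 < 4 * p & 2 <= 2 ^ b],
    g < p /\ ((p.-1).-primitive_root (g%:R : 'F_p))%R &
    steps prepare s <= 3000 * ((2 ^ lgr p).*2 ^ 2 * (n * 2 ^ b))].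
Proof.
move=> p_pr n0 hp hn hps hm; have p1 := prime_gt1 p_pr.
have ps := linear_small p1.
rewrite /prepare 4!denSeq 4!stepsSeq; set s1 := den load_input s.
have k1 := leq_trans (steps_cost s (isT : static load_input)) (cost_load_input hn).
have I1 := load_inputP hn; rewrite -/s1 in I1.
have f1 : frame (wr load_input) (awr load_input) s s1 := den_frame load_input s.
have ps_frame xs As u u' : frame xs As u u' -> params_spec p u ->
    all (fun x => x \notin xs) [:: rL; rrho; rR; rR2; rM; rU] -> params_spec p u'.
  by case=> h _ [? ? ? ? ? ?] /and5P[? ? ? ? /and3P[? ? _]]; split; rewrite h.
have ps1 := ps_frame _ _ _ _ f1 hps isT.
have [P1 N1] : reg s1 rP = p /\ reg s1 rN = n by have [h _] := f1; rewrite !h.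
have [LZ rhoZ Z0] := lgr_sizes p; set Z := (2 ^ lgr p).*2 in LZ rhoZ Z0 *.
have k2 : steps bound_prog s1 <= 200 * Z.
  by apply: leq_trans (steps_cost s1 (isT : static bound_prog)) _; apply: cost_bound_prog; rewrite ?(psL ps1).
clearbody s1; set s2 := den bound_prog s1.
have f2 : frame (wr bound_prog) (awr bound_prog) s1 s2 := den_frame bound_prog s1.
have ps2 := ps_frame _ _ _ _ f2 ps1 isT.
have [|B1 B2 B3 B4] := bound_progP p1 P1 (psL ps1).
  by rewrite (psU ps1); apply: leq_ltn_trans ps; lia.
rewrite -/s2 in B1 B2 B3 B4; set b := reg s2 rb in B1.
have [P2 N2] : reg s2 rP = p /\ reg s2 rN = n by have [h _] := f2; rewrite !h.
have I2 j : arr aI s2 j = arr aI s1 j by have [_ ->] := f2.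
have b2 : reg s2 rb = b by [].
have k3 : steps tables_prog s2 <= 200 * Z.
  apply: leq_trans (steps_cost s2 (isT : static tables_prog)) _.
  by apply: cost_tables_prog; rewrite ?(psR2 ps2) ?(psrho ps2).
clearbody s2 b; set s3 := den tables_prog s2.
have t3 := tables_progP ps2; rewrite -/s3 in t3.
have f3 : frame (wr tables_prog) (awr tables_prog) s2 s3 := den_frame tables_prog s2.
have ps3 := ps_frame _ _ _ _ f3 ps2 isT.
have [P3 N3 B3' b3] : [/\ reg s3 rP = p, reg s3 rN = n, reg s3 rB = 2 ^ b & reg s3 rb = b].
  by have [h _] := f3; rewrite !h.
have I3 j : arr aI s3 j = arr aI s1 j by have [_ ->] := f3.
rewrite B1 in B2 B3 B4; set B := 2 ^ b in B1 B2 B3 B4 B3' *.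
have B0 : 0 < B := ltnW B4.
have k4 : steps primes_prog s3 <= 300 * (B * Z).
  apply: leq_trans (steps_cost s3 (isT : static primes_prog)) _.
  by apply: cost_primes_prog; rewrite ?(psL ps3).
clearbody s3.
have Bp := block_le_prime B2 B3.
have BU : B.+2 < reg s3 rU by rewrite (psU ps3); apply: leq_ltn_trans ps; lia.
have LU : bitlen p < reg s3 rU.
  rewrite (psU ps3); apply: leq_ltn_trans ps; apply: (@leq_trans p); last by lia.
  have := bitlen_le (ltnW p1); have : 0 < bitlen p by [].
  case: (bitlen p) => // l _ /= hl; exact: leq_trans (ltn_expl l (isT : 1 < 2)) hl.
have pL := bitlen_gt p.
have [h4 vcL] := primes_progP p_pr pL B2 B4 P3 (psL ps3) B3' LU BU.
set s4 := den primes_prog s3 in h4 vcL *.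
have f4 : frame (wr primes_prog) (awr primes_prog) s3 s4 := den_frame primes_prog s3.
have ps4 := ps_frame _ _ _ _ f4 ps3 isT.
have [P4 N4 B4' b4] : [/\ reg s4 rP = p, reg s4 rN = n, reg s4 rB = B & reg s4 rb = b].
  by have [h _] := f4; rewrite !h.
have I4 j : arr aI s4 j = arr aI s1 j by have [_ ->] := f4.
have t4 := tables_frame f4 t3 isT.
have k5 : steps gen_prog s4 <= 1000 * (Z * (B * Z)).
  apply: leq_trans (steps_cost s4 (isT : static gen_prog)) _.
  by apply: cost_gen_prog; rewrite ?(psL ps4) //; apply: leq_trans LZ; apply: ltnW.
clearbody s4.
have [||g1 g2] := gen_progP p_pr pL B2 B4 P4 (psL ps4) B4' _ _ h4.
- by rewrite (psU ps4); apply: leq_ltn_trans ps; lia.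
- by rewrite (psU ps4); apply: leq_ltn_trans ps; lia.
exists b, (reg (den gen_prog s4) rG); set s5 := den gen_prog s4 in g1 g2 *.
have f5 : frame (wr gen_prog) (awr gen_prog) s4 s5 := den_frame gen_prog s4.
have [hfr hfa] := f5.
split=> //; last first.
  have nBZ : Z * (B * Z) <= Z ^ 2 * (n * B).
    have -> : Z * (B * Z) = Z ^ 2 * B by rewrite -mulnn; ring.
    by rewrite leq_mul2l leq_pmull ?orbT.
  have e1 : B * Z <= Z * (B * Z) by rewrite leq_pmull.
  have e2 : Z <= B * Z by rewrite leq_pmull.
  have e3 : n <= Z ^ 2 * (n * B).
    by rewrite mulnCA leq_pmulr // muln_gt0 expn_gt0 Z0.
  move: (Z ^ 2 * (n * B)) (Z * (B * Z)) (B * Z) nBZ e1 e2 e3 k1 k2 k3 k4 k5 => T1 T2 T3; lia.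
split=> //; try by rewrite hfr.
- exact: ps_frame f5 ps4 isT.
- exact: tables_frame f5 t4 isT.
- by move=> j hj; rewrite hfa // I4 I1 // hm.
Qed.

Lemma block_need p n B : 1 < p -> n <= p -> B <= p -> 0 < n.+1 * B + 1 <= 2 ^ (3 * bitlen p).
Proof.
move=> p1 np Bp; rewrite addn1 ltn0Sn -addn1 need_le //.
have := leq_mul (np : n.+1 <= p.+1) Bp; rewrite -mulnn.
by move: (n.+1 * B) => x; nia.
Qed.

Lemma scan_need p n B : 1 < p -> n <= p -> B <= p -> 0 < n + B + 1 <= 2 ^ (3 * bitlen p).
Proof.
move=> p1 np Bp; rewrite addn1 ltn0Sn -addn1 need_le // -mulnn.
have : p + p <= p * p by rewrite addnn -mul2n leq_mul2r p1 orbT.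
by move: (p * p) => x; lia.
Qed.

(** The scan costs about [v (n + B)] for [v] blocks, where [v n <= n B] by [v <= B] and
    [v B <= 2 n B] by [v <= 2 n]. The exponent 7 adds up 4 from the size of a transform, 2 from its
    passes, and 1 from the [b] doublings. *)
Lemma main_arith Z n B b v S1 S2 x1 x2 x3 x4 x5 x6 x7 x8 :
  0 < Z -> 0 < n -> 1 < B -> b.+1 <= Z -> v <= 2 * n -> v <= B ->
  S1 <= Z ^ 4 * (n.+1 * B + 1) -> S2 <= Z ^ 4 * (n + B + 1) ->
  x1 <= 3000 * (Z ^ 2 * (n * B)) -> x2 <= 300 * Z -> x3 <= 4000 * (b.+1 * (Z ^ 2 * S1)) ->
  x4 <= 4000 * (Z ^ 2 * S1) -> x5 <= 200 * (B + 1) -> x6 <= 600 * Z ->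
  x7 <= 10 + v * (4000 * (Z ^ 2 * S2)) -> x8 <= 100 * n.+1 ->
  x1 + (x2 + (x3 + (x4 + (x5 + (x6 + (x7 + x8)))))) <= 45 * 1000 * (Z ^ 7 * (n * B)).
Proof.
move=> Z0 n0 B2 bZ v2n vB z3 y3 k1 l2 l3 l4 l5 l6 l7 l8; have B0 : 0 < B := ltnW B2.
pose T := Z ^ 7 * (n * B); rewrite -/T.
have pT i : i <= 7 -> Z ^ i * (n * B) <= T.
  by move=> hi; rewrite leq_mul2r leq_pexp2l // orbT.
have nB0 : 0 < n * B by rewrite muln_gt0 n0.
have T0 := pT 0 isT; rewrite mul1n in T0.
have T2 := pT 2 isT; have T6 := pT 6 isT.
have TZ : Z <= T by apply: leq_trans (pT 1 isT); rewrite expn1 leq_pmulr.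
have BnB : B <= n * B by rewrite leq_pmull.
have nnB : n <= n * B by rewrite leq_pmulr.
have c1 : Z ^ 2 * S1 <= 3 * (Z ^ 6 * (n * B)).
  apply: (@leq_trans (Z ^ 2 * (Z ^ 4 * (3 * (n * B))))).
    rewrite leq_mul2l; apply/orP; right; apply: leq_trans z3 _.
    by rewrite leq_mul2l; apply/orP; right; rewrite mulSn; lia.
  by rewrite mulnA -expnD mulnCA.
have c2 : b.+1 * (Z ^ 2 * S1) <= 3 * T.
  apply: leq_trans (leq_mul bZ c1) _.
  by rewrite mulnCA [Z * _]mulnA -expnS.
have c3 : v * (Z ^ 2 * S2) <= 4 * T.
  apply: (@leq_trans (Z ^ 6 * (v * (n + B + 1)))).
    apply: (@leq_trans (v * (Z ^ 2 * (Z ^ 4 * (n + B + 1))))).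
      by rewrite leq_mul2l leq_mul2l y3 !orbT.
    by rewrite [Z ^ 2 * _]mulnA -expnD mulnCA.
  apply: (@leq_trans (Z ^ 6 * (4 * (n * B)))); last by rewrite mulnCA leq_mul2l T6 orbT.
  rewrite leq_mul2l; apply/orP; right; rewrite !mulnDr muln1.
  have w1 : v * n <= n * B by rewrite mulnC leq_mul2l vB orbT.
  have w2 : v * B <= 2 * (n * B) by rewrite mulnA leq_mul2r v2n orbT.
  have w3 : v <= n * B by apply: leq_trans vB _.
  by lia.
have l7' : x7 <= 10 + 4000 * (v * (Z ^ 2 * S2)) by apply: leq_trans l7 _; rewrite mulnCA.
clear pT l7 z3 y3; move: (b.+1 * (Z ^ 2 * S1)) (Z ^ 2 * S1) (Z ^ 2 * (n * B)) (Z ^ 6 * (n * B)) (v * (Z ^ 2 * S2))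
  T T0 T2 T6 TZ c1 c2 c3 BnB nnB k1 l2 l3 l4 l5 l6 l7' l8 => b1 s1 z2 z6 v2 T'; move: (n * B) nB0 => nB nB0.
by lia.
Qed.

Lemma steps_Asg x e s : steps (Asg x e) s = esz e + 2.
Proof. by []. Qed.

Lemma steps_setup_blocks p n b g a s : ctx p n b g a s ->
  steps setup_blocks s <= 300 * (2 ^ lgr p).*2.
Proof.
move=> hc; have [_ _ Z0] := lgr_sizes p.
rewrite /setup_blocks stepsSeq steps_Asg denAsg; set u := setr _ _ _.
have hR : reg u rR <= (2 ^ lgr p).*2.
  by rewrite reg_setr /= (psR (cps hc)) -addnn leq_addr.
have := leq_trans (steps_cost u (isT : static setup)) (cost_setup hR Z0).
by clearbody u; move: (steps setup u) => x hx; rewrite /=; lia.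
Qed.

Lemma steps_eval_blocks p n b g a k s B : ctx p n b g a s -> env (lgr p) k s ->
  k.+1 <= (2 ^ lgr p).*2 -> reg (den eval_blocks s) rLen = n * B + 1 ->
  n * B + 1 <= (2 ^ lgr p).*2 ^ k.+1 ->
  steps eval_blocks s <= 4000 * ((2 ^ lgr p).*2 ^ 2 * (2 ^ lgr p).*2 ^ k.+1).
Proof.
move=> hc he kZ hlen hS; have [LZ _ Z0] := lgr_sizes p.
rewrite /eval_blocks 4!denSeq den_reg // in hlen.
rewrite /eval_blocks 4!stepsSeq !steps_Asg.
set u1 := den _ (den _ (den _ s)) in hlen *.
have fu : frame [:: rLen; rY; rq] [::] s u1.
  by rewrite /u1 !denAsg; do 3 (apply: frame_trans; last by apply: frame_setr).
have hcu := ctx_frame fu hc isT; have heu := env_frame fu he isT.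
clearbody u1.
have hLu : reg u1 rL <= (2 ^ lgr p).*2 by rewrite (psL (cps hcu)).
have := leq_trans (steps_cost u1 (isT : static inv_prog)) (cost_inv_prog hLu Z0).
set u2 := den inv_prog u1 in hlen *.
have heu2 : env (lgr p) k u2 := env_frame (den_frame inv_prog u1) heu isT.
clearbody u2.
have hlen' : reg u2 rLen <= n * B + 1 by rewrite hlen.
have := leq_trans (steps_cost u2 (isT : static (chirp_prog aH)))
  (cost_chirp_prog aH heu2 kZ hlen' hS).
have : (2 ^ lgr p).*2 <= (2 ^ lgr p).*2 ^ 2 * (2 ^ lgr p).*2 ^ k.+1.
  by rewrite -mulnn -mulnA leq_pmulr // muln_gt0 Z0 expn_gt0 Z0.
move: (steps (chirp_prog _) _) (steps inv_prog _) ((2 ^ lgr p).*2 ^ 2 * _) => x y T.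
by rewrite /=; lia.
Qed.

Lemma steps_collect p n b g a s : ctx p n b g a s -> 1 < p -> p <= (2 ^ b) ^ 2 -> 1 < 2 ^ b ->
  2 ^ b <= p -> steps collect s <= 200 * (2 ^ b + 1).
Proof.
move=> hc p1 Bp B2 Bp'; have nB := nblocks_le Bp B2.
rewrite /collect 2!stepsSeq !steps_Asg; set u := den _ (den _ s).
have hJu : reg u vJ = nblocks p b.
  rewrite /u !exE /= (cP hc) (cB hc) (psU (cps hc)) modn_small // -/(nblocks p b).
  by apply: leq_ltn_trans (linear_small p1); apply: leq_trans nB _; lia.
have := leq_trans (steps_cost u (isT : static collect_loop)) (cost_collect_loop hJu).
clearbody u; move: nB; move: (nblocks p b) (steps collect_loop u) => J x; rewrite /=; lia.
Qed.

Lemma steps_setup_scan p n b g a s : ctx p n b g a s ->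
  steps setup_scan s <= 600 * (2 ^ lgr p).*2.
Proof.
move=> hc; have [LZ _ Z0] := lgr_sizes p.
rewrite /setup_scan 7!stepsSeq !steps_Asg; set u1 := den (Asg rneed _) s.
have fu : frame [:: rneed] [::] s u1 by rewrite /u1 denAsg; apply: frame_setr.
have hcu := ctx_frame fu hc isT; clearbody u1.
have hR : reg u1 rR <= (2 ^ lgr p).*2 by rewrite (psR (cps hcu)) -addnn leq_addr.
have := leq_trans (steps_cost u1 (isT : static setup)) (cost_setup hR Z0).
set u2 := den (Asg rq _) _.
have hL : reg u2 rL <= (2 ^ lgr p).*2.
  rewrite /u2 !denAsg !reg_setr /= den_reg //.
  by rewrite (psL (cps hcu)).
clearbody u2.
have := leq_trans (steps_cost u2 (isT : static inv_prog)) (cost_inv_prog hL Z0).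
set u3 := den (Asg vo _) _; clearbody u3.
move: (steps setup _) (steps inv_prog _) => x y; rewrite /=; case: ifP => _; lia.
Qed.

Lemma mainP p n s (f : {poly 'F_p}) : prime p -> 0 < n -> n <= p -> size f = n.+1 ->
  reg s rP = p -> reg s rN = n -> params_spec p s ->
  (forall j, j <= n -> mem s j = val (f`_j)%R) ->
  perm_eq (list_of aO vo (den (prepare;; setup_blocks;; block_prog;; eval_blocks;;
      collect;; setup_scan;; scan)%C s))
    [seq val x | x <- enum 'F_p & root f x] /\
  exists2 B, 0 < B ^ 2 < 4 * p &
    steps main_prog s <= 45 * 1000 * ((2 ^ lgr p).*2 ^ 7 * (n * B)).
Proof.
move=> p_pr n0 np szf hp hn hps hm; have p1 := prime_gt1 p_pr.
pose a j := val (f`_j)%R.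
have fE : pol 'F_p n.+1 a = f by apply: pol_eq => [|i _]; rewrite ?szf // natF_val.
have szf' : size (pol 'F_p n.+1 a) = n.+1 by rewrite fE.
have ap i : i <= n -> a i < p by move=> _; apply: valF_lt.
have [b [g [hc1 [Bp B4p B2] [gp pg] k1]]] := prepareP p_pr n0 hp hn hps hm.
rewrite -/a in hc1; set B := 2 ^ b in Bp B4p B2 k1.
have [LZ rhoZ Z0] := lgr_sizes p.
rewrite /main_prog 6!denSeq 7!stepsSeq; set s1 := den prepare s in hc1 *; clearbody s1.
have [q1 [he2 hN1 hk1]] := setup_blocksP p_pr n0 np Bp B4p B2 gp pg szf' hc1.
have l2 := steps_setup_blocks hc1.
set s2 := den setup_blocks s1 in he2 *.
have hc2 : ctx p n b g a s2 := ctx_frame (den_frame setup_blocks s1) hc1 isT.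
clearbody s2.
have [hC [hlen4 hq4]] := eval_blocksP p_pr n0 np Bp B4p B2 ap gp pg szf' hc2 he2 hN1 hk1.
have Bp' := block_le_prime Bp B4p.
have need1 := block_need p1 np Bp'.
have [z1 z2 z3] := env_sizes p1 need1 hk1.
set Z := (2 ^ lgr p).*2 in LZ rhoZ Z0 k1 l2 z1 z2 z3 *.
set S1 := Z ^ q1.+1 in z3.
have hNS : (2 ^ lgr p) ^ q1.+1 <= S1 by rewrite leq_exp2r // /Z -addnn leq_addr.
have l3 : steps block_prog s2 <= 4000 * (b.+1 * (Z ^ 2 * S1)).
  apply: leq_trans (steps_cost s2 (isT : static block_prog)) _.
  apply: cost_block_prog he2 z1 (cb hc2) _; rewrite (cN hc2).
  by apply: leq_trans hNS; apply: leq_trans hN1; nia.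
set s3 := den block_prog s2 in hC hlen4 hq4 *.
have hc3 : ctx p n b g a s3 := ctx_frame (den_frame block_prog s2) hc2 isT.
have he3 : env (lgr p) q1 s3 := env_frame (den_frame block_prog s2) he2 isT.
clearbody s3.
have hl3 : n * B + 1 <= S1.
  by apply: leq_trans hNS; apply: leq_trans hN1; rewrite leq_add2r leq_mul2r leqnSn orbT.
have l4 := steps_eval_blocks hc3 he3 z1 hlen4 hl3; rewrite -/Z -/S1 in l4.
set s4 := den eval_blocks s3 in hC hlen4 hq4 *.
have hc4 : ctx p n b g a s4 := ctx_frame (den_frame eval_blocks s3) hc3 isT.
clearbody s4.
have hJ := collectP p_pr n0 np Bp B4p B2 gp pg szf' hc4 hlen4 hC.
have l5 := steps_collect hc4 p1 Bp B2 Bp'; rewrite -/B in l5.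
set s5 := den collect s4 in hJ *.
have hc5 : ctx p n b g a s5 := ctx_frame (den_frame collect s4) hc4 isT.
have hq5 : ((reg s5 rq)%:R = (g%:R : 'F_p) ^+ B)%R by rewrite /s5 den_reg.
clearbody s5.
have [q2 [[he6 hN2 hk2] [hlen6 hgB6 hrq6 hqq6] hO6]] := setup_scanP p_pr n0 np Bp B4p B2 gp pg szf' hc5 hq5.
have l6 := steps_setup_scan hc5; rewrite -/Z in l6.
set s6 := den setup_scan s5 in he6 hlen6 hgB6 hrq6 hqq6 hO6 *.
have hc6 : ctx p n b g a s6 := ctx_frame (den_frame setup_scan s5) hc5 isT.
have hJ6 : list_of aJ vcnt s6 = [seq j <- iota 0 (nblocks p b) | bad p n b g a j].
  by rewrite -hJ /list_of /s6 den_reg //; apply: eq_map => i; rewrite den_arr.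
clearbody s6.
have hperm := scanP p_pr n0 np Bp B4p B2 ap gp pg szf' hc6 he6 hN2 hk2 hlen6 hgB6 hrq6 hqq6 hJ6 hO6.
rewrite fE in hperm; split; first exact: hperm.
exists B; first by rewrite expn_gt0 (ltnW B2) B4p.
have hv : reg s6 vcnt = size [seq j <- iota 0 (nblocks p b) | bad p n b g a j].
  by rewrite -hJ6 size_mkseq.
have v2n : reg s6 vcnt <= 2 * n by rewrite hv; apply: (size_bad p_pr Bp B4p pg szf').
have vB : reg s6 vcnt <= B.
  rewrite hv size_filter; apply: leq_trans (count_size _ _) _; rewrite size_iota.
  exact: nblocks_le Bp B2.
have need2 := scan_need p1 np Bp'.
have [y1 y2 y3] := env_sizes p1 need2 hk2; rewrite -/Z in y1 y2 y3.
set S2 := Z ^ q2.+1 in y3.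
have hNS2 : (2 ^ lgr p) ^ q2.+1 <= S2 by rewrite leq_exp2r // /Z -addnn leq_addr.
have l7 : steps scan s6 <= 10 + reg s6 vcnt * (4000 * (Z ^ 2 * S2)).
  apply: leq_trans (steps_cost s6 (isT : static scan)) _.
  apply: (cost_scan (len := n + 1) he6 y1 _ _ (cB hc6)) => //.
  - by rewrite hlen6.
  - by apply: leq_trans hNS2; apply: leq_trans hN2; lia.
  - by apply: leq_trans hNS2; apply: leq_trans hN2; rewrite -/B; lia.
  - by rewrite (psL (cps hc6)).
set s7 := den scan s6 in hperm *.
have vo7 : reg s7 vo <= n.
  have := perm_size hperm; rewrite /list_of size_mkseq => ->; rewrite size_map.
  have f0 : (f != 0)%R by rewrite -size_poly_gt0 szf.
  rewrite -ltnS -szf; apply: max_poly_roots => //; last by rewrite filter_uniq // enum_uniq.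
  by apply/allP => x; rewrite mem_filter => /andP[].
have l8 : steps write_out s7 <= 100 * n.+1.
  apply: leq_trans (leq_trans (steps_cost s7 (isT : static write_out)) (cost_write_out erefl)) _.
  by rewrite leq_mul2l ltnS vo7.
have bZ : b.+1 <= Z.
  apply: leq_trans LZ; rewrite -(ltn_exp2l _ _ (isT : 1 < 2)).
  exact: leq_ltn_trans Bp' (bitlen_gt p).
exact: (main_arith Z0 n0 B2 bZ v2n vB z3 y3 k1 l2 l3 l4 l5 l6 l7 l8).
Qed.

Lemma steps_params p s : reg s rP = p -> p < 2 ^ (2 ^ lgr p) ->
  steps params s <= 300 * (2 ^ lgr p).*2.
Proof.
move=> hp pr; have [_ hps] := paramsP hp pr; have [LZ rhoZ Z0] := lgr_sizes p.
have h1 := psrho hps; have h2 := psR hps.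
rewrite /params 10!denSeq in h1 h2; rewrite /params 10!stepsSeq !steps_Asg.
set u1 := den (Asg rrho #0%X) _ in h1 h2 *; set u2 := den (Asg rR _) _ in h1 h2 *.
set u3 := den (Asg rM #1%X) _ in h1 h2 *.
have e1 : reg u1 rL = bitlen p by rewrite /u1 denAsg denBits !reg_setr /= hp.
have e3 : reg u3 rR = 2 ^ lgr p by rewrite -h2; do 3! rewrite [RHS]den_reg //.
have e2 : reg u2 rrho = lgr p by rewrite -h1; do 3! rewrite [RHS]den_reg //; rewrite /u3; do 3! rewrite [RHS]den_reg //.
have RZ : 2 ^ lgr p <= (2 ^ lgr p).*2 by rewrite -addnn leq_addr.
clear h1 h2; clearbody u3; clearbody u2; clearbody u1.
set c1 := For _ _ _; set c2 := For _ _ _; set c3 := For _ _ _.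
have := @steps_cost c1 u1 isT; have := @steps_cost c2 u2 isT; have := @steps_cost c3 u3 isT.
move: (steps c1 u1) (steps c2 u2) (steps c3 u3) => x1 x2 x3.
by rewrite /= !evVar e1 e2 e3 hp; lia.
Qed.

(** [vt] is reset because [params_spec] is silent on its last value, whereas [words] asks for a
    bound on every register. *)
Definition program : com := (params;; vt ::= #0;; main_prog;; rP ::= vo)%C.

Lemma program_words p s : reg s rP = p -> p < 2 ^ (2 ^ lgr p) ->
  (forall x, x < nvars -> reg s x <= p) -> (forall a, mem s a <= p) ->
  words (2 ^ lgr p).+2 (den (Asg vt #0%X) (den params s)).
Proof.
move=> hp pr hreg hmem; have [_ [h1 h2 h3 h4 h5 h6]] := paramsP hp pr.
have [LZ rhoZ Z0] := lgr_sizes p.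
have pw : p < 2 ^ (2 ^ lgr p).+2 by apply: leq_trans pr _; rewrite leq_exp2l //; lia.
have Zw : (2 ^ lgr p).*2 < 2 ^ (2 ^ lgr p).+2.
  by rewrite -addnn !expnS; have := ltn_expl (2 ^ lgr p) (isT : 1 < 2); lia.
rewrite denAsg; split=> [x hx|a]; last first.
  have mE st : mem st a = arr (a %% 16) st (a %/ 16) by rewrite /arr /cell -divn_eq.
  by rewrite [mem _ _]mE -[arr _ _ _]/(arr (a %% 16) (den params s) _) den_arr ?ltn_mod // -mE (leq_ltn_trans (hmem a)).
have [->|xt] := eqVneq x vt; first by rewrite reg_setr /= expn_gt0.
rewrite reg_setr (negbTE xt).
have [hw|hw] := boolP (x \in wr params); last by rewrite den_reg // (leq_ltn_trans (hreg x hx)).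
have : x \in [:: rL; rrho; rR; rR2; rM; rU; vt] by move: hw; rewrite !inE; lia.
rewrite !inE (negbTE xt) orbF.
case/or4P=> [/eqP->|/eqP->|/eqP->|]; rewrite ?h1 ?h2 ?h3; [lia..|lia|].
case/or3P=> [/eqP->|/eqP->|/eqP->]; rewrite ?h4 ?h5 ?h6 //.
  have := ltn_expl (2 ^ lgr p) (isT : 1 < 2); rewrite !(expnS 2 _.+1, expnS 2 (2 ^ _)).
  by move: (2 ^ 2 ^ lgr p) => X; lia.
by rewrite ltn_exp2l.
Qed.

Lemma den_main_prog s : den main_prog s = den write_out
  (den (prepare;; setup_blocks;; block_prog;; eval_blocks;; collect;; setup_scan;; scan)%C s).
Proof. by rewrite /main_prog; do 7! rewrite [in LHS]denSeq; do 6! rewrite [in RHS]denSeq. Qed.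

(** The exponent 13 is 7 from the step count, 2 from the squared word length [6 * r.+2], and 4 to
    swallow the numerical constants, as [2 r >= 128]. *)
Lemma program_arith r N x y :
  64 <= r -> 0 < N -> x <= 300 * r.*2 -> y <= 45 * 1000 * (r.*2 ^ 7 * N) ->
  2 * (6 * r.+2).-1.+1 ^ 2 * (x + (esz #0%X + 2 + (y + (esz vo + 2)))) <= r.*2 ^ 13 * N.
Proof.
move=> r64 N0 hx hy; rewrite [esz _]/= [esz _]/=; set Z := r.*2 in hx hy *.
have Z128 : 128 <= Z by rewrite /Z -addnn; lia.
have Z0 : 0 < Z by lia.
have T1 : Z <= Z ^ 7 * N by rewrite expnS -mulnA leq_pmulr // muln_gt0 expn_gt0 Z0 N0.
have rZ : r.+2 <= Z by rewrite /Z -addnn; lia.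
have hs : x + (1 + 2 + (y + (2 + 2))) <= 46 * 1000 * (Z ^ 7 * N).
  by move: (Z ^ 7 * N) T1 hy => T; lia.
have -> : (6 * r.+2).-1.+1 = 6 * r.+2 by lia.
rewrite (expnD Z 6 7) (expnD Z 4 2).
apply: (@leq_trans (72 * Z ^ 2 * (46 * 1000 * (Z ^ 7 * N)))).
  by apply: leq_mul hs; rewrite expnMn mulnA leq_mul2l leq_exp2r // rZ orbT.
rewrite mulnACA [X in _ <= X](_ : _ = Z ^ 4 * (Z ^ 2 * (Z ^ 7 * N))); last by rewrite !mulnA.
rewrite leq_mul2r; apply/orP; right.
have z1000 : 1000 <= Z * Z by apply: leq_trans (leq_mul (_ : 32 <= Z) (_ : 32 <= Z)); lia.
rewrite (expnD Z 1 3) (expnD Z 1 2) -mulnn; apply: leq_mul; first lia.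
by apply: leq_mul; first lia.
Qed.

Lemma programP p n (f : {poly 'F_p}) : prime p -> 0 < n -> n <= p -> size f = n.+1 ->
  exists s t, [/\ exec (compile nvars program) (input f) s t,
    perm_eq (output s) [seq val x | x <- enum 'F_p & root f x] &
    exists2 B, 0 < B ^ 2 < 4 * p & t <= (2 ^ lgr p).*2 ^ 13 * (n * B)].
Proof.
move=> p_pr n0 np szf; set s0 := input f; have p0 := prime_gt0 p_pr.
have hp : reg s0 rP = p by []. have hn : reg s0 rN = n by rewrite /= szf.
have pr : p < 2 ^ (2 ^ lgr p).
  apply: leq_trans (bitlen_gt p) _; rewrite leq_exp2l //.
  by have := radix_large (bitlen p); rewrite -/(lgr p); lia.
have r64 : 64 <= 2 ^ lgr p by rewrite /lgr addnC expnD leq_pmulr // expn_gt0.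
have [LZ rhoZ Z0] := lgr_sizes p; have k0 := steps_params hp pr.
have [hok0 hps0] := paramsP hp pr.
have ww := program_words hp pr.
set s1 := den (Asg vt #0%X) (den params s0) in ww.
have {}ww : words (2 ^ lgr p).+2 s1.
  apply: ww => [x _|a].
    by rewrite /= /update; case: ifP => // _; case: ifP => // _; rewrite szf.
  by rewrite /= ltnW // valF_lt.
have s1r x : x != vt -> reg s1 x = reg (den params s0) x.
  by move=> xt; rewrite /s1 denAsg reg_setr (negbTE xt).
have ps1 : params_spec p s1 by case: hps0 => *; split; rewrite s1r.
have hp1 : reg s1 rP = p by rewrite s1r // den_reg.
have hn1 : reg s1 rN = n by rewrite s1r // den_reg.
have hm1 j : mem s1 j = val (f`_j)%R.
  have mE st : mem st j = arr (j %% 16) st (j %/ 16) by rewrite /arr /cell -divn_eq.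
  by rewrite mE -[arr _ _ _]/(arr (j %% 16) (den params s0) _) den_arr ?ltn_mod // -mE.
have pos1 : positive [:: rP; rU; rM] s1.
  move=> y; rewrite !inE => /or3P[] /eqP->; rewrite ?hp1 ?(psU ps1) ?(psM ps1) //.
  by rewrite expn_gt0.
have w6 : 6 <= (2 ^ lgr p).+2 by lia.
have [hok1 w1 _] := tcP w6 ww pos1 (isT : tc [:: rP; rU; rM] main_prog).
have [hperm [B B4p k1]] := mainP p_pr n0 np szf hp1 hn1 ps1 (fun j _ => hm1 j).
have pos0 : positive [::] (den main_prog s1) by [].
have [hok2 _ _] := tcP w6 w1 pos0 (isT : tc [::] (Asg rP vo)).
have okvt : okc (6 * (2 ^ lgr p).+2) (Asg vt #0%X) (den params s0).
  by split; rewrite //= expn_gt0.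
have ok : okc (6 * (2 ^ lgr p).+2).-1.+1 program s0.
  have W1 : 0 < 6 * (2 ^ lgr p).+2 by rewrite muln_gt0.
  rewrite (prednK W1) /program 3!okSeq.
  by split; [exact: hok0|split; [exact: okvt|split; [exact: hok1|exact: hok2]]].
have W0 : 0 < (6 * (2 ^ lgr p).+2).-1 by lia.
have [ls [t [he [hsr hsm] _ ht]]] := compileP W0 (leqnn _) (conj (fun _ _ => erefl) erefl : sim s0 s0) ok.
exists ls, t; split=> //.
  move: hsr hsm; rewrite /program 3!denSeq -/s1 => hsr hsm.
  rewrite /output hsm hsr // denAsg.
  rewrite den_main_prog; move: hperm; rewrite -write_outP.
  by move: (den write_out _) => s2.
exists B; first exact: B4p.
apply: leq_trans ht _; rewrite /program 3!stepsSeq !steps_Asg -/s1.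
have nB0 : 0 < n * B by case/andP: B4p; rewrite muln_gt0 n0 expn_gt0 orbF.
exact: (program_arith r64 nB0 k0 k1).
Qed.

From mathcomp Require Import all_classical all_reals all_analysis.
Import Defs.
Import Order.TTheory GRing.Theory Num.Theory.
Import numFieldNormedType.Exports.

(** * The degree is at most [p] *)

Lemma not_uniq_perm (T : eqType) (s : seq T) : ~~ uniq s ->
  exists x s', perm_eq s [:: x, x & s'].
Proof.
elim: s => //= y s IH; rewrite negb_and negbK; case/orP => [ys|/IH [x [s' h]]].
  by exists y, (rem y s); rewrite perm_cons perm_to_rem.
exists x, (y :: s'); rewrite -(perm_cons y) in h; apply: perm_trans h _.
by rewrite -(perm_catCA [:: x; x] [:: y] s').
Qed.

(** A repeated root would put the square of a linear factor into [f]; so the roots are distinct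
    elements of a set of size [p]. *)
Lemma squarefree_split_size p (f : {poly 'F_p}) : prime p ->
  squarefree_poly f -> fully_splits f -> size f <= p.+1.
Proof.
move=> p_pr sqf [gs hgs fE]; pose rt (g : {poly 'F_p}) := (- (g`_0 / g`_1))%R.
pose P := (\prod_(x <- map rt gs) ('X - x%:P))%R.
have fP : (f = (\prod_(g <- gs) g`_1) *: P)%R.
  rewrite /P big_map -scaler_prod fE; apply: eq_big_seq => g /hgs sg.
  have g1 : (g`_1 != 0)%R by rewrite -[1]/(2.-1) -sg -lead_coefE lead_coef_eq0 -size_poly_gt0 sg.
  apply/polyP => -[|[|i]]; rewrite coefZ coefB coefX coefC /=.
  - by rewrite sub0r /rt opprK mulrCA divff ?mulr1.
  - by rewrite subr0 mulr1.
  - by rewrite nth_default ?sg // subr0 mulr0.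
have urt : uniq (map rt gs).
  apply: contraT => /not_uniq_perm [x [s' hs]].
  have : (('X - x%:P) ^+ 2 %| f)%R.
    rewrite fP -mul_polyC dvdp_mull // /P (perm_big _ hs) !big_cons /= mulrA -expr2.
    exact: dvdp_mulIl.
  by move/sqf; rewrite size_XsubC.
apply: leq_trans (_ : size P <= _); first by rewrite fP; apply: size_scale_leq.
have : size (map rt gs) <= #|'F_p| by rewrite -(card_uniqP urt) max_card.
by rewrite card_Fp // size_prod_XsubC.
Qed.

(** * The exponent [1/2 + o(1)] *)

(** With [2 r = 2 ^ (t + 7)], the factor [(2 r) ^ 13] is [2 ^ (13 t + 91)]; one more power of 2
    comes from [B < 2 sqrt p]. *)
Definition overhead (n : nat) : nat := 13 * isqrt (bitlen n) + 92.

(** With [t = isqrt (bitlen n) >= 1] the left side is at most [105 t ^ 2], and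
    [t ^ 2 <= bitlen n <= 2 * trunc_log 2 n]. *)
Lemma overhead_le n : 1 < n ->
  overhead n * isqrt (bitlen n) <= 210 * trunc_log 2 n.
Proof.
move=> n1; have h : 0 < trunc_log 2 n by rewrite trunc_log_gt0.
have /andP[h1 h2] := isqrt_bounds (bitlen n).
have t1 : 0 < isqrt (bitlen n) by case: isqrt h2.
have : bitlen n <= 2 * trunc_log 2 n by rewrite /bitlen; lia.
by rewrite /overhead; move: h1; rewrite -mulnn; nia.
Qed.

Lemma isqrt_large T n : 2 ^ (T ^ 2) <= n -> T <= isqrt (bitlen n).
Proof.
move=> h; have := leq_ltn_trans h (bitlen_gt n); rewrite ltn_exp2l // => hT.
have /andP[_ h2] := isqrt_bounds (bitlen n).
by have := ltn_trans hT h2; rewrite ltn_exp2r // ltnS.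
Qed.

Local Open Scope classical_set_scope.
Local Open Scope ring_scope.

(** The exponent [e] for which [n ^ e] is [2 ^ overhead n]. Numerator and denominator grow like the
    square root of [log n] and like [log n], so it tends to 0. *)
Definition slack (R : realType) (n : nat) : R := (overhead n)%:R * ln 2 / ln n%:R.

Lemma slack_le (R : realType) n : (1 < n)%N ->
  slack R n <= 210 / (isqrt (bitlen n))%:R.
Proof.
move=> n1; have l2 : 0 < ln (2 : R) by rewrite ln_gt0 ?ltr1n.
have n0 : 0 < n%:R :> R by rewrite ltr0n ltnW.
have t0 : (0 < isqrt (bitlen n))%N by have /andP[_] := isqrt_bounds (bitlen n); case: isqrt.
have ll : (trunc_log 2 n)%:R * ln 2 <= ln (n%:R : R).
  rewrite mulr_natl -lnXn // ler_ln ?posrE ?exprn_gt0 // -natrX ler_nat.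
  by apply: trunc_logP => //; apply: ltnW.
have := overhead_le n1; rewrite -(ler_nat R) !natrM; have := ler0n R 210.
move: 210%:R => c c0 h.
rewrite /slack ler_pdivrMr ?ln_gt0 ?ltr1n // mulrAC ler_pdivlMr ?ltr0n //.
rewrite mulrAC; apply: le_trans (_ : _ <= c * ((trunc_log 2 n)%:R * ln 2)) _.
  by rewrite mulrA ler_wpM2r // ltW.
by rewrite ler_wpM2l.
Qed.

Lemma slack_ge0 (R : realType) n : 0 <= slack R n.
Proof.
case: n => [|n]; first by rewrite /slack (@ln0 _ 0) ?invr0 ?mulr0.
by rewrite /slack divr_ge0 // ?mulr_ge0 // ?ln_ge0 // ?ler1n.
Qed.

Lemma slack_cvg (R : realType) : slack R n @[n --> \oo] --> (0 : R).
Proof.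
apply/cvgrPdist_lt => e e0; near=> n.
have n1 : (1 < n)%N by near: n; apply: nbhs_infty_gt.
rewrite sub0r normrN ger0_norm ?slack_ge0 //; apply: le_lt_trans (slack_le _ n1) _.
(* From [n >= 2 ^ (T ^ 2)] on, the integer square root of the bit length is at least
   [T > 210 / e]. *)
pose T := (Num.truncn (210 / e)).+1.
have hT : (T <= isqrt (bitlen n))%N.
  by apply: isqrt_large; near: n; apply: nbhs_infty_ge.
have T0 : 0 < (isqrt (bitlen n))%:R :> R by rewrite ltr0n; apply: leq_trans hT.
rewrite ltr_pdivrMr // mulrC -ltr_pdivrMr //.
apply: lt_le_trans (truncnS_gt _) _; by rewrite ler_nat.
Unshelve. all: by end_near.
Qed.

Lemma powR_slack (R : realType) p n t B : (1 < p)%N -> (0 < B ^ 2 < 4 * p)%N ->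
  (t <= (2 ^ lgr p).*2 ^ 13 * (n * B))%N ->
  t%:R <= n%:R * p%:R `^ (2^-1 + slack R p).
Proof.
move=> p1 /andP[_ B4p] ht; have p0 : 0 < p%:R :> R by rewrite ltr0n ltnW.
have lp : ln (p%:R : R) != 0 by rewrite gt_eqF // ln_gt0 ?ltr1n.
rewrite powRD; last by rewrite (gt_eqF p0) implybT.
rewrite powR12_sqrt ?(ltW p0) //.
have -> : p%:R `^ slack R p = 2 ^+ overhead p.
  rewrite /powR gt_eqF // /slack mulfVK // mulr_natl -lnXn // lnK // posrE exprn_gt0 //.
have hB : B%:R <= 2 * Num.sqrt p%:R :> R.
  rewrite -(@ler_pXn2r _ 2) ?nnegrE ?mulr_ge0 ?sqrtr_ge0 //.
  have : (B ^ 2)%:R <= (4 * p)%:R :> R by rewrite ler_nat ltnW.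
  by rewrite natrX natrM exprMn sqr_sqrtr ?(ltW p0) // -[2 ^+ 2]natrX.
have ht' : (t <= 2 ^ (13 * isqrt (bitlen p) + 91) * (n * B))%N.
  apply: leq_trans ht _; rewrite -mul2n -expnS -expnM leq_mul2r.
  apply/orP; right; rewrite leq_exp2l; last by [].
  by rewrite /lgr; move: (isqrt _) => u; lia.
move: ht'; rewrite -(ler_nat R) => /le_trans; apply.
rewrite natrM natrX natrM mulrCA ler_wpM2l //.
have -> : overhead p = (13 * isqrt (bitlen p) + 91).+1 by rewrite /overhead addnS.
rewrite exprS mulrA [X in _ <= X]mulrC [_ * 2]mulrC.
by apply: ler_wpM2l => //; rewrite exprn_ge0.
Qed.

Theorem theorem6 :
  exists A : cmd,
  forall R : realType,
  exists eps : nat -> R,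
    (eps n @[n --> \oo] --> (0 : R)) /\
    forall (p n : nat) (f : {poly 'F_p}),
      prime p -> (1 <= n)%N -> size f = n.+1 ->
      squarefree_poly f -> fully_splits f ->
      exists (s : state) (t : nat),
        [/\ exec A (input f) s t,
            perm_eq (output s) [seq val x | x <- enum 'F_p & root f x] &
            t%:R <= n%:R * p%:R `^ (2^-1 + eps p)].
Proof.
exists (compile nvars program) => R; exists (slack R); split; first exact: slack_cvg.
move=> p n f p_pr n0 szf sqf spl.
have np : (n <= p)%N by have := squarefree_split_size p_pr sqf spl; rewrite szf ltnS.
have [s [t [he hperm [B hB ht]]]] := programP p_pr n0 np szf.
by exists s, t; split=> //; apply: powR_slack hB ht; apply: prime_gt1.
Qed.
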